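(* Suppose $q=a+v\in\mathbb{H}_{\mathbb R}$ (scalar part $a$, vector part $v$) with $a\ge2$, where $v$ is fixed. (1) In the Fourier domain, the quaternionic B-splines $B_q$ converge in $L^p$-norm, $1\le p\le\infty$, to a modulated Gaussian: $$\left\|\widehat{B_q}\!\left(\frac{\cdot}{\sqrt a}\right)-e^{-i\sqrt a(\cdot)/2}\,e^{-(\cdot)^2/24}\,e^{-i(\cdot)v/(2\sqrt a)}\,e^{-(\cdot)^2v/(24a)}\right\|_p\to0\quad\text{as }a\to\infty.$$ (2) In the time domain, the quaternionic B-splines converge in $L^{p'}$-norm, $2\le p'\le\infty$, to a modulated Gaussian: $$\left\|\sqrt a\,B_q(\sqrt a\,(\cdot))-\frac{2\sqrt3\sqrt{\pi a}}{|q|\sqrt{a+|q|}}\,(a-v+|q|)\,e^{-3(a+v)/2}\,e^{6\sqrt a(\cdot)}\,e^{-6a(\cdot)^2(a-v)/(a^2+|v|^2)}\right\|_{p'}\to0\quad\text{as }a\to\infty.$$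
   Context: $\mathbb{H}_{\mathbb R}$ is the real quaternion algebra with basis $1,e_1,e_2,e_3$, and $\mathbb{H}_{\mathbb C}$ is its complexification (the complex unit $i$ commutes with $e_1,e_2,e_3$), with $|p|^2=\sum_{j=0}^3|p_j|^2$ for $p=p_0+\sum_{j=1}^3p_je_j$. For $z\in\mathbb{C}$ and $q=a+v$ with scalar part $a$ and vector part $v$, $z^q:=z^a[\cos(|v|\log z)+\frac{v}{|v|}\sin(|v|\log z)]\in\mathbb{H}_{\mathbb C}$ (principal branch; second term $0$ if $v=0$; $0^q:=0$ if $a>0$). The quaternionic B-spline $B_q$ is the function with Fourier transform $\widehat{B_q}(\xi)=\left(\frac{1-e^{-i\xi}}{i\xi}\right)^q$ (base equal to $1$ at $\xi=0$), where $\widehat f(\xi)=\int_{\mathbb R}f(x)e^{-i\xi x}\,dx$. For $p\in\mathbb{H}_{\mathbb C}$, $e^p=\sum_{j\ge0}p^j/j!$. Norms are those of $L^p(\mathbb{R},\mathbb{H}_{\mathbb C})$, computed using $|\cdot|$ on $\mathbb{H}_{\mathbb C}$; $(\cdot)$ stands for the real variable.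
   Formalization: In part (2) the limiting modulated Gaussian is multiplied by 1/(2π): with the stated Fourier convention the printed formula is too large by the factor 2π (for v=0 its integral is 2π, while that of √a B_a(√a·) is 1), so the printed convergence fails. *)

(* Defs.v *)
From HB Require Import structures.
From mathcomp Require Import all_boot all_order all_algebra.
From mathcomp Require Import all_classical all_reals all_analysis.
From mathcomp Require Import ring.
From mathcomp.real_closed Require Import complex.

Set Implicit Arguments.
Unset Strict Implicit.
Unset Printing Implicit Defensive.

Import Order.TTheory GRing.Theory Num.Theory.
Import numFieldNormedType.Exports.

Local Open Scope classical_set_scope.
Local Open Scope ring_scope.
Local Open Scope complex_scope.

(* Quat p0 p1 p2 p3 = p0 + p1 e_1 + p2 e_2 + p3 e_3 *)
Record quat (K : Type) := Quat { q0 : K; q1 : K; q2 : K; q3 : K }.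

Definition quat_map (K L : Type) (f : K -> L) (p : quat K) : quat L :=
  Quat (f (q0 p)) (f (q1 p)) (f (q2 p)) (f (q3 p)).

Definition quat_to_prod (K : Type) (p : quat K) := (q0 p, q1 p, q2 p, q3 p).
Definition prod_to_quat (K : Type) (t : K * K * K * K) : quat K :=
  let: (a, b, c, d) := t in Quat a b c d.

Lemma quat_to_prodK (K : Type) :
  cancel (@quat_to_prod K) (@prod_to_quat K).
Proof. by case. Qed.

HB.instance Definition _ (K : choiceType) :=
  Choice.copy (quat K) (can_type (@quat_to_prodK K)).

Section QuatAlgebra.
Variable K : comNzRingType.
Implicit Types p q : quat K.

Definition quat_zero : quat K := Quat 0 0 0 0.
Definition quat_opp p : quat K := quat_map -%R p.
Definition quat_add p q : quat K :=
  Quat (q0 p + q0 q) (q1 p + q1 q) (q2 p + q2 q) (q3 p + q3 q).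
Definition quat_scale (k : K) p : quat K := quat_map ( *%R k) p.
Definition quat_one : quat K := Quat 1 0 0 0.

(* K-bilinear, e_1^2 = e_2^2 = e_3^2 = e_1 e_2 e_3 = -1 *)
Definition quat_mul p q : quat K :=
  Quat (q0 p * q0 q - q1 p * q1 q - q2 p * q2 q - q3 p * q3 q)
       (q0 p * q1 q + q1 p * q0 q + q2 p * q3 q - q3 p * q2 q)
       (q0 p * q2 q - q1 p * q3 q + q2 p * q0 q + q3 p * q1 q)
       (q0 p * q3 q + q1 p * q2 q - q2 p * q1 q + q3 p * q0 q).

Local Ltac quat_ring :=
  repeat case=> ? ? ? ?; rewrite /quat_mul /quat_add /quat_opp /quat_scale;
  rewrite /quat_map /quat_zero /quat_one /=; congr Quat; ring.

Lemma quat_addA : associative quat_add. Proof. by quat_ring. Qed.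
Lemma quat_addC : commutative quat_add. Proof. by quat_ring. Qed.
Lemma quat_add0l : left_id quat_zero quat_add. Proof. by quat_ring. Qed.
Lemma quat_addNl : left_inverse quat_zero quat_opp quat_add.
Proof. by quat_ring. Qed.

HB.instance Definition _ := GRing.isZmodule.Build (quat K)
  quat_addA quat_addC quat_add0l quat_addNl.

Lemma quat_mulA : associative quat_mul. Proof. by quat_ring. Qed.
Lemma quat_mul1l : left_id quat_one quat_mul. Proof. by quat_ring. Qed.
Lemma quat_mul1r : right_id quat_one quat_mul. Proof. by quat_ring. Qed.
Lemma quat_mulDl : left_distributive quat_mul quat_add.
Proof. by quat_ring. Qed.
Lemma quat_mulDr : right_distributive quat_mul quat_add.
Proof. by quat_ring. Qed.
Lemma quat_one_neq0 : quat_one != quat_zero.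
Proof. by apply/eqP => -[] /eqP; rewrite oner_eq0. Qed.

HB.instance Definition _ := GRing.Zmodule_isNzRing.Build (quat K)
  quat_mulA quat_mul1l quat_mul1r quat_mulDl quat_mulDr quat_one_neq0.

Lemma quat_scaleA (k l : K) p :
  quat_scale k (quat_scale l p) = quat_scale (k * l) p.
Proof. by move: p; quat_ring. Qed.
Lemma quat_scale1 : left_id 1 quat_scale. Proof. by quat_ring. Qed.
Lemma quat_scaleDr : right_distributive quat_scale quat_add.
Proof. by move=> k; quat_ring. Qed.
Lemma quat_scaleDl p (k l : K) :
  quat_scale (k + l) p = quat_add (quat_scale k p) (quat_scale l p).
Proof. by move: p; quat_ring. Qed.

HB.instance Definition _ := GRing.Zmodule_isLmodule.Build K (quat K)
  quat_scaleA quat_scale1 quat_scaleDr quat_scaleDl.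

Lemma quat_scaleAl (k : K) p q :
  quat_scale k (quat_mul p q) = quat_mul (quat_scale k p) q.
Proof. by move: p q; quat_ring. Qed.

HB.instance Definition _ :=
  GRing.Lmodule_isLalgebra.Build K (quat K) quat_scaleAl.

Lemma quat_scaleAr (k : K) p q :
  quat_scale k (quat_mul p q) = quat_mul p (quat_scale k q).
Proof. by move: p q; quat_ring. Qed.

HB.instance Definition _ :=
  GRing.Lalgebra_isAlgebra.Build K (quat K) quat_scaleAr.

Definition scalar_part p : K := q0 p.
Definition vector_part p : quat K := Quat 0 (q1 p) (q2 p) (q3 p).

End QuatAlgebra.

Local Notation Re := complex.Re.
Local Notation Im := complex.Im.

(* H_R is quat R and H_C is quat R[i]. *)
Section Quaternions.
Variable R : realType.

Definition toHC (q : quat R) : quat R[i] := quat_map (real_complex R) q.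

(* |p|^2 = |p_0|^2 + |p_1|^2 + |p_2|^2 + |p_3|^2 with complex moduli; on H_R this
   is used through toHC *)
Definition qnorm (p : quat R[i]) : R :=
  Num.sqrt (Normc.normc (q0 p) ^+ 2 + Normc.normc (q1 p) ^+ 2
            + Normc.normc (q2 p) ^+ 2 + Normc.normc (q3 p) ^+ 2).

Definition cexp (z : R[i]) : R[i] :=
  (expR (Re z))%:C * ((cos (Im z)) +i* (sin (Im z))).

Definition ccos (z : R[i]) : R[i] := (cexp ('i%C * z) + cexp (- ('i%C * z))) / 2.
Definition csin (z : R[i]) : R[i] :=
  (cexp ('i%C * z) - cexp (- ('i%C * z))) / (2 * 'i%C).

(* Principal argument, in ]-pi, pi]; junk at 0. *)
Definition carg (z : R[i]) : R :=
  let t := acos (Re z / Normc.normc z) in if 0 <= Im z then t else - t.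

Definition clog (z : R[i]) : R[i] := (ln (Normc.normc z)) +i* (carg z).

(* The case z = 0 is meaningful only when the scalar part of q is positive.  If
   v = 0, the second term vanishes since then also v / |v| = 0. *)
Definition qpow (z : R[i]) (q : quat R) : quat R[i] :=
  let a := scalar_part q in
  let v := toHC (vector_part q) in
  if z == 0 then 0 else
  cexp (a%:C * clog z) *:
    ((ccos ((qnorm v)%:C * clog z))%:A
     + csin ((qnorm v)%:C * clog z) *: (((qnorm v)^-1)%:C *: v)).

Definition clim (u : nat -> R[i]) : R[i] :=
  lim (Re (u n) @[n --> \oo]) +i* lim (Im (u n) @[n --> \oo]).

Definition qexp (p : quat R[i]) : quat R[i] :=
  let S n : quat R[i] := \sum_(0 <= k < n) (k`!%:R^-1 : R[i]) *: p ^+ k in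
  Quat (clim (fun n => q0 (S n))) (clim (fun n => q1 (S n)))
       (clim (fun n => q2 (S n))) (clim (fun n => q3 (S n))).

Definition cintegrable (f : R -> R[i]) : Prop :=
  lebesgue_measure.-integrable setT (fun x : R => (Re (f x))%:E) /\
  lebesgue_measure.-integrable setT (fun x : R => (Im (f x))%:E).

Definition cintegral (f : R -> R[i]) : R[i] :=
  Rintegral lebesgue_measure setT (fun x : R => Re (f x))
  +i* Rintegral lebesgue_measure setT (fun x : R => Im (f x)).

Definition HC_integrable (f : R -> quat R[i]) : Prop :=
  [/\ cintegrable (fun x => q0 (f x)), cintegrable (fun x => q1 (f x)),
      cintegrable (fun x => q2 (f x)) & cintegrable (fun x => q3 (f x))].

Definition HC_integral (f : R -> quat R[i]) : quat R[i] :=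
  Quat (cintegral (fun x => q0 (f x))) (cintegral (fun x => q1 (f x)))
       (cintegral (fun x => q2 (f x))) (cintegral (fun x => q3 (f x))).

Definition fourier (f : R -> quat R[i]) (xi : R) : quat R[i] :=
  HC_integral (fun x => cexp (- ('i%C * (xi * x)%:C)) *: f x).

Definition bspline_base (xi : R) : R[i] :=
  if xi == 0 then 1 else (1 - cexp (- ('i%C * xi%:C))) / ('i%C * xi%:C).

(* Determines f up to a Lebesgue-null set. *)
Definition is_bspline (q : quat R) (f : R -> quat R[i]) : Prop :=
  HC_integrable f /\ forall xi, fourier f xi = qpow (bspline_base xi) q.

Definition HC_Lnorm (p : \bar R) (f : R -> quat R[i]) : \bar R :=
  Lnorm (@lebesgue_measure R) p (EFin \o (fun x => qnorm (f x))).

(* The Gaussians below have q = a + v. *)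
Definition gauss_freq (q : quat R) (xi : R) : quat R[i] :=
  let a := scalar_part q in
  let v := toHC (vector_part q) in
  (cexp (- ('i%C * (Num.sqrt a * xi / 2)%:C)) * (expR (- (xi ^+ 2 / 24)))%:C) *:
    (qexp (- ('i%C * (xi / (2 * Num.sqrt a))%:C) *: v)
     * qexp ((- (xi ^+ 2 / (24 * a)))%:C *: v)).

(* This is the inverse Fourier transform of gauss_freq q.  The leading (2 * pi)^-1
   is the constant of Fourier inversion for the convention chosen in [fourier]:
   the formula without it has Fourier transform 2 * pi * gauss_freq q, and for
   v = 0 integral 2 * pi, whereas x |-> sqrt a * B_a (sqrt a * x) has integral 1. *)
Definition gauss_time (q : quat R) (x : R) : quat R[i] :=
  let a := scalar_part q in
  let v := toHC (vector_part q) in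
  let nq := qnorm (toHC q) in
  (((2 * pi)^-1
    * (2 * Num.sqrt 3 * Num.sqrt (pi * a) / (nq * Num.sqrt (a + nq))))%:C
   * (expR (6 * Num.sqrt a * x))%:C) *:
    ((a%:C%:A - v + nq%:C%:A)
     * qexp ((- (3 / 2))%:C *: (a%:C%:A + v))
     * qexp ((- (6 * a * x ^+ 2 / (a ^+ 2 + qnorm v ^+ 2)))%:C
             *: (a%:C%:A - v))).

End Quaternions.

(* Main.v *)
(** All quaternions in sight lie in the commutative subalgebra spanned by [1]
    and a unit vector [n = v / |v|], on which [x + y n |-> (x + i y, x - i y)] is
    an isomorphism onto [C x C].  It turns [z ^ (a + v)] into the pair
    [z ^ (a + i m), z ^ (a - i m)] with [m = |v|], and both Gaussians into pairs of
    complex Gaussians, so everything reduces to complex exponents.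

    There the difference of the two sides in the Fourier domain is at most
    [e / (1 + xi ^ 2)] for all [xi], once [a] is large.  For bounded [xi] this comes
    from expanding the logarithm of [(1 - exp (- i u)) / (i u) =
    exp (- i u / 2) sin (u / 2) / (u / 2)] at [u = xi / sqrt a]; for the other [xi]
    both terms decay like [(1 + xi ^ 2) ^ (-2)], uniformly in [a].  Integrating the
    bound gives the first claim.

    The Gaussian of the second claim has the one of the first as Fourier transform.
    Inversion bounds the difference in the time domain almost everywhere, a
    Plancherel inequality bounds its square norm, and the other norms lie in between.
    Inversion and Plancherel are needed only for integrable functions whose transform
    is [O(1 / (1 + xi ^ 2))], where Abel summation proves them. *)

From HB Require Import structures.
Require Import Defs.
From mathcomp Require Import all_boot all_order all_algebra.
From mathcomp Require Import all_classical all_reals all_analysis.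
From mathcomp Require Import measurable_realfun ess_sup_inf.
From mathcomp Require Import ring lra.
From mathcomp.real_closed Require Import complex.

Set Implicit Arguments.
Unset Strict Implicit.
Unset Printing Implicit Defensive.

Import Order.TTheory GRing.Theory Num.Theory.
Import numFieldNormedType.Exports.

Local Open Scope classical_set_scope.
Local Open Scope ring_scope.
Local Open Scope complex_scope.

Local Notation Re := complex.Re.
Local Notation Im := complex.Im.
Local Notation normc := Normc.normc.

(** * Integrals over the real line *)

Section RealIntegrals.
Context {R : realType}.
Local Notation mu := (@lebesgue_measure R).
Implicit Types (D : set R) (f g F : R -> R).

(** The weight [1 / (1 + xi ^ 2)] is bounded by 1 and each of its powers with exponent at least 1
    has integral at most [pi]. One pointwise estimate therefore serves all [p] at once and also
    feeds the time domain. Against the decay [(1 + xi ^ 2) ^ (-2)] it leaves one power to spare, and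
    this power makes the tails small. Expanding the logarithm is safe although it is multiplied by
    the large [a]: for [|u| <= 1] the argument of the base is exactly [- u / 2], so only the
    logarithm of its modulus is approximated, with error at most [u ^ 4]. At [u = xi / sqrt a] the
    factor [a] turns this into [xi ^ 4 / a]. The vector part enters through [exp (- b arg z)],
    bounded independently of [a]. The spline is known only as an integrable function with a given
    transform, hence only almost everywhere. Inversion is therefore proved for integrals over
    segments and passed to almost every point by differentiation. *)

Lemma ae_imply (P Q : R -> Prop) : (forall x, P x -> Q x) ->
  {ae mu, forall x, P x} -> {ae mu, forall x, Q x}.
Proof.
by move=> PQ; apply: filterS; first exact: (ae_filter_ringOfSetsType mu).
Qed.

Lemma ae_and (P Q : R -> Prop) : {ae mu, forall x, P x} ->
  {ae mu, forall x, Q x} -> {ae mu, forall x, P x /\ Q x}.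
Proof.
move=> aP aQ.
by apply: (@filterI _ _ (ae_filter_ringOfSetsType mu) _ _ aP aQ).
Qed.

Lemma integrable_measurable D f :
  mu.-integrable D (EFin \o f) -> measurable_fun D f.
Proof. by move=> /measurable_int /measurable_EFinP. Qed.

Lemma EFin_Rintegral D f : measurable D -> mu.-integrable D (EFin \o f) ->
  (\int[mu]_(x in D) f x)%:E = (\int[mu]_(x in D) (f x)%:E)%E.
Proof.
move=> mD iF; rewrite /Rintegral fineK//.
exact: (@integrable_fin_num _ _ _ mu D mD _ iF).
Qed.

Lemma integrable_dom D f g : measurable D -> measurable_fun D f ->
  mu.-integrable D (EFin \o g) -> (forall x, D x -> `|f x| <= g x) ->
  mu.-integrable D (EFin \o f).
Proof.
move=> mD mf ig fg; apply: le_integrable ig => //; first exact/measurable_EFinP.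
by move=> x Dx /=; rewrite lee_fin (le_trans (fg _ Dx))// ler_norm.
Qed.

Lemma integrable_Zl D f (k : R) : measurable D ->
  mu.-integrable D (EFin \o f) ->
  mu.-integrable D (EFin \o (fun x => k * f x)).
Proof.
move=> mD iF.
by under [EFin \o _]eq_fun do rewrite /= EFinM; exact: integrableZl.
Qed.

Lemma integrable_D D f g : measurable D ->
  mu.-integrable D (EFin \o f) -> mu.-integrable D (EFin \o g) ->
  mu.-integrable D (EFin \o (fun x => f x + g x)).
Proof.
move=> mD iF iG.
by under [EFin \o _]eq_fun do rewrite /= EFinD; exact: integrableD.
Qed.

Lemma integrable_B D f g : measurable D ->
  mu.-integrable D (EFin \o f) -> mu.-integrable D (EFin \o g) ->
  mu.-integrable D (EFin \o (fun x => f x - g x)).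
Proof.
move=> mD iF iG.
by under [EFin \o _]eq_fun do rewrite /= EFinB; exact: integrableB.
Qed.

Lemma integrableM_bounded D f g (M : R) : measurable D ->
  mu.-integrable D (EFin \o f) -> measurable_fun D g ->
  (forall x, D x -> `|g x| <= M) ->
  mu.-integrable D (EFin \o (fun x => f x * g x)).
Proof.
move=> mD iF mg gM; apply: (@integrable_dom _ _ (fun x => M * `|f x|)) => //.
- by apply: measurable_funM => //; exact: integrable_measurable.
- exact: (@integrable_Zl _ (fun x => `|f x|) _ mD (integrable_norm iF)).
- by move=> x Dx; rewrite normrM mulrC ler_wpM2r// gM.
Qed.

Lemma normr_Rintegral_le D f g : measurable D -> measurable_fun D f ->
  mu.-integrable D (EFin \o g) -> (forall x, D x -> `|f x| <= g x) ->
  `|\int[mu]_(x in D) f x| <= \int[mu]_(x in D) g x.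
Proof.
move=> mD mf ig fg; have iF := integrable_dom mD mf ig fg.
apply: (le_trans (@le_normr_Rintegral _ _ _ mu _ _ mD iF)).
by apply: le_Rintegral => //; exact: (integrable_norm iF).
Qed.

Lemma Rintegral_dominated_cvg D (f_ : nat -> R -> R) f g : measurable D ->
  (forall n, measurable_fun D (f_ n)) -> measurable_fun D f ->
  {ae mu, forall x, D x -> f_ n x @[n --> \oo] --> f x} ->
  mu.-integrable D (EFin \o g) ->
  (forall n x, D x -> `|f_ n x| <= g x) ->
  (\int[mu]_(x in D) f_ n x @[n --> \oo] --> \int[mu]_(x in D) f x).
Proof.
move=> mD mf_ mf cf ig fg.
have [] := @dominated_convergence _ _ _ mu D mD (fun n => EFin \o f_ n)
  (EFin \o f) (EFin \o g).
- by move=> n; apply/measurable_EFinP; exact: mf_.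
- exact/measurable_EFinP.
- by apply: ae_imply cf => x /[apply] ?; apply: cvg_EFin => //; exact: nearW.
- exact: ig.
- by apply: aeW => x n Dx /=; rewrite lee_fin fg.
move=> iF _ cI.
by apply: fine_cvg; rewrite -[X in _ --> X](EFin_Rintegral mD iF) in cI.
Qed.

Lemma FTC_segment f F (a b : R) : a < b -> continuous f ->
  (forall x : R, is_derive x 1 F (f x)) ->
  \int[mu]_(x in `[a, b]) f x = F b - F a.
Proof.
move=> ab cf dF; rewrite /Rintegral (continuous_FTC2 (F := F))//.
- exact: continuous_subspaceT.
- split.
  + by move=> x _; exact: ex_derive.
  + apply: cvg_at_right_filter; apply: differentiable_continuous.
    by apply/derivable1_diffP; exact: ex_derive.
  + apply: cvg_at_left_filter; apply: differentiable_continuous.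
    by apply/derivable1_diffP; exact: ex_derive.
- by move=> x _; rewrite derive1E derive_val.
Qed.

(** By dominated convergence with bound [|f|], the integrals over the segments tend to the integral
    over [D]; the fundamental theorem evaluates each of them. The line and the half-line are both
    instances. *)
Lemma FTC_exhaustion D f F (a_ b_ : nat -> R) (l : R) : measurable D ->
  continuous f -> (forall x : R, is_derive x 1 F (f x)) ->
  mu.-integrable D (EFin \o f) ->
  (forall n, a_ n < b_ n) -> (forall n, `[a_ n, b_ n] `<=` D) ->
  (forall x, D x -> \forall n \near \oo, x \in `[a_ n, b_ n]) ->
  F (b_ n) - F (a_ n) @[n --> \oo] --> l ->
  \int[mu]_(x in D) f x = l.
Proof.
move=> mD cf dF iF ab abD Dab cF.
apply: (@cvg_unique _ _ _ _ _ _ _ cF); first exact: Rhausdorff.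
have -> : (fun n => F (b_ n) - F (a_ n)) =
    (fun n => \int[mu]_(x in D) (f \_ `[a_ n, b_ n]) x).
  apply/funext => n; rewrite -(FTC_segment (ab n) cf dF).
  by rewrite -Rintegral_mkcondr; congr Rintegral; rewrite setIidr.
apply: (@Rintegral_dominated_cvg _ _ _ (fun x => `|f x|)) => //.
- move=> n; apply: measurable_funTS; apply: (measurable_restrictT _ _).1 => //.
  by apply: measurable_funTS; exact: continuous_measurable_fun.
- by apply: measurable_funTS; exact: continuous_measurable_fun.
- apply: aeW => x Dx; apply: cvg_near_cst.
  near=> n; rewrite patchE ifT// inE/=.
  by near: n; exact: Dab.
- exact: (integrable_norm iF).
- by move=> n x _; rewrite patchE; case: ifP => //; rewrite normr0.
Unshelve. all: by end_near. Qed.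

Lemma integral_deriv_line f F : continuous f ->
  (forall x : R, is_derive x 1 F (f x)) ->
  mu.-integrable setT (EFin \o f) ->
  F x @[x --> +oo] --> 0 -> F x @[x --> -oo] --> 0 ->
  \int[mu]_x f x = 0.
Proof.
move=> cf dF iF Fy FNy.
(* [n.+1] rather than [n] keeps the segment nondegenerate at [n = 0]. *)
apply: (@FTC_exhaustion _ _ F (fun n => - n.+1%:R) (fun n => n.+1%:R)) => //.
- by move=> n; rewrite ltrNl (@lt_le_trans _ _ 0)// oppr_lt0.
- move=> x _; near=> n.
  rewrite in_itv/= -ler_norml (@le_trans _ _ n%:R)//; last by rewrite ler_nat.
  by near: n; exact: nbhs_infty_ger.
- rewrite -[0 in X in _ --> X](subr0 0); apply: cvgB.
    apply: (cvg_comp _ _ _ Fy).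
    apply/cvgryPge => A; near=> n.
    rewrite (@le_trans _ _ n%:R)//; last by rewrite ler_nat.
    by near: n; exact: nbhs_infty_ger.
  apply: (cvg_comp _ _ _ FNy).
  apply/cvgrNyPle => A; near=> n.
  rewrite lerNl (@le_trans _ _ n%:R)//; last by rewrite ler_nat.
  by near: n; exact: nbhs_infty_ger.
Unshelve. all: by end_near. Qed.

Lemma integral_deriv_halfline f F : continuous f ->
  (forall x : R, is_derive x 1 F (f x)) ->
  mu.-integrable `[0, +oo[ (EFin \o f) ->
  F x @[x --> +oo] --> 0 ->
  \int[mu]_(x in `[0, +oo[) f x = - F 0.
Proof.
move=> cf dF iF Fy.
apply: (@FTC_exhaustion _ _ F (fun=> 0) (fun n => n.+1%:R)) => //.
- by move=> n x /=; rewrite !in_itv/= andbT => /andP[].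
- move=> x /=; rewrite in_itv/= andbT => x0; near=> n.
  rewrite in_itv/= x0 (@le_trans _ _ n%:R)//; last by rewrite ler_nat.
  by near: n; exact: nbhs_infty_ger.
- rewrite -[in X in _ --> X](add0r (- F 0)); apply: cvgB; last exact: cvg_cst.
  apply: (cvg_comp _ _ _ Fy).
  apply/cvgryPge => A; near=> n.
  rewrite (@le_trans _ _ n%:R)//; last by rewrite ler_nat.
  by near: n; exact: nbhs_infty_ger.
Unshelve. all: by end_near. Qed.

(** The product bound makes the kernel absolutely integrable by Tonelli, and extending it by zero in
    [s] outside [D] reduces the claim to Fubini on the plane. The first two conclusions are also the
    source of measurability for the transforms below. *)
Lemma Rintegral_Fubini D (K : R * R -> R) (w u : R -> R) : measurable D ->
  measurable_fun setT K ->
  mu.-integrable D (EFin \o w) -> mu.-integrable setT (EFin \o u) ->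
  (forall s x, D s -> `|K (s, x)| <= w s * u x) ->
  [/\ mu.-integrable D (EFin \o (fun s => \int[mu]_x K (s, x))),
      mu.-integrable setT (EFin \o (fun x => \int[mu]_(s in D) K (s, x))) &
      \int[mu]_(s in D) \int[mu]_x K (s, x) =
      \int[mu]_x \int[mu]_(s in D) K (s, x)].
Proof.
move=> mD mK iw iu Kwu.
pose k := EFin \o (K \_ (D `*` setT)).
have mk : measurable_fun setT k.
  apply/measurable_EFinP; apply/(measurable_restrictT _ _).1.
    exact: measurableX.
  exact: measurable_funTS.
have kE s x : k (s, x) = ((fun s => K (s, x)) \_ D s)%:E.
  rewrite /k /= !patchE; congr (_%:E).
  by rewrite in_setX in_setT andbT.
have kE2 s x : k (s, x) = if s \in D then (K (s, x))%:E else 0%E.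
  by rewrite kE patchE; case: ifP.
have iK s : D s -> mu.-integrable setT (EFin \o (fun x => K (s, x))).
  move=> Ds; apply: (@integrable_dom _ _ (fun x => w s * u x)) => //.
  - exact: measurableT_comp.
  - exact: integrable_Zl.
  - by move=> x _; exact: Kwu.
have ik : (mu \x mu)%E.-integrable setT k.
  apply/integrable12ltyP => //.
  apply: (@le_lt_trans _ _ (\int[mu]_(s in D) (`|w s| * \int[mu]_x `|u x|)%:E)%E).
    rewrite [leRHS]integral_mkcond; apply: ge0_le_integral => //.
    - by move=> s _; apply: integral_ge0.
    - apply: (@measurable_fun_fubini_tonelli_F _ _ (measurableTypeR R)
        (measurableTypeR R) R mu (abse \o k)) => //.
        exact: measurableT_comp.
      by move=> z /=.
    - rewrite [X in measurable_fun _ X](_ : _ =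
          EFin \o ((fun s => `|w s| * \int[mu]_x `|u x|) \_ D)); last first.
        by apply/funext => s; rewrite /= !patchE; case: ifP.
      apply/measurable_EFinP; apply: (measurable_restrictT _ _).1 => //.
      apply: measurable_funM => //.
      by apply: measurableT_comp => //; exact: integrable_measurable.
    - move=> s _; rewrite patchE; case: ifPn => [/set_mem Ds|sD]; last first.
        rewrite integral0_eq// => x _; rewrite kE2 (negbTE sD) abse0//.
      rewrite -RintegralZl//; last exact: (integrable_norm iu).
      rewrite EFin_Rintegral//; last first.
        by apply: integrable_Zl => //; exact: (integrable_norm iu).
      apply: ge0_le_integral => //.
      + by apply: measurableT_comp => //; exact: measurableT_comp.
      + apply/measurable_EFinP; apply: measurable_funM => //.
        by apply: measurableT_comp => //; exact: integrable_measurable.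
      + move=> x _; rewrite kE2 mem_set// lee_fin.
        by rewrite (le_trans (Kwu _ _ Ds))// -normrM ler_norm.
  apply: integrable_lty => //.
  rewrite (_ : (fun _ => _) = EFin \o (fun s => `|w s| * \int[mu]_x `|u x|))//.
  apply: (@integrableM_bounded _ (fun s => `|w s|) _
    `|\int[mu]_x `|u x| |) => //.
  exact: (integrable_norm iw).
have iF := integrable_fubini_F ik.
have iKD x : mu.-integrable D (EFin \o (fun s => K (s, x))).
  apply: (@integrable_dom _ _ (fun s => `|u x| * `|w s|)) => //.
  - by apply: measurable_funTS; exact: measurableT_comp.
  - by apply: integrable_Zl => //; exact: (integrable_norm iw).
  - move=> s Ds; rewrite (le_trans (Kwu _ _ Ds))// mulrC -normrM.
    exact: ler_norm.
have FE : fubini_F mu k = (EFin \o (fun s => \int[mu]_x K (s, x))) \_ D.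
  apply/funext => s; rewrite /fubini_F patchE; case: ifPn => sD.
    rewrite /= EFin_Rintegral//; last by apply: iK; exact: set_mem.
    by apply: eq_integral => x _; rewrite kE2 sD.
  by rewrite integral0_eq// => x _; rewrite kE2 (negbTE sD).
have GE : fubini_G mu k = EFin \o (fun x => \int[mu]_(s in D) K (s, x)).
  apply/funext => x; rewrite /= EFin_Rintegral//.
  rewrite [RHS]integral_mkcond; apply: eq_integral => s _.
  by rewrite kE2 patchE.
split.
- by apply/(integrable_mkcond _ _).2 => //; rewrite -FE.
- apply: (@integrable_dom _ _ (fun x => (\int[mu]_(s in D) `|w s|) * `|u x|)) => //.
  + by apply/measurable_EFinP; rewrite -GE; exact: (measurable_fubini_G ik).
  + by apply: integrable_Zl => //; exact: (integrable_norm iu).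
  + move=> x _; rewrite -RintegralZr//; last exact: (integrable_norm iw).
    apply: normr_Rintegral_le => //.
    * by apply: measurable_funTS; exact: measurableT_comp.
    * under [EFin \o _]eq_fun do rewrite /= mulrC.
      by apply: integrable_Zl => //; exact: (integrable_norm iw).
    * by move=> s Ds; rewrite (le_trans (Kwu _ _ Ds))// -normrM ler_norm.
rewrite [LHS]/Rintegral [RHS]/Rintegral; congr fine.
have E : (\int[mu]_x fubini_F mu k x = \int[mu]_x fubini_G mu k x)%E := Fubini ik.
by rewrite FE GE -integral_mkcond in E.
Qed.

End RealIntegrals.

(** * Linear change of variables *)

Section Scaling.
Context {R : realType}.
Local Notation mu := (@lebesgue_measure R).
Variables (k : R) (k0 : 0 < k).

Let scale : measurableTypeR R -> measurableTypeR R := fun x => k * x.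

Let measurable_scale : measurable_fun setT scale.
Proof. by apply: measurable_funM. Qed.

(** [k] times the image of Lebesgue measure under [x |-> k * x]. It agrees with Lebesgue measure on
    half-open intervals, hence everywhere, and integrating against an image measure is
    substitution. *)
Let nu : {measure set (measurableTypeR R) -> \bar R}.
Proof.
unshelve refine (mscale (NngNum (ltW k0)) (pushforward mu scale)).
exact: measurable_scale.
Defined.

Let lebesgue_scale A : measurable A -> mu A = nu A.
Proof.
apply: lebesgue_measure_unique => _ [[a b] _ <-].
have E : scale @^-1` [set` `]a, b]] = [set` `]k^-1 * a, k^-1 * b]].
  apply/seteqP; split => x /=; rewrite !in_itv/= /scale.
    by rewrite ltr_pdivrMl// ler_pdivlMl.
  by rewrite ltr_pdivrMl// ler_pdivlMl.
rewrite -[RHS]/(k%:E * mu (scale @^-1` [set` `]a, b]]))%E E.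
rewrite !lebesgue_measure_itv/= !lte_fin ltr_pM2l ?invr_gt0//.
case: ifPn => _; last by rewrite mule0.
by rewrite -!EFinD -EFinM -mulrBr mulVKf ?gt_eqF.
Qed.

Lemma ge0_integral_scale (g : R -> \bar R) : measurable_fun setT g ->
  (forall x, 0 <= g x)%E ->
  (\int[mu]_x g x = k%:E * \int[mu]_x g (k * x)%R)%E.
Proof.
move=> mg g0.
rewrite (@eq_measure_integral _ _ _ _ nu); last by move=> A mA _; exact: lebesgue_scale.
rewrite ge0_integral_mscale//; congr (_ * _)%E.
by rewrite ge0_integral_pushforward.
Qed.

Lemma integrable_scale (f : R -> R) : mu.-integrable setT (EFin \o f) ->
  mu.-integrable setT (EFin \o (fun x => f (k * x))).
Proof.
move=> iF; have mf := integrable_measurable iF.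
apply/integrableP; split.
  by apply/measurable_EFinP; exact: measurableT_comp measurable_scale.
move/integrableP : iF => [_].
rewrite (@ge0_integral_scale (fun x => `|(EFin \o f) x|%E))//; last first.
  by apply: measurableT_comp => //; exact/measurable_EFinP.
rewrite -lte_pdivlMl//.
by rewrite [X in (_ < X)%E](_ : _ = +oo%E)// gt0_muley// lte_fin invr_gt0.
Qed.

Lemma Rintegral_scale (f : R -> R) : mu.-integrable setT (EFin \o f) ->
  \int[mu]_x f x = k * \int[mu]_x f (k * x).
Proof.
move=> iF; have mf := integrable_measurable iF.
have ik := integrable_scale iF.
apply: EFin_inj; rewrite EFinM !EFin_Rintegral//.
rewrite integralE [X in (_ * X)%E]integralE.
rewrite muleBr//; last first.
  rewrite fin_num_adde_defr//.
  by apply: integrable_pos_fin_num.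
have mF : measurable_fun setT (EFin \o f) by exact/measurable_EFinP.
rewrite (@ge0_integral_scale (EFin \o f)^\+%E)//; last first.
  exact: measurable_funepos.
rewrite (@ge0_integral_scale (EFin \o f)^\-%E)//; last first.
  exact: measurable_funeneg.
by congr (_ * _ - _ * _)%E; apply: eq_integral => x _; rewrite ?funeposE ?funenegE.
Qed.

End Scaling.

(** * Some explicit integrals *)

Section FourierInversion.
Context {R : realType}.
Local Notation mu := (@lebesgue_measure R).
Implicit Types (D : set R) (f g F : R -> R).

Lemma continuous_oneDsqr_inv : continuous (fun x : R => (1 + x ^+ 2)^-1).
Proof. by move=> x; exact: (@continuous_oneDsqrV R x). Qed.

Lemma integrable_oneDsqrV D : measurable D ->
  mu.-integrable D (EFin \o (fun x : R => (1 + x ^+ 2)^-1)).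
Proof.
move=> mD; apply: (@integrableS _ _ _ _ setT) => //.
apply/integrableP; split.
  apply/measurable_EFinP; apply: continuous_measurable_fun.
  exact: continuous_oneDsqr_inv.
under eq_integral => x _.
  rewrite /= ger0_norm; last by rewrite invr_ge0 addr_ge0// sqr_ge0.
  over.
rewrite (@ge0_symfun_integralT _ (fun x : R => (1 + x ^+ 2)^-1)).
- by rewrite -set_itvcy [X in (_ * X)%E]integral0y_oneDsqr -EFinM ltry.
- by move=> x; rewrite invr_ge0 addr_ge0// sqr_ge0.
- exact: continuous_oneDsqr_inv.
- by move=> x; rewrite /= sqrrN.
Qed.

Lemma Rintegral_oneDsqrV : \int[mu]_x (1 + x ^+ 2)^-1 = pi.
Proof.
rewrite /Rintegral (@ge0_symfun_integralT _ (fun x : R => (1 + x ^+ 2)^-1)).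
- rewrite -set_itvcy [X in (_ * X)%E]integral0y_oneDsqr -EFinM /=.
  by rewrite mulrC mulfVK.
- by move=> x; rewrite invr_ge0 addr_ge0// sqr_ge0.
- exact: continuous_oneDsqr_inv.
- by move=> x; rewrite /= sqrrN.
Qed.

Lemma Rintegral0y_oneDsqrV :
  \int[mu]_(x in `[0, +oo[) (1 + x ^+ 2)^-1 = pi / 2.
Proof. by rewrite /Rintegral [X in fine X]integral0y_oneDsqr. Qed.

Lemma integrable_expRN (d : R) : 0 < d ->
  mu.-integrable `[0, +oo[ (EFin \o (fun x : R => expR (- (d * x)))).
Proof.
move=> d0; apply: (@integrable_dom _ _ _
  (fun x => (1 + 2 / d ^+ 2) * (1 + x ^+ 2)^-1)) => //.
- apply: measurable_funTS; apply: measurableT_comp => //.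
  apply: measurableT_comp => //; exact: measurable_funM.
- by apply: integrable_Zl => //; exact: integrable_oneDsqrV.
- move=> x /=; rewrite in_itv/= andbT => x0.
  rewrite ger0_norm ?expR_ge0// expRN ler_pdivlMr ?ltr_wpDr ?sqr_ge0//.
  rewrite mulrC ler_pdivrMr ?expR_gt0//.
  have dx0 : 0 <= d * x by rewrite mulr_ge0// ltW.
  (* The quadratic term of the series suffices, [1 + y ^ 2 / 2 <= expR y]; the constant
     [1 + 2 / d ^ 2] is chosen so that the product dominates [1 + x ^ 2]. *)
  have := @expR_ge1Dxn R (d * x) 1 dx0.
  rewrite -[2`!%:R]/(2%:R : R) => le.
  apply: (@le_trans _ _ ((1 + 2 / d ^+ 2) * (1 + (d * x) ^+ 2 / 2))).
    rewrite exprMn.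
    have -> : (1 + 2 / d ^+ 2) * (1 + d ^+ 2 * x ^+ 2 / 2) =
       1 + x ^+ 2 + (2 / d ^+ 2 + d ^+ 2 * x ^+ 2 / 2).
      by field; rewrite gt_eqF.
    rewrite lerDl; apply: addr_ge0; first by rewrite divr_ge0 ?sqr_ge0.
    by apply: divr_ge0 => //; rewrite mulr_ge0 ?sqr_ge0.
  by rewrite ler_wpM2l// addr_ge0// divr_ge0// sqr_ge0.
Qed.

Lemma integral_expRN_cos (d s : R) : 0 < d ->
  \int[mu]_(x in `[0, +oo[) (expR (- (d * x)) * cos (x * s)) =
  d / (d ^+ 2 + s ^+ 2).
Proof.
move=> d0.
have ds0 : d ^+ 2 + s ^+ 2 != 0.
  by rewrite gt_eqF// ltr_wpDr ?sqr_ge0// exprn_gt0.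
(* Real part of the complex primitive [exp ((- d + i s) x) / (- d + i s)]. *)
pose F (x : R) := expR (- (d * x)) *
  ((s * sin (x * s) - d * cos (x * s)) / (d ^+ 2 + s ^+ 2)).
have ccos : continuous (fun x : R => cos (x * s)).
  move=> x; apply: continuous_comp; last exact: continuous_cos.
  by apply: cvgM; [exact: cvg_id|exact: cvg_cst].
have cexp : continuous (fun x : R => expR (- (d * x))).
  move=> x; apply: continuous_comp; last exact: continuous_expR.
  by apply: cvgN; apply: cvgM; [exact: cvg_cst|exact: cvg_id].
transitivity (- F 0); [apply: integral_deriv_halfline|].
- by move=> x; apply: cvgM; [exact: cexp|exact: ccos].
- move=> x; apply: is_derive_eq.
  by rewrite /GRing.scale/=; field.
- apply: (@integrableM_bounded _ _ _ _ 1) => //.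
  + exact: integrable_expRN.
  + by apply: measurable_funTS; exact: continuous_measurable_fun.
  + by move=> x _; exact: cos_max.
- have expN : expR (- (d * x)) @[x --> +oo] --> (0:R).
    apply: (@cvg_comp _ _ _ (fun x => d * x) (fun y => expR (- y)) _ +oo);
      last exact: cvgr_expR.
    by apply: gt0_cvgMry => //; exact: cvg_id.
  apply/cvgr0Pnorm_le => e e0.
  pose M := (`|s| + d) / (d ^+ 2 + s ^+ 2).
  have M0 : 0 <= M by rewrite divr_ge0 ?addr_ge0 ?sqr_ge0// ltW.
  have /cvgr0Pnorm_le/(_ (e / (M + 1))) := expN.
  rewrite divr_gt0 ?ltr_wpDl// => /(_ isT); apply: filterS => x xe.
  rewrite /F normrM (@le_trans _ _ (e / (M + 1) * (M + 1)))//; last first.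
    by rewrite mulfVK// gt_eqF// ltr_wpDl.
  rewrite ler_pM// (@le_trans _ _ M) ?lerDl//.
  rewrite normrM normfV (@ger0_norm _ (d ^+ 2 + s ^+ 2)) ?addr_ge0 ?sqr_ge0//.
  rewrite ler_wpM2r ?invr_ge0 ?addr_ge0 ?sqr_ge0//.
  rewrite (le_trans (ler_normB _ _))// !normrM lerD//.
    by rewrite ler_piMr// sin_max.
  by rewrite (gtr0_norm d0) ler_piMr ?cos_max// ltW.
by rewrite /F !(mulr0, mul0r, oppr0) expR0 sin0 cos0; field.
Qed.

End FourierInversion.

(** * Inversion and Plancherel bounds for the cosine and sine transforms *)

Section CosSinTransform.
Context {R : realType}.
Local Notation mu := (@lebesgue_measure R).

(** For complex [f] the real part of the transform is [cosT (Re f) + sinT (Im f)], and similarly for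
    the imaginary part, so inversion can be carried out on real functions. *)
Definition cosT (f : R -> R) (xi : R) : R := \int[mu]_x (f x * cos (xi * x)).
Definition sinT (f : R -> R) (xi : R) : R := \int[mu]_x (f x * sin (xi * x)).

Section Inversion.
Variables (f : R -> R) (e : R).
Hypothesis intf : mu.-integrable setT (EFin \o f).
Hypothesis cos_le : forall xi, `|cosT f xi| <= e / (1 + xi ^+ 2).
Hypothesis sin_le : forall xi, `|sinT f xi| <= e / (1 + xi ^+ 2).

Local Notation I := (`[0, +oo[%classic : set R).

Let mf : measurable_fun setT f := integrable_measurable intf.

Let measurable_mulcos (a : R) : measurable_fun setT (fun x : R => cos (a * x)).
Proof.
apply: measurableT_comp; last exact: measurable_funM.
exact: continuous_measurable_fun (@continuous_cos R).
Qed.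

Let measurable_mulsin (a : R) : measurable_fun setT (fun x : R => sin (a * x)).
Proof.
apply: measurableT_comp; last exact: measurable_funM.
exact: continuous_measurable_fun (@continuous_sin R).
Qed.

Let integrable_fcos a : mu.-integrable setT (EFin \o (fun x => f x * cos (a * x))).
Proof. by apply: integrableM_bounded => // x _; exact: cos_max. Qed.

Let integrable_fsin a : mu.-integrable setT (EFin \o (fun x => f x * sin (a * x))).
Proof. by apply: integrableM_bounded => // x _; exact: sin_max. Qed.

Let mcos2 : measurable_fun setT (fun z : R * R => cos (z.1 * z.2)).
Proof.
apply: measurableT_comp; first exact: continuous_measurable_fun (@continuous_cos R).
by apply: measurable_funM; [exact: measurable_fst|exact: measurable_snd].
Qed.

Let msin2 : measurable_fun setT (fun z : R * R => sin (z.1 * z.2)).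
Proof.
apply: measurableT_comp; first exact: continuous_measurable_fun (@continuous_sin R).
by apply: measurable_funM; [exact: measurable_fst|exact: measurable_snd].
Qed.

(** Measurability of an integral in its parameter comes out of Fubini, which asks for integrability
    in that parameter; the weight supplies it and is divided out here. *)
Let measurable_weight (F : R -> R) :
  mu.-integrable setT (EFin \o (fun s => F s * (1 + s ^+ 2)^-1)) ->
  measurable_fun setT F.
Proof.
move=> /integrable_measurable mF.
rewrite (_ : F = fun s => F s * (1 + s ^+ 2)^-1 * (1 + s ^+ 2)).
  by apply: measurable_funM => //; apply: measurable_funD => //; exact: measurable_funX.
by apply/funext => s; rewrite mulfVK// gt_eqF// ltr_wpDr ?sqr_ge0.
Qed.

Let mC : measurable_fun setT (cosT f).
Proof.
apply: measurable_weight.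
have [||||] := @Rintegral_Fubini R setT
  (fun z => f z.2 * cos (z.1 * z.2) * (1 + z.1 ^+ 2)^-1)
  (fun s => (1 + s ^+ 2)^-1) (fun x => `|f x|) measurableT.
- apply: measurable_funM; first apply: measurable_funM => //.
    exact: measurableT_comp measurable_snd.
  apply: (@measurableT_comp _ _ _ _ _ _ (fun s : R => (1 + s ^+ 2)^-1)) => //.
  apply: continuous_measurable_fun; exact: continuous_oneDsqr_inv.
- exact: integrable_oneDsqrV.
- exact: (integrable_norm intf).
- move=> s x _ /=; rewrite !normrM mulrC ger0_norm ?invr_ge0 ?addr_ge0 ?sqr_ge0//.
  by rewrite ler_wpM2l ?invr_ge0 ?addr_ge0 ?sqr_ge0// ler_piMr// cos_max.
- move=> + _ _ => /=; apply: eq_integrable => // s _ /=.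
  by rewrite RintegralZr.
Qed.

Let mS : measurable_fun setT (sinT f).
Proof.
apply: measurable_weight.
have [||||] := @Rintegral_Fubini R setT
  (fun z => f z.2 * sin (z.1 * z.2) * (1 + z.1 ^+ 2)^-1)
  (fun s => (1 + s ^+ 2)^-1) (fun x => `|f x|) measurableT.
- apply: measurable_funM; first apply: measurable_funM => //.
    exact: measurableT_comp measurable_snd.
  apply: (@measurableT_comp _ _ _ _ _ _ (fun s : R => (1 + s ^+ 2)^-1)) => //.
  apply: continuous_measurable_fun; exact: continuous_oneDsqr_inv.
- exact: integrable_oneDsqrV.
- exact: (integrable_norm intf).
- move=> s x _ /=; rewrite !normrM mulrC ger0_norm ?invr_ge0 ?addr_ge0 ?sqr_ge0//.
  by rewrite ler_wpM2l ?invr_ge0 ?addr_ge0 ?sqr_ge0// ler_piMr// sin_max.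
- move=> + _ _ => /=; apply: eq_integrable => // s _ /=.
  by rewrite RintegralZr.
Qed.

(** Equals the integral of [f x * cos (xi * (x - y))] in [x], the real part of the transform at [xi]
    times [exp (i xi y)]. *)
Let G (xi y : R) := cosT f xi * cos (xi * y) + sinT f xi * sin (xi * y).

Let G_le xi y : `|G xi y| <= (e + e) * (1 + xi ^+ 2)^-1.
Proof.
rewrite (le_trans (ler_normD _ _))// mulrDl lerD// normrM.
  by rewrite (le_trans _ (cos_le xi))// ler_piMr// cos_max.
by rewrite (le_trans _ (sin_le xi))// ler_piMr// sin_max.
Qed.

Let mG : measurable_fun setT (fun z : R * R => G z.1 z.2).
Proof.
apply: measurable_funD; apply: measurable_funM => //.
  exact: measurableT_comp measurable_fst.
exact: measurableT_comp measurable_fst.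
Qed.

Let mG1 y : measurable_fun setT (fun xi => G xi y).
Proof.
apply: measurable_funD; apply: measurable_funM => //.
  by under eq_fun do rewrite mulrC; exact: measurable_mulcos.
by under eq_fun do rewrite mulrC; exact: measurable_mulsin.
Qed.

(** [G] is even in [xi], so the half-line gives half of the inversion integral, and the value to be
    expected is [pi * f y]. *)
Definition inv_transform y : R := \int[mu]_(xi in I) G xi y.
Local Notation F := inv_transform.

Let mI : measurable I. Proof. exact: measurable_itv. Qed.

Let iG y : mu.-integrable I (EFin \o (fun xi => G xi y)).
Proof.
apply: (@integrable_dom _ _ _ (fun xi => (e + e) * (1 + xi ^+ 2)^-1)) => //.
- exact: measurable_funTS.
- by apply: integrable_Zl => //; exact: integrable_oneDsqrV.
Qed.

Lemma normr_inv_transform_le y : `|F y| <= e * pi.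
Proof.
apply: (@le_trans _ _ (\int[mu]_(xi in I) ((e + e) * (1 + xi ^+ 2)^-1))).
  apply: normr_Rintegral_le => //; first exact: measurable_funTS.
  by apply: integrable_Zl => //; exact: integrable_oneDsqrV.
rewrite RintegralZl//; last exact: integrable_oneDsqrV.
rewrite Rintegral0y_oneDsqrV; lra.
Qed.

Let mF : measurable_fun setT F.
Proof.
apply: measurable_weight.
have [||||] := @Rintegral_Fubini R I
  (fun z => G z.1 z.2 * (1 + z.2 ^+ 2)^-1)
  (fun s => (e + e) * (1 + s ^+ 2)^-1) (fun x => (1 + x ^+ 2)^-1) mI.
- apply: measurable_funM => //.
  apply: (@measurableT_comp _ _ _ _ _ _ (fun s : R => (1 + s ^+ 2)^-1)) => //.
  apply: continuous_measurable_fun; exact: continuous_oneDsqr_inv.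
- by apply: integrable_Zl => //; exact: integrable_oneDsqrV.
- exact: integrable_oneDsqrV.
- move=> s x _ /=; rewrite normrM.
  rewrite (@ger0_norm _ (_^-1)) ?invr_ge0 ?addr_ge0 ?sqr_ge0//.
  by rewrite ler_wpM2r// ?invr_ge0 ?addr_ge0 ?sqr_ge0.
- move=> _ + _ => /=; apply: eq_integrable => // s _ /=.
  by rewrite RintegralZr.
Qed.

(* Abel summation: the factor [expR (- (d * xi))] makes the double integral
   absolutely convergent, and the inner integral becomes the Poisson kernel. *)
Let abel_inversion d y : 0 < d ->
  \int[mu]_(xi in I) (expR (- (d * xi)) * G xi y) =
  \int[mu]_x (f x * (d / (d ^+ 2 + (x - y) ^+ 2))).
Proof.
move=> d0.
have cD (xi x : R) : cos (xi * (x - y)) =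
    cos (xi * x) * cos (xi * y) + sin (xi * x) * sin (xi * y).
  by rewrite mulrBr cosB.
have [||||_ _] := @Rintegral_Fubini R I
  (fun z => f z.2 * (expR (- (d * z.1)) * cos (z.1 * (z.2 - y))))
  (fun s => expR (- (d * s))) (fun x => `|f x|) mI.
- apply: measurable_funM; first exact: measurableT_comp measurable_snd.
  apply: measurable_funM.
    apply: measurableT_comp => //; apply: measurableT_comp => //.
    by apply: measurable_funM => //; exact: measurable_fst.
  apply: measurableT_comp; first exact: continuous_measurable_fun (@continuous_cos R).
  apply: measurable_funM; first exact: measurable_fst.
  by apply: measurable_funB => //; exact: measurable_snd.
- exact: integrable_expRN.
- exact: (integrable_norm intf).
- move=> s x _ /=; rewrite !normrM mulrC ler_wpM2r//.
  by rewrite ger0_norm ?expR_ge0// ler_piMr ?expR_ge0// cos_max.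
under [LHS]eq_Rintegral => s _.
  rewrite /=.
  have -> : \int[mu]_x (f x * (expR (- (d * s)) * cos (s * (x - y)))) =
      expR (- (d * s)) * G s y.
    rewrite /G /cosT /sinT -!RintegralZr// -RintegralD//; last 2 first.
    - by under [EFin \o _]eq_fun do rewrite /= mulrC; exact: integrable_Zl.
    - by under [EFin \o _]eq_fun do rewrite /= mulrC; exact: integrable_Zl.
    rewrite -RintegralZl//; last first.
      apply: (@integrable_dom _ _ _ (fun x => `|f x| + `|f x|)) => //.
      + apply: measurable_funD; apply: measurable_funM => //;
          exact: measurable_funM.
      + by apply: integrable_D => //; exact: (integrable_norm intf).
      + move=> x _; rewrite (le_trans (ler_normD _ _))// lerD// -mulrA normrM.
          by rewrite ler_piMr// normrM mulr_ile1// cos_max.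
        by rewrite ler_piMr// normrM mulr_ile1// sin_max.
    apply: eq_Rintegral => x _; rewrite cD; ring.
  over.
move=> ->; apply: eq_Rintegral => x _ /=.
rewrite RintegralZl//; last first.
  apply: (@integrableM_bounded _ _ _ _ 1) => //.
  + exact: integrable_expRN.
  + apply: measurable_funTS; under eq_fun do rewrite mulrC.
    exact: measurable_mulcos.
  + by move=> xi _; exact: cos_max.
by rewrite integral_expRN_cos.
Qed.

Let Fd d y : R := \int[mu]_(xi in I) (expR (- (d * xi)) * G xi y).

(** Integrated in [y] over a segment, the Poisson kernel becomes a difference of arctangents,
    bounded by [pi]. Its limit as [d] tends to 0 can then be taken for a merely integrable [f]. *)
Let integral_abel (d a b : R) : 0 < d -> a < b ->
  mu.-integrable `[a, b] (EFin \o Fd d) /\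
  \int[mu]_(y in `[a, b]) Fd d y =
  \int[mu]_x (f x * (atan ((b - x) / d) - atan ((a - x) / d))).
Proof.
move=> d0 ab.
have pos (t : R) : 0 < d ^+ 2 + t ^+ 2.
  by rewrite ltr_wpDr ?sqr_ge0// exprn_gt0.
have cinv0 : continuous (fun t : R => (d ^+ 2 + t ^+ 2)^-1).
  move=> t; apply: cvgV; first by rewrite gt_eqF.
  by apply: cvgD; [exact: cvg_cst|exact: exprn_continuous].
have cinv (x : R) : continuous (fun y : R => (d ^+ 2 + (x - y) ^+ 2)^-1).
  move=> y.
  apply: (@continuous_comp _ _ _ (fun y => x - y) (fun t => (d ^+ 2 + t ^+ 2)^-1)).
    by apply: cvgB; [exact: cvg_cst|exact: cvg_id].
  exact: cinv0.
have [||||i1 _] := @Rintegral_Fubini R `[a, b]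
  (fun z => f z.2 * (d / (d ^+ 2 + (z.2 - z.1) ^+ 2)))
  (fun s => d^-1) (fun x => `|f x|) (measurable_itv _).
- apply: measurable_funM; first exact: measurableT_comp measurable_snd.
  apply: measurable_funM => //.
  apply: (@measurableT_comp _ _ _ _ _ _ (fun t : R => (d ^+ 2 + t ^+ 2)^-1)
    _ (fun z : R * R => z.2 - z.1)).
  + exact: continuous_measurable_fun cinv0.
  + by apply: measurable_funB; [exact: measurable_snd|exact: measurable_fst].
- apply: continuous_compact_integrable; first exact: segment_compact.
  by apply: continuous_subspaceT => y; exact: cvg_cst.
- exact: (integrable_norm intf).
- move=> s x _ /=; rewrite normrM mulrC ler_wpM2r// ger0_norm; last first.
    by rewrite divr_ge0 ?ltW.
  rewrite ler_pdivrMr// mulrDr expr2 mulKf ?gt_eqF// lerDl mulr_ge0 ?sqr_ge0//.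
  by rewrite invr_ge0 ltW.
have FdE : Fd d = fun y => \int[mu]_x (f x * (d / (d ^+ 2 + (x - y) ^+ 2))).
  by apply/funext => y; exact: abel_inversion.
rewrite FdE => E; split; first exact: i1.
rewrite [LHS]E; apply: eq_Rintegral => x _ /=.
rewrite RintegralZl; [|exact: measurable_itv|]; last first.
  apply: continuous_compact_integrable; first exact: segment_compact.
  by apply: continuous_subspaceT => y; apply: cvgM; [exact: cvg_cst|exact: cinv].
congr (_ * _); apply: (@FTC_segment _ _ (fun y => atan ((y - x) / d)) _ _ ab).
- by move=> y; apply: cvgM; [exact: cvg_cst|exact: cinv].
- move=> y; apply: is_derive_eq.
  rewrite /GRing.scale/=.
  have -> : 1 + ((y - x) / d) ^+ 2 = (d ^+ 2 + (x - y) ^+ 2) / d ^+ 2.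
    by field; rewrite gt_eqF.
  by field; rewrite (gt_eqF (pos _)) gt_eqF.
Qed.

Let e0 : 0 <= e.
Proof. by have := cos_le 0; rewrite expr0n addr0 divr1; exact: le_trans. Qed.

Let Fd_le d y : 0 < d -> `|Fd d y| <= e * pi.
Proof.
move=> d0.
apply: (@le_trans _ _ (\int[mu]_(xi in I) ((e + e) * (1 + xi ^+ 2)^-1))).
  apply: normr_Rintegral_le => //.
  - apply: measurable_funTS; apply: measurable_funM => //.
    by apply: measurableT_comp => //; apply: measurableT_comp => //;
      exact: measurable_funM.
  - by apply: integrable_Zl => //; exact: integrable_oneDsqrV.
  - move=> x /=; rewrite in_itv/= andbT => x0.
    rewrite normrM (le_trans _ (G_le x y))// ler_piMl// ger0_norm ?expR_ge0//.
    by rewrite -expR0 ler_expR oppr_le0 mulr_ge0// ltW.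
rewrite RintegralZl//; last exact: integrable_oneDsqrV.
rewrite Rintegral0y_oneDsqrV; lra.
Qed.

Let d_ (n : nat) : R := n.+1%:R^-1.
Let d_gt0 n : 0 < d_ n. Proof. by rewrite invr_gt0. Qed.
Let cvg_d : d_ n @[n --> \oo] --> (0:R).
Proof. exact: cvg_harmonic. Qed.

Let cvg_Fd y : Fd (d_ n) y @[n --> \oo] --> F y.
Proof.
apply: (@Rintegral_dominated_cvg _ _ _ _
  (fun xi => (e + e) * (1 + xi ^+ 2)^-1)) => //.
- move=> n; apply: measurable_funTS; apply: measurable_funM => //.
  by apply: measurableT_comp => //; apply: measurableT_comp => //;
    exact: measurable_funM.
- exact: measurable_funTS.
- apply: aeW => xi _; rewrite -[X in _ --> X]mul1r; apply: cvgM; last exact: cvg_cst.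
  have ct : continuous (fun t : R => expR (- (t * xi))).
    move=> t; apply: continuous_comp; last exact: continuous_expR.
    by apply: cvgN; apply: cvgM; [exact: cvg_id|exact: cvg_cst].
  by have := cvg_comp _ _ cvg_d (ct 0); rewrite mul0r oppr0 expR0.
- by apply: integrable_Zl => //; exact: integrable_oneDsqrV.
- move=> n x /=; rewrite in_itv/= andbT => x0.
  rewrite normrM (le_trans _ (G_le x y))// ler_piMl// ger0_norm ?expR_ge0//.
  by rewrite -expR0 ler_expR oppr_le0 mulr_ge0// ltW.
Qed.

Let cvg_atan_pos (t : R) : 0 < t -> atan (t / d_ n) @[n --> \oo] --> (pi / 2 : R).
Proof.
move=> t0.
suff ty : t / d_ n @[n --> \oo] --> +oo by exact: (cvg_comp _ _ ty (@cvgy_atan R)).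
rewrite /d_; under eq_fun do rewrite invrK.
apply/cvgryPge => A; near=> n.
rewrite -ler_pdivrMl// (@le_trans _ _ n%:R)//; last by rewrite ler_nat.
by near: n; exact: nbhs_infty_ger.
Unshelve. all: by end_near. Qed.

Let cvg_atan_neg (t : R) : t < 0 ->
  atan (t / d_ n) @[n --> \oo] --> (- (pi / 2) : R).
Proof.
move=> t0; have := @cvg_atan_pos (- t); rewrite oppr_gt0 => /(_ t0) H.
rewrite (_ : (fun n => _) = (fun n => - atan (- t / d_ n))); last first.
  by apply/funext => n; rewrite mulNr atanN opprK.
exact: cvgN.
Qed.

(** At an endpoint the limit would be [pi / 2]; the two endpoints form a null set. *)
Let cvg_abel_kernel (a b x : R) : a < b -> x != a -> x != b ->
  atan ((b - x) / d_ n) - atan ((a - x) / d_ n) @[n --> \oo] -->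
  (if x \in `[a, b] then pi : R else 0).
Proof.
move=> ab xa xb.
have [xlta|] := ltP x a.
  rewrite in_itv/= leNgt xlta/= -(subrr (pi / 2 : R)).
  by apply: cvgB; apply: cvg_atan_pos; rewrite subr_gt0// (lt_trans xlta).
rewrite le_eqVlt eq_sym (negbTE xa)/= => ax.
have [xltb|] := ltP x b.
  rewrite in_itv/= (ltW ax) (ltW xltb)/=.
  have -> : (pi : R) = pi / 2 - (- (pi / 2)) by field.
  apply: cvgB; first by apply: cvg_atan_pos; rewrite subr_gt0.
  by apply: cvg_atan_neg; rewrite subr_lt0.
rewrite le_eqVlt eq_sym (negbTE xb)/= => bx.
rewrite in_itv/= (leNgt x b) bx/= andbF -(subrr (- (pi / 2) : R)).
by apply: cvgB; apply: cvg_atan_neg; rewrite subr_lt0// (lt_trans _ bx).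
Qed.

Let inversion_segment (a b : R) : a < b ->
  \int[mu]_(y in `[a, b]) F y = pi * \int[mu]_(x in `[a, b]) f x.
Proof.
move=> ab.
have mab : measurable `[a, b]%classic by exact: measurable_itv.
have icst : mu.-integrable `[a, b] (EFin \o (fun=> e * pi)).
  apply: continuous_compact_integrable; first exact: segment_compact.
  by apply: continuous_subspaceT => y; exact: cvg_cst.
have mif : measurable_fun setT (fun x : R => if x \in `[a, b] then pi : R else 0).
  rewrite (_ : (fun x => _) = (fun=> pi) \_ `[a, b]); last first.
    by apply/funext => x; rewrite patchE mem_setE.
  exact: (measurable_restrictT _ _).1.
(* One sequence, two limits: the damping disappears under the bound [e * pi], and the kernel becomes
   [pi] times an indicator under the bound [pi * |f|]. *)
have H1 : \int[mu]_(y in `[a, b]) Fd (d_ n) y @[n --> \oo] -->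
    \int[mu]_(y in `[a, b]) F y.
  apply: (@Rintegral_dominated_cvg _ _ _ _ (fun=> e * pi)) => //.
  - by move=> n; have [/integrable_measurable] := integral_abel (d_gt0 n) ab.
  - exact: measurable_funTS.
  - by apply: aeW => y _; exact: cvg_Fd.
  - by move=> n x _; exact: Fd_le.
have H2 : \int[mu]_(y in `[a, b]) Fd (d_ n) y @[n --> \oo] -->
    \int[mu]_x (f x * (if x \in `[a, b] then pi else 0)).
  rewrite (_ : (fun n => _) = fun n => \int[mu]_x
     (f x * (atan ((b - x) / d_ n) - atan ((a - x) / d_ n)))); last first.
    by apply/funext => n; have [_ ->] := integral_abel (d_gt0 n) ab.
  apply: (@Rintegral_dominated_cvg _ _ _ _ (fun x => pi * `|f x|)) => //.
  - move=> n; apply: measurable_funM => //.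
    have matan : measurable_fun setT (@atan R).
      by apply: continuous_measurable_fun => x; exact: continuous_atan.
    by apply: measurable_funB; apply: measurableT_comp => //;
       apply: measurable_funM => //; exact: measurable_funB.
  - by apply: measurable_funM.
  - have Nae c : {ae mu, forall x, x != c}.
      exists [set c]; split; [exact: measurable_set1|exact: lebesgue_measure_set1|].
      by move=> x /= /negP; rewrite negbK => /eqP.
    have Nab : {ae mu, forall x, x != a /\ x != b}.
      exact: ae_and.
    apply: ae_imply Nab => x [xa xb] _.
    by apply: cvgM; [exact: cvg_cst|exact: cvg_abel_kernel].
  - by apply: integrable_Zl => //; exact: (integrable_norm intf).
  - move=> n x _; rewrite normrM mulrC ler_wpM2r//.
    have := @atan_gtNpi2 R ((b - x) / d_ n); have := @atan_ltpi2 R ((b - x) / d_ n).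
    have := @atan_gtNpi2 R ((a - x) / d_ n); have := @atan_ltpi2 R ((a - x) / d_ n).
    by rewrite ler_norml; lra.
have -> := @cvg_unique _ (@Rhausdorff R) _ _ _ _ H1 H2.
rewrite -RintegralZl//; last by apply: integrableS intf.
rewrite [RHS]Rintegral_mkcond; apply: eq_Rintegral => x _.
rewrite patchE mem_setE/=; case: ifP => _; rewrite ?mulr0//.
by rewrite mulrC.
Qed.

Lemma Fourier_inversion_ae : {ae mu, forall x, pi * f x = F x}.
Proof.
pose g x := pi * f x - F x.
have icst K : compact K -> mu.-integrable K (EFin \o (fun=> e * pi)).
  move=> cK; apply: continuous_compact_integrable => //.
  by apply: continuous_subspaceT => y; exact: cvg_cst.
have iFK K : compact K -> mu.-integrable K (EFin \o F).
  move=> cK; apply: (@integrable_dom _ _ _ (fun=> e * pi)) => //.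
  - exact: compact_measurable.
  - exact: measurable_funTS.
  - exact: icst.
  - by move=> x _; exact: normr_inv_transform_le.
have ig (a b : R) : mu.-integrable `[a, b] (EFin \o g).
  apply: integrable_B => //.
    by apply: integrable_Zl => //; apply: integrableS intf.
  by apply: iFK; exact: segment_compact.
have lg : locally_integrable setT g.
  apply: locally_integrableB.
    by apply: open_integrable_locally; [exact: openT|exact: integrable_Zl].
  split; [exact: mF|exact: openT|move=> K _ cK].
  have mK : measurable K by exact: compact_measurable.
  exact: (@integrable_lty _ _ _ mu K mK _ (integrable_norm (iFK _ cK))).
have g0 (a b : R) : \int[mu]_(y in `[a, b]) g y = 0.
  have [ab|] := ltP a b.
    rewrite /g RintegralB//; last 2 first.
    - by apply: integrable_Zl => //; apply: integrableS intf.
    - by apply: iFK; exact: segment_compact.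
    rewrite RintegralZl//; last by apply: integrableS intf.
    by rewrite inversion_segment// subrr.
  rewrite le_eqVlt => /predU1P[->|ba]; first by rewrite set_itv1 Rintegral_set1.
  by rewrite set_itv_ge ?bnd_simp -?ltNge// Rintegral_set0.
(* Lebesgue differentiation applied to the primitive of [g] based at [- n], which vanishes
   identically. The countably many exceptional sets are united afterwards. *)
have Hn n : {ae mu, forall x : R, - n%:R < x -> g x = 0}.
  have := @FTC1 R g (BLeft (- n%:R)) (fun y => ig _ y) lg.
  apply: ae_imply => x H nx; case: H => [|_ <-]; first by rewrite /= lte_fin.
  rewrite (_ : (fun y => _) = cst 0); first by rewrite derive1_cst.
  by apply/funext => y; exact: g0.
have := ae_foralln Hn; apply: ae_imply => x H.
apply/eqP; rewrite -subr_eq0 -/(g x); apply/eqP.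
apply: (H (Num.trunc `|x|).+1); rewrite ltrNl.
by rewrite (le_lt_trans (ler_norm _))// normrN truncnS_gt.
Qed.

Lemma ae_normr_le_of_transform : {ae mu, forall x, `|f x| <= e}.
Proof.
apply: ae_imply Fourier_inversion_ae => x fF.
have := normr_inv_transform_le x; rewrite -fF normrM gtr0_norm ?pi_gt0//.
by rewrite mulrC ler_pM2r// pi_gt0.
Qed.

(** Replacing one factor of [f ^ 2] by [F / pi] and exchanging the integrals gives [1 / pi] times
    the integral of [cosT ^ 2 + sinT ^ 2] over the half-line, where [(1 + xi ^ 2) ^ (-2)] is bounded
    by [(1 + xi ^ 2)^-1], of integral [pi / 2]. Since [F] is bounded, [f * F] is integrable, and
    square integrability of [f] is part of the conclusion. *)
Lemma Plancherel_le : (\int[mu]_x (f x ^+ 2)%:E <= (e ^+ 2)%:E)%E.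
Proof.
have [||||i1 i2] := @Rintegral_Fubini R I (fun z => f z.2 * G z.1 z.2)
  (fun s => (e + e) * (1 + s ^+ 2)^-1) (fun x => `|f x|) mI.
- by apply: measurable_funM => //; exact: measurableT_comp measurable_snd.
- by apply: integrable_Zl => //; exact: integrable_oneDsqrV.
- exact: (integrable_norm intf).
- by move=> s x _ /=; rewrite normrM mulrC ler_wpM2r.
move=> E.
have E1 xi : \int[mu]_x (f x * G xi x) = cosT f xi ^+ 2 + sinT f xi ^+ 2.
  rewrite (_ : (fun x => _) = fun x => cosT f xi * (f x * cos (xi * x)) +
      sinT f xi * (f x * sin (xi * x))); last by apply/funext => x; rewrite /G; ring.
  rewrite RintegralD; [|exact: measurableT|exact: integrable_Zl|exact: integrable_Zl].
  by rewrite !RintegralZl; do ?[exact: measurableT].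
have E2 x : \int[mu]_(s in I) (f x * G s x) = f x * F x.
  by rewrite RintegralZl.
have E1' : (fun s => \int[mu]_x (f (s, x).2 * G (s, x).1 (s, x).2)) =
    fun xi => cosT f xi ^+ 2 + sinT f xi ^+ 2.
  by apply/funext => xi; exact: E1.
have E2' : (fun x => \int[mu]_(s in I) (f (s, x).2 * G (s, x).1 (s, x).2)) =
    fun x => f x * F x.
  by apply/funext => x; exact: E2.
rewrite E1' in i1 E; rewrite E2' in i2 E.
have -> : (\int[mu]_x (f x ^+ 2)%:E = \int[mu]_x (pi^-1 * (f x * F x))%:E)%E.
  apply: ae_eq_integral => //.
  - by apply/measurable_EFinP; exact: measurable_funX.
  - by apply/measurable_EFinP; do 2 apply: measurable_funM => //.
  - apply: ae_imply Fourier_inversion_ae => x <- _; congr (_%:E).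
    by rewrite (mulrCA (f x)) mulKf ?expr2// gt_eqF ?pi_gt0.
rewrite -EFin_Rintegral//; last exact: integrable_Zl.
rewrite lee_fin RintegralZl// -E ler_pdivrMl ?pi_gt0//.
apply: (@le_trans _ _ (\int[mu]_(xi in I) ((e ^+ 2 + e ^+ 2) * (1 + xi ^+ 2)^-1))).
  apply: le_Rintegral => //.
    by apply: integrable_Zl => //; exact: integrable_oneDsqrV.
  move=> xi _.
  have sq t : `|t| <= e / (1 + xi ^+ 2) -> t ^+ 2 <= e ^+ 2 * (1 + xi ^+ 2)^-1.
    move=> te; rewrite -real_normK ?num_real//.
    have h0 : 0 < (1 + xi ^+ 2)^-1 by rewrite invr_gt0 ltr_wpDr ?sqr_ge0.
    apply: (@le_trans _ _ ((e / (1 + xi ^+ 2)) ^+ 2)).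
      by rewrite ler_sqr ?nnegrE ?mulr_ge0 ?(ltW h0).
    rewrite exprMn ler_wpM2l ?sqr_ge0// expr2 ler_piMl ?(ltW h0)//.
    by rewrite invf_le1 ?lerDl ?sqr_ge0// ltr_wpDr ?sqr_ge0.
  by rewrite mulrDl lerD// sq.
rewrite RintegralZl//; last exact: integrable_oneDsqrV.
rewrite Rintegral0y_oneDsqrV; lra.
Qed.

End Inversion.
End CosSinTransform.

(** * Gaussian integrals *)

Section ComplexGauss.
Context {R : realType}.
Local Notation mu := (@lebesgue_measure R).

(** The exponent is cut into two halves, each giving one factor [1 / (1 + x ^ 2)] through
    [1 + y <= expR y]. *)
Lemma expRN_sqr_le (k x : R) : 0 < k ->
  expR (- (k * x ^+ 2)) <= (1 + 2 / k) ^+ 2 / (1 + x ^+ 2) ^+ 2.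
Proof.
move=> k0; have x0 := sqr_ge0 x.
have h0 : 0 < 1 + x ^+ 2 by rewrite ltr_wpDr.
rewrite -expr_div_n; have -> : k * x ^+ 2 = (k / 2 * x ^+ 2) + (k / 2 * x ^+ 2) by lra.
have k2 : 0 <= 2 / k by rewrite divr_ge0// ltW.
rewrite opprD expRD -expr2 ler_sqr ?nnegrE ?expR_ge0//; last first.
  by rewrite divr_ge0 ?addr_ge0.
rewrite expRN ler_pdivlMr// mulrC ler_pdivrMr ?expR_gt0//.
apply: (@le_trans _ _ ((1 + 2 / k) * (1 + k / 2 * x ^+ 2))).
  have -> : (1 + 2 / k) * (1 + k / 2 * x ^+ 2) =
    1 + x ^+ 2 + (2 / k + k / 2 * x ^+ 2) by field; rewrite gt_eqF.
  by rewrite lerDl addr_ge0// mulr_ge0// divr_ge0// ltW.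
by rewrite ler_wpM2l ?expR_ge1Dx// addr_ge0.
Qed.

Lemma cvg_oneDsqr_dom (F : R -> R) (K : R) :
  (forall x, `|F x| <= K / (1 + x ^+ 2)) ->
  F x @[x --> +oo] --> 0 /\ F x @[x --> -oo] --> 0.
Proof.
move=> FK.
have bnd e x : 0 < e -> `|K| / e <= `|x| -> 1 <= `|x| -> `|F x| <= e.
  move=> e0 xK x1; rewrite (le_trans (FK x))//.
  rewrite ler_pdivrMr ?ltr_wpDr ?sqr_ge0// (le_trans (ler_norm _))//.
  rewrite -ler_pdivrMl// mulrC (le_trans xK)// -(real_normK (num_real x)).
  by rewrite (@le_trans _ _ (`|x| ^+ 2)) ?lerDr// expr2 ler_peMl.
split; apply/cvgr0Pnorm_le => e e0; near=> x.
- have xK : `|K| / e <= x by near: x; apply: nbhs_pinfty_ge; exact: num_real.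
  have x1 : 1 <= x by near: x; apply: nbhs_pinfty_ge; exact: num_real.
  by apply: bnd => //; [apply: le_trans xK _|apply: le_trans x1 _]; exact: ler_norm.
- have xK : `|K| / e <= - x by rewrite lerNr; near: x; apply: nbhs_ninfty_le; exact: num_real.
  have x1 : 1 <= - x by rewrite lerNr; near: x; apply: nbhs_ninfty_le; exact: num_real.
  by apply: bnd => //; rewrite -normrN;
    [apply: le_trans xK _|apply: le_trans x1 _]; exact: ler_norm.
Unshelve. all: by end_near. Qed.

Section Phase.
Variables (r1 r2 s1 s2 phi : R).
Hypothesis r21 : `|r2| < r1.

(* Let [Z = X + i t w].  Then [P t x] and [H t x] are the real parts of
   [(dZ / dx) exp (- Z ^ 2 - i phi)] and [(dZ / dt) exp (- Z ^ 2 - i phi)], so that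
   [dP / dt = dH / dx]: the integral of [P t] does not depend on [t], which tilts
   the line of integration from the real axis at [t = 0] to the one wanted. *)
Let X (x : R) := r1 * x + s1.
Let w (x : R) := r2 * x + s2.
Let E (t x : R) := expR ((t * w x) ^+ 2 - X x ^+ 2).
Let th (t x : R) := 2 * X x * (t * w x) + phi.
Let P (t x : R) := E t x * (r1 * cos (th t x) + t * r2 * sin (th t x)).
Let H (t x : R) := E t x * (w x * sin (th t x)).
Let p (t x : R) := E t x *
  (2 * (t * w x) * w x * (r1 * cos (th t x) + t * r2 * sin (th t x))
   + (r2 * sin (th t x)
      + 2 * X x * w x * (t * r2 * cos (th t x) - r1 * sin (th t x)))).

Let dP (t x : R) : is_derive t (1 : R) (P ^~ x) (p t x).
Proof.
apply: is_derive_eq; rewrite /p /P /E /th /X /w /GRing.scale/=.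
ring.
Qed.

Let dH (t x : R) : is_derive x (1 : R) (H t) (p t x).
Proof.
apply: is_derive_eq; rewrite /p /H /E /th /X /w /GRing.scale/=.
ring.
Qed.

Let r1_gt0 : 0 < r1. Proof. exact: le_lt_trans r21. Qed.

Let A := `|r1| + `|r2| + `|s1| + `|s2|.
Let A0 : 0 <= A. Proof. by rewrite !addr_ge0. Qed.

Let affine_sqr_le (r s x : R) : `|r| <= A -> `|s| <= A ->
  (r * x + s) ^+ 2 <= 4 * A ^+ 2 * (1 + x ^+ 2).
Proof.
move=> rA sA.
have r2A : r ^+ 2 <= A ^+ 2 by rewrite -(real_normK (num_real r)) ler_sqr.
have s2A : s ^+ 2 <= A ^+ 2 by rewrite -(real_normK (num_real s)) ler_sqr.
have : r ^+ 2 * x ^+ 2 <= A ^+ 2 * x ^+ 2 by rewrite ler_wpM2r ?sqr_ge0.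
have := sqr_ge0 (r * x - s); have := mulr_ge0 (sqr_ge0 A) (sqr_ge0 x).
by have := sqr_ge0 A; rewrite (sqrrB (r * x)) (sqrrD (r * x)) exprMn; lra.
Qed.

Let X2_le x : X x ^+ 2 <= 4 * A ^+ 2 * (1 + x ^+ 2).
Proof.
apply: affine_sqr_le; rewrite /A; have := normr_ge0 r1; have := normr_ge0 r2;
  have := normr_ge0 s1; have := normr_ge0 s2; lra.
Qed.

Let w2_le x : w x ^+ 2 <= 4 * A ^+ 2 * (1 + x ^+ 2).
Proof.
apply: affine_sqr_le; rewrite /A; have := normr_ge0 r1; have := normr_ge0 r2;
  have := normr_ge0 s1; have := normr_ge0 s2; lra.
Qed.

Let c := r1 ^+ 2 - r2 ^+ 2.
Let c0 : 0 < c.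
Proof.
rewrite subr_gt0 -(real_normK (num_real r2)) -(real_normK (num_real r1)).
by rewrite ltr_sqr ?nnegrE// (gtr0_norm r1_gt0).
Qed.

Let b := r1 * s1 - r2 * s2.
Let D := expR (2 * b ^+ 2 / c + s2 ^+ 2) * (1 + 2 / (c / 2)) ^+ 2.
Let D0 : 0 <= D. Proof. by rewrite mulr_ge0 ?expR_ge0 ?sqr_ge0. Qed.

(** The worst case is [t = 1], where the quadratic coefficient of the exponent is [- c], negative
    because [|r2| < r1]. Half of it absorbs the linear term, the other half gives the decay,
    uniformly in [t]. *)
Let E_le (t x : R) : 0 <= t <= 1 -> E t x <= D / (1 + x ^+ 2) ^+ 2.
Proof.
move=> /andP[t0 t1]; rewrite /D -mulrA.
apply: (@le_trans _ _ (expR (2 * b ^+ 2 / c + s2 ^+ 2) *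
    expR (- (c / 2 * x ^+ 2)))); last first.
  by rewrite ler_wpM2l ?expR_ge0// expRN_sqr_le// divr_gt0.
rewrite -expRD ler_expR.
have tw : (t * w x) ^+ 2 <= w x ^+ 2.
  by rewrite exprMn ler_piMl ?sqr_ge0// expr_le1.
have wX : w x ^+ 2 - X x ^+ 2 = - (c * x ^+ 2) - 2 * b * x + s2 ^+ 2 - s1 ^+ 2.
  by rewrite /w /X /c /b; ring.
have bx : - (2 * b * x) <= 2 * b ^+ 2 / c + c / 2 * x ^+ 2.
  have : 0 <= 2 / c * (b + c / 2 * x) ^+ 2.
    by rewrite mulr_ge0 ?sqr_ge0// divr_ge0// ltW.
  have -> : 2 / c * (b + c / 2 * x) ^+ 2 =
    2 * b ^+ 2 / c + c / 2 * x ^+ 2 + 2 * b * x by field; rewrite gt_eqF.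
  lra.
have := sqr_ge0 s1; lra.
Qed.

Let u_gt0 (x : R) : 0 < 1 + x ^+ 2. Proof. by rewrite ltr_wpDr ?sqr_ge0. Qed.

(** A factor of quadratic growth uses up one of the two powers in [E_le]; the remaining one is
    integrable. *)
Let E_dom (t x M K : R) : 0 <= t <= 1 -> `|M| <= K * (1 + x ^+ 2) ->
  `|E t x * M| <= D * K * (1 + x ^+ 2)^-1.
Proof.
move=> t01 MK; rewrite normrM ger0_norm ?expR_ge0//.
apply: (@le_trans _ _ (D / (1 + x ^+ 2) ^+ 2 * (K * (1 + x ^+ 2)))).
  by apply: ler_pM => //; [exact: expR_ge0|exact: E_le].
rewrite le_eqVlt; apply/orP; left; apply/eqP.
by field; rewrite gt_eqF.
Qed.

(** Two products of [8 A ^ 2] with [2 r1], plus [r1] for the middle term of [p]. *)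
Let Kp := r1 * (1 + 32 * A ^+ 2).
Let p_le (t x : R) : 0 <= t <= 1 -> `|p t x| <= D * Kp * (1 + x ^+ 2)^-1.
Proof.
move=> t01; apply: E_dom => //.
move: (t01) => /andP[t0 t1].
have trig (y : R) : `|r1 * cos y + t * r2 * sin y| <= 2 * r1 /\
    `|t * r2 * cos y - r1 * sin y| <= 2 * r1.
  have hc := cos_max y; have hs := sin_max y.
  have tr2 : `|t * r2| <= r1.
    by rewrite normrM (ger0_norm t0) (le_trans (ler_piMl _ t1))// ltW.
  have m (z y' : R) : `|z| <= r1 -> `|y'| <= 1 -> `|z * y'| <= r1.
    by move=> zr y1; rewrite normrM (le_trans (ler_piMr _ y1)).
  have r1n : `|r1| <= r1 by rewrite gtr0_norm.
  split.
    rewrite (le_trans (ler_normD _ _))//.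
    by have := m _ _ r1n hc; have := m _ _ tr2 hs; lra.
  rewrite (le_trans (ler_normB _ _))//.
  by have := m _ _ r1n hs; have := m _ _ tr2 hc; lra.
have [T1 T2] := trig (th t x).
have ww : `|2 * (t * w x) * w x| <= 8 * A ^+ 2 * (1 + x ^+ 2).
  have -> : 2 * (t * w x) * w x = 2 * (t * w x ^+ 2) by ring.
  have tw0 : 0 <= t * w x ^+ 2 := mulr_ge0 t0 (sqr_ge0 _).
  rewrite ger0_norm; last by rewrite mulr_ge0.
  have : t * w x ^+ 2 <= w x ^+ 2 by rewrite ler_piMl ?sqr_ge0.
  have := w2_le x; lra.
have Xw : `|2 * X x * w x| <= 8 * A ^+ 2 * (1 + x ^+ 2).
  have := X2_le x; have := w2_le x.
  have := sqr_ge0 (X x - w x); have := sqr_ge0 (X x + w x).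
  rewrite (sqrrB (X x)) (sqrrD (X x)) ler_norml => ? ? ? ?.
  by apply/andP; split; rewrite -mulrA; lra.
have rs : `|r2 * sin (th t x)| <= r1.
  by rewrite normrM (le_trans (ler_piMr _ (sin_max _)))// ltW.
have U : 1 <= 1 + x ^+ 2 by rewrite lerDl sqr_ge0.
rewrite (le_trans (ler_normD _ _))// (le_trans (lerD (lexx _) (ler_normD _ _)))//.
rewrite !(normrM (2 * _ * _)).
have M1 := ler_pM (normr_ge0 _) (normr_ge0 _) ww T1.
have M2 := ler_pM (normr_ge0 _) (normr_ge0 _) Xw T2.
have : r1 <= r1 * (1 + x ^+ 2) by rewrite ler_peMr// ltW.
rewrite /Kp; move: M1 M2 rs; rewrite !normrM; lra.
Qed.

Let H_le (t x : R) : 0 <= t <= 1 ->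
  `|H t x| <= D * (1 + 4 * A ^+ 2) * (1 + x ^+ 2)^-1.
Proof.
move=> t01; apply: E_dom => //.
rewrite normrM (le_trans (ler_piMr _ (sin_max _)))//.
have := w2_le x; have := sqr_ge0 x; have := sqr_ge0 (`|w x| - 1).
rewrite (sqrrB `|w x|) expr1n (real_normK (num_real (w x))).
have := normr_ge0 (w x); have := sqr_ge0 A; have := mulr_ge0 (sqr_ge0 A) (sqr_ge0 x).
lra.
Qed.

Let P_le (t x : R) : 0 <= t <= 1 -> `|P t x| <= D * (2 * r1) * (1 + x ^+ 2)^-1.
Proof.
move=> t01; apply: E_dom => //.
move: (t01) => /andP[t0 t1].
have U : 1 <= 1 + x ^+ 2 by rewrite lerDl sqr_ge0.
apply: (@le_trans _ _ (2 * r1)); last by rewrite ler_peMr// mulr_ge0// ltW.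
rewrite (le_trans (ler_normD _ _))// !normrM (ger0_norm t0) (gtr0_norm r1_gt0).
have tr2 : t * `|r2| <= r1 by rewrite (le_trans (ler_piMl _ t1))// ltW.
have := ler_pM (ltW r1_gt0) (normr_ge0 _) (lexx r1) (cos_max (th t x)).
have := ler_pM (mulr_ge0 t0 (normr_ge0 r2)) (normr_ge0 _) tr2 (sin_max (th t x)).
lra.
Qed.

Let cp t : continuous (p t).
Proof.
move=> x; apply: differentiable_continuous; apply/derivable1_diffP.
exact: ex_derive.
Qed.

Let cpt x : continuous (p ^~ x).
Proof.
move=> t; apply: differentiable_continuous; apply/derivable1_diffP.
exact: ex_derive.
Qed.

Let cP t : continuous (P t).
Proof.
move=> x; apply: differentiable_continuous; apply/derivable1_diffP.
exact: ex_derive.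
Qed.

Let idom K : mu.-integrable setT (EFin \o (fun x : R => K * (1 + x ^+ 2)^-1)).
Proof. by apply: integrable_Zl => //; exact: integrable_oneDsqrV. Qed.

Let iP t : 0 <= t <= 1 -> mu.-integrable setT (EFin \o P t).
Proof.
move=> t01; apply: integrable_dom (idom (D * (2 * r1))) _ => //.
  exact: continuous_measurable_fun.
by move=> x _; exact: P_le.
Qed.

Let ip t : 0 <= t <= 1 -> mu.-integrable setT (EFin \o p t).
Proof.
move=> t01; apply: integrable_dom (idom (D * Kp)) _ => //.
  exact: continuous_measurable_fun.
by move=> x _; exact: p_le.
Qed.

Let intp0 t : 0 <= t <= 1 -> \int[mu]_x p t x = 0.
Proof.
move=> t01.
have [H1 H2] := cvg_oneDsqr_dom (fun x => H_le x t01).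
apply: (@integral_deriv_line _ _ (H t)); [exact: cp|exact: dH|exact: ip|by []|by []].
Qed.

Let mp : measurable_fun setT (fun z : R * R => p z.1 z.2).
Proof.
have m1 : measurable_fun setT (fun z : R * R => z.1) by exact: measurable_fst.
have mX : measurable_fun setT (fun z : R * R => X z.2).
  by apply: measurable_funD => //; apply: measurable_funM => //; exact: measurable_snd.
have mw : measurable_fun setT (fun z : R * R => w z.2).
  by apply: measurable_funD => //; apply: measurable_funM => //; exact: measurable_snd.
have mE : measurable_fun setT (fun z : R * R => E z.1 z.2).
  apply: measurableT_comp => //; apply: measurable_funB; apply: measurable_funX => //.
  exact: measurable_funM.
have mth : measurable_fun setT (fun z : R * R => th z.1 z.2).
  apply: measurable_funD => //; apply: measurable_funM; apply: measurable_funM => //.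
have mc : measurable_fun setT (fun z : R * R => cos (th z.1 z.2)).
  apply: measurableT_comp mth; exact: continuous_measurable_fun (@continuous_cos R).
have ms : measurable_fun setT (fun z : R * R => sin (th z.1 z.2)).
  apply: measurableT_comp mth; exact: continuous_measurable_fun (@continuous_sin R).
apply: measurable_funM => //.
apply: measurable_funD; last apply: measurable_funD.
- apply: measurable_funM.
    by do 2 (apply: measurable_funM => //); exact: measurable_funM.
  apply: measurable_funD; apply: measurable_funM => //; exact: measurable_funM.
- exact: measurable_funM.
- apply: measurable_funM; first by do 2 (apply: measurable_funM => //).
  apply: measurable_funB; apply: measurable_funM => //; exact: measurable_funM.
Qed.

Let int_path : \int[mu]_x P 1 x = \int[mu]_x P 0 x.
Proof.
apply/eqP; rewrite -subr_eq0 -RintegralB//; [|apply: iP; lra..].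
have [||||_ _] := @Rintegral_Fubini R `[0, 1] (fun z => p z.1 z.2)
  (fun=> D * Kp) (fun x => (1 + x ^+ 2)^-1) _ mp.
- exact: measurable_itv.
- apply: continuous_compact_integrable; first exact: segment_compact.
  by apply: continuous_subspaceT => y; exact: cvg_cst.
- exact: integrable_oneDsqrV.
- by move=> s x /=; rewrite in_itv/= => s01; exact: p_le.
move=> /= E1.
apply/eqP; transitivity (\int[mu]_x \int[mu]_(t in `[0, 1]) p t x).
  apply: eq_Rintegral => x _.
  by symmetry; apply: (@FTC_segment _ _ (P ^~ x)).
rewrite -E1; transitivity (\int[mu]_(t in `[0, 1]) (0 : R)).
  by apply: eq_Rintegral => t; rewrite inE/= in_itv/=; exact: intp0.
by rewrite Rintegral_cst ?mul0r//; exact: measurable_itv.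
Qed.

(** At [t = 0] the substitution [y = r1 * x + s1] leads to the integral of [exp (- y ^ 2)]. *)
Let int_start : \int[mu]_x P 0 x = Num.sqrt pi * cos phi.
Proof.
have PE x : P 0 x = cos phi * (gauss_fun (r1 * x + s1) * r1).
  rewrite /P /E /th !(mul0r, mulr0, add0r, addr0) /gauss_fun.
  by rewrite expr0n add0r /X; ring.
pose F (x : R) := r1 * x + s1.
have dF (x : R) : is_derive x (1 : R) F r1.
  by apply: is_derive_eq; rewrite /GRing.scale/=; ring.
have FE : F = fun x => r1 * (x + s1 / r1).
  by apply/funext => x; rewrite /F mulrDr mulrCA mulfV ?mulr1// gt_eqF.
have F' : derive1 F = cst r1 by apply/funext => x; rewrite derive1E derive_val.
have iG : (\int[mu]_x (gauss_fun (F x) * r1)%:E = (Num.sqrt pi)%:E)%E.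
  rewrite -integralT_gauss (@increasing_ge0_integration_by_substitutionT _ F)//.
  - by apply: eq_integral => x _; rewrite F'.
  - by move=> x y xy; rewrite ltrD2r ltr_pM2l.
  - by rewrite F'; exact: cst_continuous.
  - by rewrite F'; exact: is_cvg_cst.
  - by rewrite F'; exact: is_cvg_cst.
  - by rewrite FE; apply: (gt0_cvgMrNy r1_gt0); exact: cvg_addrr_Ny.
  - by rewrite FE; apply: (gt0_cvgMry r1_gt0); exact: cvg_addrr.
  - exact: continuous_gauss_fun.
  - by move=> x; exact: gauss_fun_ge0.
transitivity (\int[mu]_x (cos phi * (gauss_fun (F x) * r1))).
  by apply: eq_Rintegral => x _; exact: PE.
rewrite RintegralZl//; last first.
  apply/integrableP; split.
    apply/measurable_EFinP; apply: measurable_funM => //.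
    apply: measurableT_comp; first exact: measurable_gauss_fun.
    by apply: measurable_funD => //; exact: measurable_funM.
  under eq_integral => x _.
    by rewrite /= ger0_norm ?mulr_ge0 ?gauss_fun_ge0 ?(ltW r1_gt0)//; over.
  by rewrite iG ltry.
by rewrite /Rintegral iG mulrC.
Qed.

(** The free phase yields both parts of a complex integral: replacing [phi] by [phi + pi / 2]
    multiplies the complex integrand by [- i], which brings its imaginary part into the real
    part. *)
Lemma Rintegral_complex_gauss :
  mu.-integrable setT (EFin \o (fun x => expR (w x ^+ 2 - X x ^+ 2) *
    (r1 * cos (2 * X x * w x + phi) + r2 * sin (2 * X x * w x + phi)))) /\
  \int[mu]_x (expR (w x ^+ 2 - X x ^+ 2) *
    (r1 * cos (2 * X x * w x + phi) + r2 * sin (2 * X x * w x + phi))) =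
  Num.sqrt pi * cos phi.
Proof.
have P1 : P 1 = (fun x => expR (w x ^+ 2 - X x ^+ 2) *
    (r1 * cos (2 * X x * w x + phi) + r2 * sin (2 * X x * w x + phi))).
  by apply/funext => x; rewrite /P /E /th !mul1r.
rewrite -P1; split; last by rewrite int_path int_start.
by apply: iP; lra.
Qed.

End Phase.
End ComplexGauss.

(** * The complex exponential *)

Section ComplexExp.
Context {R : realType}.
Implicit Types (z : R[i]) (x y : R).

Lemma complexRe_D (z w : R[i]) : Re (z + w) = Re z + Re w.
Proof. by case: z w => [? ?] [? ?]. Qed.
Lemma complexIm_D (z w : R[i]) : Im (z + w) = Im z + Im w.
Proof. by case: z w => [? ?] [? ?]. Qed.
Lemma complexRe_N (z : R[i]) : Re (- z) = - Re z.
Proof. by case: z. Qed.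
Lemma complexIm_N (z : R[i]) : Im (- z) = - Im z.
Proof. by case: z. Qed.
Lemma complexRe_M (z w : R[i]) : Re (z * w) = Re z * Re w - Im z * Im w.
Proof. by case: z w => [? ?] [? ?]. Qed.
Lemma complexIm_M (z w : R[i]) : Im (z * w) = Re z * Im w + Im z * Re w.
Proof. by case: z w => [? ?] [? ?]. Qed.

Lemma complex_ext (z w : R[i]) : Re z = Re w -> Im z = Im w -> z = w.
Proof. by case: z w => [a b] [c d] /= -> ->. Qed.

Definition complexReIm := (complexRe_D, complexIm_D, complexRe_N, complexIm_N,
  complexRe_M, complexIm_M).

Lemma normc_sqr z : normc z ^+ 2 = Re z ^+ 2 + Im z ^+ 2.
Proof. by case: z => a b /=; rewrite sqr_sqrtr// addr_ge0// sqr_ge0. Qed.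

Lemma normc_ge0 z : 0 <= normc z.
Proof. by case: z => a b /=; exact: sqrtr_ge0. Qed.

Lemma normc_real x : normc x%:C = `|x|.
Proof. by rewrite /= expr0n addr0 sqrtr_sqr. Qed.

Lemma normr_Re_le z : `|Re z| <= normc z.
Proof.
rewrite -ler_sqr ?nnegrE ?normc_ge0// real_normK ?num_real// normc_sqr.
by rewrite lerDl sqr_ge0.
Qed.

Lemma normr_Im_le z : `|Im z| <= normc z.
Proof.
rewrite -ler_sqr ?nnegrE ?normc_ge0// real_normK ?num_real// normc_sqr.
by rewrite lerDr sqr_ge0.
Qed.

Lemma Re_cexp z : Re (cexp z) = expR (Re z) * cos (Im z).
Proof. by rewrite /cexp complexRe_M /= mul0r subr0. Qed.

Lemma Im_cexp z : Im (cexp z) = expR (Re z) * sin (Im z).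
Proof. by rewrite /cexp complexIm_M /= mul0r addr0. Qed.

Lemma cexpD z w : cexp (z + w) = cexp z * cexp w.
Proof.
apply: complex_ext; rewrite !(complexReIm, Re_cexp, Im_cexp) expRD ?cosD ?sinD; ring.
Qed.

Lemma cexp0 : cexp (0 : R[i]) = 1.
Proof. by apply: complex_ext; rewrite ?Re_cexp ?Im_cexp /= expR0 ?cos0 ?sin0 mul1r. Qed.

Lemma cexp_real x : cexp x%:C = (expR x)%:C.
Proof.
by apply: complex_ext; rewrite ?Re_cexp ?Im_cexp /= ?cos0 ?sin0 ?mulr1 ?mulr0.
Qed.

Lemma normc_cexp z : normc (cexp z) = expR (Re z).
Proof.
apply/eqP; rewrite -(@eqrXn2 _ 2) ?normc_ge0 ?expR_ge0// normc_sqr Re_cexp Im_cexp.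
by rewrite !exprMn -mulrDr cos2Dsin2 mulr1.
Qed.

Lemma derive_ge0_le (f df : R -> R) (a b : R) : a <= b ->
  (forall t : R, is_derive t 1 f (df t)) ->
  (forall t : R, a <= t <= b -> 0 <= df t) -> f a <= f b.
Proof.
move=> ab fdf df0.
have cf : continuous f.
  move=> t; apply: differentiable_continuous; apply/derivable1_diffP.
  exact: ex_derive.
have [c cab fE] := @MVT_segment _ f df a b ab (fun t _ => fdf t)
  (continuous_subspaceT cf).
rewrite -subr_ge0 fE mulr_ge0// ?subr_ge0// df0//; rewrite in_itv in cab.
Qed.

(** Both [g - f] and [g + f] are nondecreasing on the interval from 0 to [t]. *)
Lemma normr_le_of_derive (f df g dg : R -> R) (t : R) : 0 <= t ->
  (forall s : R, is_derive s 1 f (df s)) ->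
  (forall s : R, is_derive s 1 g (dg s)) ->
  `|f 0| <= g 0 -> (forall s : R, 0 <= s <= t -> `|df s| <= dg s) ->
  `|f t| <= g t.
Proof.
move=> t0 fdf gdg fg0 dfg.
have H1 : g 0 - f 0 <= g t - f t.
  apply: (@derive_ge0_le (fun s => g s - f s) (fun s => dg s - df s)) => //.
  by move=> s /dfg; rewrite ler_norml subr_ge0 => /andP[].
have H2 : g 0 + f 0 <= g t + f t.
  apply: (@derive_ge0_le (fun s => g s + f s) (fun s => dg s + df s)) => //.
  by move=> s /dfg; rewrite ler_norml => /andP[]; lra.
move: fg0; rewrite !ler_norml => /andP[? ?]; apply/andP; split; lra.
Qed.

Lemma is_derive_powS n (t : R) :
  is_derive t 1 (fun x : R => x ^+ n.+1) (n.+1%:R * t ^+ n).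
Proof.
apply: DeriveDef; first exact: exprn_derivable.
by rewrite exp_derive /GRing.scale/= mulr1.
Qed.

Lemma is_derive_psum (c : nat -> R) n (t : R) :
  is_derive t 1 (fun t => \sum_(0 <= k < n.+1) (c k * (t ^+ k / k`!%:R)))
   (\sum_(0 <= k < n) (c k.+1 * (t ^+ k / k`!%:R))).
Proof.
elim: n => [|n ih].
  rewrite big_nil; under eq_fun do rewrite big_nat1 expr0; exact: is_derive_cst.
under eq_fun do rewrite big_nat_recr//=.
rewrite [in X in is_derive _ _ _ X]big_nat_recr//=.
have dX := is_derive_powS n t.
have n1 : n.+1%:R != 0 :> R by rewrite pnatr_eq0.
have nf : n`!%:R != 0 :> R by rewrite pnatr_eq0 -lt0n fact_gt0.
have dc : is_derive t 1 (fun x : R => c n.+1 * (x ^+ n.+1 / n.+1`!%:R))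
    (c n.+1 * (t ^+ n / n`!%:R)).
  apply: is_derive_eq; rewrite /GRing.scale/= factS natrM; field.
  by rewrite nf -natr1 addrC in n1 *.
exact: is_deriveD.
Qed.

Section Series.
Variable z : R[i].

Let c k := Re (z ^+ k).
Let d k := Im (z ^+ k).
Let L := `|Re z| + `|Im z|.
Let M := expR L.

(** With [remIm], the two parts of the remainder after [n] terms of the series of [exp (z t)]. The
    derivative of the remainder of order [n + 1] is [z] times the one of order [n], so bounds follow
    by induction on [n]; [L] dominates both components of a multiplication by [z]. *)
Let remRe n (t : R) := expR (Re z * t) * cos (Im z * t) -
  \sum_(0 <= k < n) (c k * (t ^+ k / k`!%:R)).
Let remIm n (t : R) := expR (Re z * t) * sin (Im z * t) -
  \sum_(0 <= k < n) (d k * (t ^+ k / k`!%:R)).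

Let cS k : c k.+1 = Re z * c k - Im z * d k.
Proof. by rewrite /c exprS complexRe_M. Qed.

Let dS k : d k.+1 = Re z * d k + Im z * c k.
Proof. by rewrite /d exprS complexIm_M. Qed.

Let dremRe n (t : R) : is_derive t 1 (remRe n.+1) (Re z * remRe n t - Im z * remIm n t).
Proof.
have := is_derive_psum c n t => ds.
apply: is_derive_eq; rewrite /GRing.scale/= /remRe /remIm.
under eq_bigr do rewrite cS mulrBl -!mulrA.
rewrite sumrB -!mulr_sumr; ring.
Qed.

Let dremIm n (t : R) : is_derive t 1 (remIm n.+1) (Re z * remIm n t + Im z * remRe n t).
Proof.
have := is_derive_psum d n t => ds.
apply: is_derive_eq; rewrite /GRing.scale/= /remRe /remIm.
under eq_bigr do rewrite dS mulrDl -!mulrA.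
rewrite big_split /= -!mulr_sumr; ring.
Qed.

Let rem0 n : remRe n.+1 0 = 0 /\ remIm n.+1 0 = 0.
Proof.
rewrite /remRe /remIm !big_nat_recl// !mulr0 expR0 cos0 sin0 !expr0 divr1 /c /d !expr0.
by rewrite !big1 => [|i _|i _] /=; rewrite ?exprS ?mul0r ?mulr0//; split; ring.
Qed.

Let rem_le n (t : R) : 0 <= t <= 1 ->
  `|remRe n t| <= M * ((L * t) ^+ n / n`!%:R) /\
  `|remIm n t| <= M * ((L * t) ^+ n / n`!%:R).
Proof.
have L0 : 0 <= L by rewrite addr_ge0.
elim: n t => [|n ih] t /andP[t0 t1].
  rewrite /remRe /remIm !big_nil !subr0 expr0 fact0 divr1 mulr1.
  have eM : expR (Re z * t) <= M.
    rewrite ler_expR (le_trans (ler_norm _))// normrM (ger0_norm t0).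
    by rewrite (le_trans (ler_piMr _ t1))// lerDl.
  split; rewrite normrM (ger0_norm (expR_ge0 _)) -[leRHS]mulr1;
    by apply: ler_pM => //; rewrite ?expR_ge0 ?cos_max ?sin_max.
have dg (s : R) : is_derive s 1 (fun s : R => M * ((L * s) ^+ n.+1 / n.+1`!%:R))
    (L * (M * ((L * s) ^+ n / n`!%:R))).
  have dX := is_derive_powS n s.
  have n1 : n.+1%:R != 0 :> R by rewrite pnatr_eq0.
  have nf : n`!%:R != 0 :> R by rewrite pnatr_eq0 -lt0n fact_gt0.
  under eq_fun do rewrite exprMn.
  apply: is_derive_eq; rewrite /GRing.scale/= exprMn exprS factS natrM; field.
  by rewrite nf -natr1 addrC in n1 *.
have ih' s : 0 <= s <= t -> `|remRe n s| <= M * ((L * s) ^+ n / n`!%:R) /\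
  `|remIm n s| <= M * ((L * s) ^+ n / n`!%:R).
  by move=> /andP[s0 st]; apply: ih; rewrite s0 (le_trans st).
have [r0 i0] := rem0 n.
have B a b u w v : `|a| <= v -> `|b| <= v -> `|u| = `|Re z| -> `|w| = `|Im z| ->
    `|u * a + w * b| <= L * v.
  move=> av bv uz wz; rewrite (le_trans (ler_normD _ _))// !normrM uz wz mulrDl.
  by rewrite lerD// ler_wpM2l.
split.
- apply: (normr_le_of_derive t0 (dremRe n) dg).
    by rewrite r0 normr0 !mulr0 expr0n mul0r mulr0.
  move=> s /ih'[r i]; rewrite -mulNr.
  by apply: B => //; rewrite normrN.
- apply: (normr_le_of_derive t0 (dremIm n) dg).
    by rewrite i0 normr0 !mulr0 expr0n mul0r mulr0.
  by move=> s /ih'[r i]; apply: B.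
Qed.

Let cvg_rem (r : nat -> R) : (forall n, `|r n| <= M * (L ^+ n / n`!%:R)) ->
  r n @[n --> \oo] --> (0 : R).
Proof.
move=> rM; apply: norm_cvg0.
apply: (@squeeze_cvgr _ _ _ _ (cst 0) (fun n => M * exp_coeff L n)).
- by apply: nearW => n; rewrite normr_ge0 rM.
- exact: cvg_cst.
- rewrite -[X in _ --> X](mulr0 M); apply: cvgM; first exact: cvg_cst.
  exact: cvg_exp_coeff.
Qed.

(** The bridge between [qexp], defined by its power series, and [cexp], defined by real
    functions. *)
Lemma cvg_cexp_series :
  (Re (\sum_(0 <= k < n) ((k`!%:R^-1 : R[i]) * z ^+ k)) @[n --> \oo] --> Re (cexp z)) /\
  (Im (\sum_(0 <= k < n) ((k`!%:R^-1 : R[i]) * z ^+ k)) @[n --> \oo] --> Im (cexp z)).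
Proof.
have t1 : 0 <= (1 : R) <= 1 by rewrite ler01 lexx.
have kC k : (k`!%:R^-1 : R[i]) = (k`!%:R^-1 : R)%:C by rewrite fmorphV rmorph_nat.
have ReE n : Re (\sum_(0 <= k < n) ((k`!%:R^-1 : R[i]) * z ^+ k)) =
    Re (cexp z) - remRe n 1.
  rewrite /remRe Re_cexp !mulr1 opprB addrC subrK.
  elim: n => [|n ih]; first by rewrite !big_nil.
  rewrite !big_nat_recr//= complexRe_D ih kC complexRe_M /= mul0r subr0 expr1n.
  by rewrite mul1r mulrC.
have ImE n : Im (\sum_(0 <= k < n) ((k`!%:R^-1 : R[i]) * z ^+ k)) =
    Im (cexp z) - remIm n 1.
  rewrite /remIm Im_cexp !mulr1 opprB addrC subrK.
  elim: n => [|n ih]; first by rewrite !big_nil.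
  rewrite !big_nat_recr//= complexIm_D ih kC complexIm_M /= mul0r addr0 expr1n.
  by rewrite mul1r mulrC.
split.
- under eq_fun do rewrite ReE.
  suff : Re (cexp z) - remRe n 1 @[n --> \oo] --> Re (cexp z) - 0 by rewrite subr0.
  apply: cvgB; first exact: cvg_cst.
  by apply: cvg_rem => n; have [] := rem_le n t1; rewrite mulr1.
- under eq_fun do rewrite ImE.
  suff : Im (cexp z) - remIm n 1 @[n --> \oo] --> Im (cexp z) - 0 by rewrite subr0.
  apply: cvgB; first exact: cvg_cst.
  by apply: cvg_rem => n; have [] := rem_le n t1; rewrite mulr1.
Qed.

End Series.

End ComplexExp.

(** * Diagonalization of the quaternionic calculus *)

Section QuatSplit.
Context {R : realType}.
Implicit Types (z w : R[i]).
Local Notation J := ('i%C : R[i]).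

Section UnitVector.
Variables n1 n2 n3 : R.
Hypothesis n_unit : n1 ^+ 2 + n2 ^+ 2 + n3 ^+ 2 = 1.

(* The inverse of [x + y n |-> (x + i y, x - i y)] for [n = n1 e_1 + n2 e_2 + n3 e_3]. *)
Definition qsplit z w : quat R[i] :=
  Quat ((z + w) / 2) (J * ((w - z) / 2) * n1%:C)
    (J * ((w - z) / 2) * n2%:C) (J * ((w - z) / 2) * n3%:C).
Local Notation Phi := qsplit.

Let nC : n1%:C ^+ 2 + n2%:C ^+ 2 + n3%:C ^+ 2 = 1 :> R[i].
Proof. by rewrite -!rmorphXn -!rmorphD n_unit. Qed.

Let JJ : J * J = -1. Proof. by rewrite -expr2 sqr_i. Qed.

Lemma qsplitD z w z' w' : Phi z w + Phi z' w' = Phi (z + z') (w + w').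
Proof. by congr Quat; rewrite /=; field. Qed.

Lemma qsplitN z w : - Phi z w = Phi (- z) (- w).
Proof. by congr Quat; rewrite /=; field. Qed.

Lemma qsplitB z w z' w' : Phi z w - Phi z' w' = Phi (z - z') (w - w').
Proof. by rewrite qsplitN qsplitD. Qed.

Lemma qsplitZ c z w : c *: Phi z w = Phi (c * z) (c * w).
Proof. by congr Quat; rewrite /=; field. Qed.

Lemma qsplit_scalar c : c%:A = Phi c c.
Proof.
congr Quat; rewrite /= ?subrr ?mul0r ?mulr0 ?mul0r ?mulr1//.
by field.
Qed.

Lemma qsplitM z w z' w' : Phi z w * Phi z' w' = Phi (z * z') (w * w').
Proof.
congr Quat; rewrite /=.
(* The scalar part uses that [n] squares to -1; in the vector parts the cross product terms cancel,
   the two vectors being parallel. *)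
- have -> : (z + w) / 2 * ((z' + w') / 2) -
    J * ((w - z) / 2) * n1%:C * (J * ((w' - z') / 2) * n1%:C) -
    J * ((w - z) / 2) * n2%:C * (J * ((w' - z') / 2) * n2%:C) -
    J * ((w - z) / 2) * n3%:C * (J * ((w' - z') / 2) * n3%:C) =
    (z + w) / 2 * ((z' + w') / 2) - (J * J) * ((w - z) / 2 * ((w' - z') / 2)) *
    (n1%:C ^+ 2 + n2%:C ^+ 2 + n3%:C ^+ 2) by ring.
  by rewrite nC JJ; field.
- by field.
- by field.
- by field.
Qed.

Lemma qsplitX z w k : Phi z w ^+ k = Phi (z ^+ k) (w ^+ k).
Proof.
elim: k => [|k ih]; last by rewrite !exprS ih qsplitM.
by rewrite !expr0 -qsplit_scalar scale1r.
Qed.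

Lemma qexp_qsplit z w : qexp (Phi z w) = Phi (cexp z) (cexp w).
Proof.
have SE m : \sum_(0 <= k < m) (k`!%:R^-1 : R[i]) *: Phi z w ^+ k =
    Phi (\sum_(0 <= k < m) ((k`!%:R^-1 : R[i]) * z ^+ k))
        (\sum_(0 <= k < m) ((k`!%:R^-1 : R[i]) * w ^+ k)).
  elim: m => [|m ih].
    by rewrite !big_nil -qsplit_scalar scale0r.
  by rewrite !big_nat_recr//= ih qsplitX qsplitZ qsplitD.
pose ccvg (u : nat -> R[i]) (l : R[i]) :=
  Re (u n) @[n --> \oo] --> Re l /\ Im (u n) @[n --> \oo] --> Im l.
have climE u l : ccvg u l -> clim u = l.
  by move=> [uR uI]; apply: complex_ext => /=; apply/cvg_lim => //; exact: Rhausdorff.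
have cD u v a b : ccvg u a -> ccvg v b -> ccvg (fun n => u n + v n) (a + b).
  move=> [uR uI] [vR vI]; split.
    by rewrite complexRe_D; under eq_fun do rewrite complexRe_D; exact: cvgD.
  by rewrite complexIm_D; under eq_fun do rewrite complexIm_D; exact: cvgD.
have cM c u a : ccvg u a -> ccvg (fun n => c * u n) (c * a).
  move=> [uR uI]; split.
    rewrite complexRe_M; under eq_fun do rewrite complexRe_M.
    by apply: cvgB; apply: cvgM => //; exact: cvg_cst.
  rewrite complexIm_M; under eq_fun do rewrite complexIm_M.
  by apply: cvgD; apply: cvgM => //; exact: cvg_cst.
have cz : ccvg _ _ := cvg_cexp_series z; have cw : ccvg _ _ := cvg_cexp_series w.
have comb (n : R) : clim (fun m => J *
    ((\sum_(0 <= k < m) ((k`!%:R^-1 : R[i]) * w ^+ k) -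
      \sum_(0 <= k < m) ((k`!%:R^-1 : R[i]) * z ^+ k)) / 2) * n%:C) =
    J * ((cexp w - cexp z) / 2) * n%:C.
  apply: climE.
  have E (a b : R[i]) : J * ((a - b) / 2) * n%:C =
    J * n%:C / 2 * a + (- (J * n%:C / 2)) * b by field.
  by rewrite E; under eq_fun do rewrite E; apply: cD; exact: cM.
rewrite /qexp; congr Quat; under eq_fun do rewrite SE /=; [|exact: comb..].
apply: climE; rewrite mulrC; under eq_fun do rewrite mulrC.
by apply: cM; exact: cD.
Qed.

Lemma qnorm_sqr (p : quat R[i]) : qnorm p ^+ 2 =
  normc (q0 p) ^+ 2 + normc (q1 p) ^+ 2 + normc (q2 p) ^+ 2 + normc (q3 p) ^+ 2.
Proof. by rewrite sqr_sqrtr// !addr_ge0// sqr_ge0. Qed.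

Lemma qnorm_ge0 (p : quat R[i]) : 0 <= qnorm p.
Proof. exact: sqrtr_ge0. Qed.

(** The parallelogram law for [z + w] and [w - z]. *)
Lemma qnorm_qsplit_sqr z w :
  qnorm (Phi z w) ^+ 2 = (normc z ^+ 2 + normc w ^+ 2) / 2.
Proof.
rewrite qnorm_sqr /= !Normc.normcM.
have -> : normc (2^-1 : R[i]) = 2^-1.
  by rewrite Normc.normcV (_ : 2 = (2 : R)%:C) ?normc_real ?ger0_norm// rmorph_nat.
have -> : normc J = 1 by rewrite /= expr0n expr1n add0r sqrtr1.
rewrite !normc_real !exprMn !real_normK ?num_real//.
have -> a b : (a * 2^-1 ^+ 2) + 1 ^+ 2 * (b * 2^-1 ^+ 2) * n1 ^+ 2 +
    1 ^+ 2 * (b * 2^-1 ^+ 2) * n2 ^+ 2 + 1 ^+ 2 * (b * 2^-1 ^+ 2) * n3 ^+ 2 =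
    (a + b * (n1 ^+ 2 + n2 ^+ 2 + n3 ^+ 2)) / 4 by field.
by rewrite n_unit !normc_sqr !complexReIm; field.
Qed.

Lemma qnorm_qsplit_le z w : qnorm (Phi z w) <= normc z + normc w.
Proof.
rewrite -ler_sqr ?nnegrE ?qnorm_ge0 ?addr_ge0 ?normc_ge0// qnorm_qsplit_sqr.
have := normc_ge0 z; have := normc_ge0 w; nra.
Qed.

End UnitVector.

Lemma toHC_qsplit (v : quat R) : scalar_part v = 0 ->
  exists n1 n2 n3 : R, n1 ^+ 2 + n2 ^+ 2 + n3 ^+ 2 = 1 /\
  toHC v = qsplit n1 n2 n3 (J * (qnorm (toHC v))%:C) (- (J * (qnorm (toHC v))%:C)).
Proof.
case: v => a b c d; rewrite /scalar_part /= => ->.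
set m := qnorm _.
have mE : m ^+ 2 = b ^+ 2 + c ^+ 2 + d ^+ 2.
  rewrite qnorm_sqr; cbn [q0 q1 q2 q3 toHC quat_map].
  by rewrite !normc_real normr0 expr0n add0r !real_normK ?num_real.
have JJ : J * J = -1 by rewrite -expr2 sqr_i.
have comp (x y : R) : y = m * x ->
    y%:C = J * ((- (J * m%:C) - J * m%:C) / 2) * x%:C.
  move=> ->; rewrite rmorphM.
  have -> : J * ((- (J * m%:C) - J * m%:C) / 2) * x%:C = - (J * J) * (m%:C * x%:C).
    by field.
  by rewrite JJ opprK mul1r.
have [m0|mN0] := eqVneq m 0.
  (* For [v = 0] any unit vector will do. *)
  exists 1, 0, 0; split; first by rewrite expr1n expr0n !addr0.
  have := mE; rewrite m0 expr0n => /esym/eqP.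
  rewrite !paddr_eq0 ?addr_ge0 ?sqr_ge0// !sqrf_eq0 => /andP[/andP[/eqP -> /eqP ->] /eqP ->].
  rewrite /toHC /quat_map /qsplit /=; congr Quat.
  - by rewrite addrN mul0r.
  - by rewrite !(mulr0, oppr0, subr0, mul0r).
  - by rewrite !(mulr0, oppr0, subr0, mul0r).
  - by rewrite !(mulr0, oppr0, subr0, mul0r).
exists (b / m), (c / m), (d / m); split.
  by rewrite !exprMn -!mulrDl -mE -exprMn mulfV// expr1n.
rewrite /toHC /quat_map /qsplit /=; congr Quat.
- by rewrite addrN mul0r.
- by apply: comp; rewrite mulrC mulfVK.
- by apply: comp; rewrite mulrC mulfVK.
- by apply: comp; rewrite mulrC mulfVK.
Qed.

End QuatSplit.

(** * Gaussians and powers in split coordinates *)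

Section Splitting.
Context {R : realType}.
Local Notation J := ('i%C : R[i]).

(** [gauss_freq] with [v] replaced by [i b]. For [a > 0] it is
    [exp (- (a + i b) (i u / 2 + u ^ 2 / 24))] at [u = xi / sqrt a]: the logarithm of the base is
    cut after its second-order term. *)
Definition freq_scalar (a b xi : R) : R[i] :=
  cexp ((b * xi / (2 * Num.sqrt a) - xi ^+ 2 / 24) +i*
        (- (Num.sqrt a * xi / 2) - b * xi ^+ 2 / (24 * a))).

(** [gauss_time] with [v] replaced by [i b]. For [a > 0] and [c = a + i b] it is the normal density
    with complex mean [c / (2 sqrt a)] and variance [c / (12 a)], the mean [c / 2] and variance
    [c / 12] of a spline of order [c] after rescaling by [sqrt a]. The quotient with the square
    roots is the principal square root of [2 / c]. *)
Definition time_scalar (a b x : R) : R[i] :=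
  let nq := Num.sqrt (a ^+ 2 + b ^+ 2) in
  ((2 * pi)^-1 * (2 * Num.sqrt 3 * Num.sqrt (pi * a) / (nq * Num.sqrt (a + nq))))%:C
  * ((a + nq) -i* b)
  * cexp ((6 * Num.sqrt a * x - 3 / 2 * a - 6 * a * x ^+ 2 / (a ^+ 2 + b ^+ 2) * a)
          +i* (6 * a * x ^+ 2 / (a ^+ 2 + b ^+ 2) * b - 3 / 2 * b)).

Variables (v : quat R) (hv : scalar_part v = 0) (n1 n2 n3 : R).
Hypothesis n_unit : n1 ^+ 2 + n2 ^+ 2 + n3 ^+ 2 = 1.
Variables (m : R) (mE : qnorm (toHC v) = m).
Local Notation Phi := (qsplit n1 n2 n3).
Hypothesis vE : toHC v = Phi (J * m%:C) (- (J * m%:C)).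

Let scalarE (a : R) : scalar_part (a%:A + v) = a.
Proof. by move: hv; rewrite /scalar_part /= => ->; rewrite mulr1 addr0. Qed.

Let vectorE (a : R) : vector_part (a%:A + v) = v.
Proof.
move: hv; case: v => a0 b c d; rewrite /scalar_part /vector_part /= => ->.
by congr Quat; rewrite mulr0 add0r.
Qed.

Let cE (x y : R) : x +i* y = x%:C + J * y%:C.
Proof. by apply: complex_ext; rewrite !complexReIm /=; ring. Qed.

Let qcE (a : R) : a%:C%:A + toHC v = Phi (a +i* m) (a -i* m).
Proof.
by rewrite vE (@qsplit_scalar _ n1 n2 n3) qsplitD; congr Phi; apply: complex_ext;
  rewrite !complexReIm /=; ring.
Qed.

Let qcNE (a : R) : a%:C%:A - toHC v = Phi (a -i* m) (a +i* m).
Proof.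
by rewrite vE (@qsplit_scalar _ n1 n2 n3) qsplitB; congr Phi; apply: complex_ext;
  rewrite !complexReIm /=; ring.
Qed.

Lemma qnorm_toHC (a : R) : qnorm (toHC (a%:A + v)) = Num.sqrt (a ^+ 2 + m ^+ 2).
Proof.
have -> : toHC (a%:A + v) = a%:C%:A + toHC v.
  case: v => a0 b c d; congr Quat; apply: complex_ext; rewrite ?complexReIm /=; ring.
rewrite qcE; apply/eqP.
rewrite -(@eqrXn2 _ 2) ?qnorm_ge0 ?sqrtr_ge0// (qnorm_qsplit_sqr n_unit).
by rewrite !normc_sqr /= sqrrN; apply/eqP; field.
Qed.

Lemma gauss_freqE (a xi : R) : gauss_freq (a%:A + v) xi =
  Phi (freq_scalar a m xi) (freq_scalar a (- m) xi).
Proof.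
rewrite /gauss_freq scalarE vectorE vE !qsplitZ !(qexp_qsplit n_unit) (qsplitM n_unit).
rewrite qsplitZ /freq_scalar -cexp_real -!cexpD.
by congr (Phi (cexp _) (cexp _)); apply: complex_ext; rewrite !complexReIm /=; ring.
Qed.

Lemma gauss_timeE (a x : R) : gauss_time (a%:A + v) x =
  Phi (time_scalar a m x) (time_scalar a (- m) x).
Proof.
rewrite /gauss_time scalarE vectorE qnorm_toHC mE qcE qcNE.
rewrite (@qsplit_scalar _ n1 n2 n3) qsplitD !qsplitZ !(qexp_qsplit n_unit).
rewrite !(qsplitM n_unit) qsplitZ /time_scalar sqrrN -cexp_real.
have E (k : R[i]) (t : R) (g u w s : R[i]) : t%:C + u + w = s ->
    k * cexp t%:C * (g * cexp u * cexp w) = k * g * cexp s.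
  move=> <-; rewrite !cexpD; ring.
congr (Phi _ _).
- rewrite (E _ _ _ _ _ _ erefl); congr (_%:C * _ * cexp _);
    apply: complex_ext; rewrite !complexReIm /=; ring.
- rewrite (E _ _ _ _ _ _ erefl); congr (_%:C * _ * cexp _);
    apply: complex_ext; rewrite !complexReIm /=; ring.
Qed.

(** [v / |v|] corresponds to the pair [(i, - i)], on which Euler's formula turns the cosine and sine
    terms into exponentials that merge with [z ^ a]. *)
Lemma qpowE (a : R) (z : R[i]) : z != 0 -> qpow z (a%:A + v) =
  Phi (cexp ((a +i* m) * clog z)) (cexp ((a -i* m) * clog z)).
Proof.
move=> z0; rewrite /qpow (negbTE z0) scalarE vectorE mE.
set L := clog z.
have JJ : J * J = -1 by rewrite -expr2 sqr_i.
have -> : (ccos (m%:C * L))%:A + csin (m%:C * L) *: ((m^-1)%:C *: toHC v) =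
    Phi (cexp (J * (m%:C * L))) (cexp (- (J * (m%:C * L)))).
  have [m0|mN0] := eqVneq m 0.
    rewrite m0 invr0 scale0r scaler0 addr0 mul0r mulr0 oppr0.
    by rewrite /ccos mulr0 oppr0 cexp0 (@qsplit_scalar _ n1 n2 n3); congr Phi; field.
  have -> : (m^-1)%:C *: toHC v = Phi J (- J).
    rewrite vE qsplitZ mulrN mulrCA -rmorphM mulVf// mulr1//.
  rewrite (@qsplit_scalar _ n1 n2 n3) qsplitZ qsplitD /ccos /csin.
  set e1 := cexp (J * _); set e2 := cexp (- _).
  have -> : (e1 - e2) / (2 * J) * J = (e1 - e2) / 2.
    rewrite invfM mulrA mulfVK//; apply/eqP => /(congr1 (@Im R))/= /eqP.
    by rewrite oner_eq0.
  have -> : (e1 - e2) / (2 * J) * - J = - ((e1 - e2) / 2).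
    rewrite mulrN invfM mulrA mulfVK//; apply/eqP => /(congr1 (@Im R))/= /eqP.
    by rewrite oner_eq0.
  by congr Phi; field.
rewrite qsplitZ -!cexpD; congr (Phi (cexp _) (cexp _)).
- by rewrite cE; ring.
- by rewrite cE rmorphN; ring.
Qed.

End Splitting.

(** * The base of the B-spline *)

Section BsplineBase.
Context {R : realType}.
Local Notation J := ('i%C : R[i]).
Implicit Types (u x y t : R).

(** Integrates an inequality between derivatives. Starting from [cos t <= 1] it gives alternately
    the Taylor bounds of sine and cosine, one degree more at each use. *)
Let taylor_step (f df g dg : R -> R) x : 0 <= x ->
  (forall t : R, is_derive t 1 f (df t)) -> (forall t : R, is_derive t 1 g (dg t)) ->
  f 0 <= g 0 -> (forall t, 0 <= t -> df t <= dg t) -> f x <= g x.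
Proof.
move=> x0 fdf gdg fg0 dfg.
have : g 0 - f 0 <= g x - f x.
  apply: (@derive_ge0_le _ (fun s => g s - f s) (fun s => dg s - df s)) => //.
  by move=> s /andP[s0 _]; rewrite subr_ge0 dfg.
lra.
Qed.

Lemma sin_le x : 0 <= x -> sin x <= x.
Proof.
move=> x0; apply: (@taylor_step sin cos id (fun=> 1) x x0).
- by rewrite sin0.
- by move=> t _; exact: cos_le1.
Qed.

Let monom (t : R) n (c : R) :
  is_derive t 1 (fun s : R => s ^+ n.+1 / c) (n.+1%:R * t ^+ n / c).
Proof.
rewrite (_ : (fun s : R => _) = c^-1 \*: (fun s : R => s ^+ n.+1)); last first.
  by apply/funext => s /=; rewrite mulrC.
by apply: (is_derive_eq (is_deriveZ c^-1 (is_derive_powS n t)));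
  rewrite /GRing.scale/= mulrC.
Qed.

Lemma cos_ge_taylor2 x : 0 <= x -> 1 - x ^+ 2 / 2 <= cos x.
Proof.
move=> x0; apply: (@taylor_step (fun t => 1 - t ^+ 2 / 2) (fun t => - t)
  cos (fun t => - sin t) x x0).
- move=> t; apply: (is_derive_eq (is_deriveB (is_derive_cst (1 : R) t 1) (monom t 1 2))).
  by lra.
- by rewrite cos0 expr0n mul0r subr0.
- by move=> t t0 /=; rewrite lerN2 sin_le.
Qed.

Lemma sin_ge_taylor3 x : 0 <= x -> x - x ^+ 3 / 6 <= sin x.
Proof.
move=> x0; apply: (@taylor_step (fun t => t - t ^+ 3 / 6) (fun t => 1 - t ^+ 2 / 2) sin cos x x0).
- move=> t; apply: (is_derive_eq (is_deriveB (is_derive_id t 1) (monom t 2 6))).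
  by lra.
- by rewrite sin0 expr0n mul0r subr0.
- by move=> t t0; exact: cos_ge_taylor2.
Qed.

Lemma cos_le_taylor4 x : 0 <= x -> cos x <= 1 - x ^+ 2 / 2 + x ^+ 4 / 24.
Proof.
move=> x0; apply: (@taylor_step cos (fun t => - sin t)
  (fun t => 1 - t ^+ 2 / 2 + t ^+ 4 / 24) (fun t => - (t - t ^+ 3 / 6)) x x0).
- move=> t; apply: (is_derive_eq (is_deriveD
    (is_deriveB (is_derive_cst (1 : R) t 1) (monom t 1 2)) (monom t 3 24))).
  by lra.
- by rewrite cos0 !expr0n !mul0r subr0 addr0.
- by move=> t t0 /=; rewrite lerN2 sin_ge_taylor3.
Qed.

Lemma sin_le_taylor5 x : 0 <= x -> sin x <= x - x ^+ 3 / 6 + x ^+ 5 / 120.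
Proof.
move=> x0; apply: (@taylor_step sin cos (fun t => t - t ^+ 3 / 6 + t ^+ 5 / 120)
  (fun t => 1 - t ^+ 2 / 2 + t ^+ 4 / 24) x x0).
- move=> t; apply: (is_derive_eq (is_deriveD
    (is_deriveB (is_derive_id t 1) (monom t 2 6)) (monom t 4 120))).
  by lra.
- by rewrite sin0 !expr0n !mul0r subr0 addr0.
- by move=> t t0; exact: cos_le_taylor4.
Qed.

Lemma cos_ge_taylor6 x : 0 <= x ->
  1 - x ^+ 2 / 2 + x ^+ 4 / 24 - x ^+ 6 / 720 <= cos x.
Proof.
move=> x0; apply: (@taylor_step
  (fun t => 1 - t ^+ 2 / 2 + t ^+ 4 / 24 - t ^+ 6 / 720)
  (fun t => - (t - t ^+ 3 / 6 + t ^+ 5 / 120)) cos (fun t => - sin t) x x0).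
- move=> t; apply: (is_derive_eq (is_deriveB (is_deriveD
    (is_deriveB (is_derive_cst (1 : R) t 1) (monom t 1 2)) (monom t 3 24)) (monom t 5 720))).
  by lra.
- by rewrite cos0 !expr0n !mul0r !subr0 addr0.
- by move=> t t0 /=; rewrite lerN2 sin_le_taylor5.
Qed.

(** [2 * (1 - cos u)] is the square of [|1 - exp (- i u)|]. The coefficient [1 / 12] of its
    expansion becomes, after halving, the [1 / 24] of the Gaussian. *)
Lemma versin_bounds u : u ^+ 2 - u ^+ 4 / 12 <= 2 * (1 - cos u) /\
  2 * (1 - cos u) <= u ^+ 2 - u ^+ 4 / 12 + u ^+ 6 / 360.
Proof.
have H : cos u <= 1 - u ^+ 2 / 2 + u ^+ 4 / 24 /\
    1 - u ^+ 2 / 2 + u ^+ 4 / 24 - u ^+ 6 / 720 <= cos u.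
  have e2 (k : nat) : `|u| ^+ (2 * k) = u ^+ (2 * k).
    by rewrite !exprM real_normK ?num_real.
  rewrite -(cos_norm u) -(e2 1%N) -(e2 2) -(e2 3).
  by split; [exact: cos_le_taylor4|exact: cos_ge_taylor6].
lra.
Qed.

Lemma bspline_baseE u : u != 0 ->
  bspline_base u = (sin u / u) +i* (- ((1 - cos u) / u)).
Proof.
move=> u0; rewrite /bspline_base (negbTE u0).
have Ju : J * u%:C != 0.
  apply/eqP => /(congr1 (@Im R)).
  by rewrite complexIm_M /= mul0r mul1r add0r => /eqP; rewrite (negbTE u0).
apply: (mulIf Ju); rewrite mulfVK//.
apply: complex_ext; rewrite !(complexReIm, Re_cexp, Im_cexp) /=
  !(mul0r, mulr0, mul1r, add0r, addr0, subr0, oppr0) expR0 ?cosN ?sinN.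
- by field.
- by field.
Qed.

Lemma normc_bspline_base_sqr u : u != 0 ->
  normc (bspline_base u) ^+ 2 = 2 * (1 - cos u) / u ^+ 2.
Proof.
move=> u0; rewrite bspline_baseE// normc_sqr /=.
have s2 := sin2cos2 u.
rewrite sqrrN !exprMn s2; field; exact: u0.
Qed.

Lemma normc_bspline_base0 : normc (bspline_base (0 : R)) = 1.
Proof. by rewrite /bspline_base eqxx Normc.normc1. Qed.

(** The tails need a bound on the whole line. The coefficient [1 / 60] lies well below the [1 / 12]
    of the expansion at 0, which leaves room for crude estimates. *)
Lemma normc_bspline_base_sqr_le u :
  normc (bspline_base u) ^+ 2 <= (1 + u ^+ 2 / 60)^-1.
Proof.
have s0 := sqr_ge0 u.
have p0 : 0 < 1 + u ^+ 2 / 60 by lra.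
have [->|u0] := eqVneq u 0.
  by rewrite normc_bspline_base0 expr1n expr0n mul0r addr0 invr1.
rewrite normc_bspline_base_sqr// -[leRHS]mul1r ler_pdivlMr//.
have s1 : 0 < u ^+ 2 by rewrite lt_def sqrf_eq0 u0.
rewrite mulrAC ler_pdivrMr// mul1r.
have [_ ub] := versin_bounds u; have c1 := cos_geN1 u.
have e4 : u ^+ 4 = (u ^+ 2) ^+ 2 by rewrite -exprM.
have e6 : u ^+ 6 = (u ^+ 2) ^+ 3 by rewrite -exprM.
move: ub; rewrite e4 e6; set s := u ^+ 2 in s0 s1 p0 *.
(* Up to [s = 5] the Taylor bound is good enough; beyond, [2 * (1 - cos u) <= 4] is. *)
have [s5|s5] := leP s 5; last first.
  move=> _; apply: (@le_trans _ _ (4 * (1 + s / 60))); last lra.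
  by rewrite ler_pM2r//; lra.
move=> ub; apply: (@le_trans _ _ ((s - s ^+ 2 / 12 + s ^+ 3 / 360) * (1 + s / 60))).
  by rewrite ler_pM2r.
have -> : (s - s ^+ 2 / 12 + s ^+ 3 / 360) * (1 + s / 60) =
  s - s ^+ 2 * (1 / 15 - s / 720 - s * s / 21600) by field.
have : 0 <= s ^+ 2 * (1 / 15 - s / 720 - s * s / 21600).
  by apply: mulr_ge0; [exact: sqr_ge0|nra].
lra.
Qed.

Lemma normc_eq0 (z : R[i]) : (normc z == 0) = (z == 0).
Proof.
apply/eqP/eqP => [|->]; first exact: Normc.eq0_normc.
by rewrite Normc.normc0.
Qed.

Lemma normc_gt0 (z : R[i]) : z != 0 -> 0 < normc z.
Proof. by move=> z0; rewrite lt_def normc_ge0 normc_eq0 z0. Qed.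

Lemma normr_carg_le (z : R[i]) : z != 0 -> `|carg z| <= pi.
Proof.
move=> z0; have nz := normc_gt0 z0.
have r1 : -1 <= Re z / normc z <= 1.
  rewrite -ler_norml normrM normfV (gtr0_norm nz) ler_pdivrMr// mul1r.
  exact: normr_Re_le.
rewrite /carg; case: ifP => _; rewrite ?normrN ger0_norm ?acos_ge0//; exact: acos_lepi.
Qed.

Lemma sinc_half_gt0 u : u != 0 -> `|u| <= 1 -> 0 < sin (u / 2) / (u / 2).
Proof.
move=> u0 u1.
have -> : sin (u / 2) / (u / 2) = sin (`|u| / 2) / (`|u| / 2).
  case: (ger0P u) => // _.
  by rewrite mulNr sinN invrN mulrNN.
have up : 0 < `|u| by rewrite normr_gt0.
rewrite divr_gt0//; last by rewrite divr_gt0.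
by apply: sin2_gt0; apply/andP; split; lra.
Qed.

(** For [|u| <= 1] the real factor [sin (u / 2) / (u / 2)] is positive and [- u / 2] lies in the
    principal range. *)
Lemma carg_bspline_base u : `|u| <= 1 -> carg (bspline_base u) = - (u / 2).
Proof.
move=> u1; have [->|u0] := eqVneq u 0.
  by rewrite /bspline_base eqxx /carg Normc.normc1 /= lexx divr1 acos1 mul0r oppr0.
set s := sin (u / 2) / (u / 2).
have s0 : 0 < s by exact: sinc_half_gt0.
have uE : u = u / 2 + u / 2 by field.
have u20 : u / 2 != 0 by rewrite mulf_neq0// invr_neq0.
have sE : sin u = s * u * cos (u / 2).
  rewrite [in LHS]uE sinD /s; field; exact: u0.
have cE : 1 - cos u = s * u * sin (u / 2).
  rewrite [in LHS]uE cosD -!expr2 cos2sin2 /s; field; exact: u0.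
have zE : bspline_base u = (s * cos (u / 2)) +i* (- (s * sin (u / 2))).
  rewrite bspline_baseE// sE cE; apply: complex_ext => /=; field; exact: u0.
have nE : normc (bspline_base u) = s.
  apply/eqP; rewrite -(@eqrXn2 _ 2) ?normc_ge0 ?ltW// zE normc_sqr /=.
  by rewrite sqrrN !exprMn -mulrDr cos2Dsin2 mulr1.
have rE : s * cos (u / 2) / s = cos (u / 2) by rewrite mulrC mulKf// gt_eqF.
rewrite /carg nE zE /= rE.
have pi2 := @pi_ge2 R.
rewrite oppr_ge0 pmulr_rle0//.
have [up|un] := ltP 0 u.
  have su : 0 < sin (u / 2).
    by apply: sin2_gt0; move: u1; rewrite gtr0_norm// => u1; apply/andP; split; lra.
  rewrite leNgt su /= cosK// in_itv/=; move: u1; rewrite gtr0_norm// => u1.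
  by apply/andP; split; lra.
have {}un : u < 0 by rewrite lt_neqAle u0 un.
have su : sin (u / 2) < 0.
  rewrite -[u / 2]opprK sinN oppr_lt0; apply: sin2_gt0.
  by move: u1; rewrite ltr0_norm// => u1; apply/andP; split; lra.
rewrite (ltW su) cosKN//; move: u1; rewrite ltr0_norm// => u1.
by apply/andP; split; lra.
Qed.

(** With [Y] the squared modulus and [s = u ^ 2], the inequalities [1 - 1 / Y <= ln Y <= Y - 1]
    locate [ln Y] near [- s / 12] with an error of order [s ^ 2]; halving gives the claim. *)
Lemma ln_bspline_base u : `|u| <= 1 ->
  `|ln (normc (bspline_base u)) + u ^+ 2 / 24| <= u ^+ 4.
Proof.
move=> u1; have [->|u0] := eqVneq u 0.
  by rewrite normc_bspline_base0 ln1 !expr0n mul0r addr0 normr0.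
have e4 : u ^+ 4 = (u ^+ 2) ^+ 2 by rewrite -exprM.
have e6 : u ^+ 6 = (u ^+ 2) ^+ 3 by rewrite -exprM.
have s1 : 0 < u ^+ 2 by rewrite lt_def sqrf_eq0 u0 sqr_ge0.
have sle : u ^+ 2 <= 1 by rewrite -(real_normK (num_real u)) expr_le1.
have nY := normc_bspline_base_sqr u0.
have [lb ub] := versin_bounds u.
set Y := normc _ ^+ 2 in nY.
rewrite e4 e6 in lb ub *.
move: nY lb ub s1 sle; set s := u ^+ 2 => nY lb ub s1 sle.
have Ylb : 1 - s / 12 <= Y.
  by rewrite nY ler_pdivlMr//; move: lb; lra.
have Yub : Y <= 1 - s / 12 + s ^+ 2 / 360.
  rewrite nY ler_pdivrMr//; apply: (le_trans ub).
  by rewrite le_eqVlt; apply/orP; left; apply/eqP; ring.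
have Y0 : 0 < Y by lra.
have n0 : 0 < normc (bspline_base u).
  rewrite lt_def normc_ge0 andbT; apply/eqP => n0.
  by move: Y0; rewrite /Y n0 expr0n ltxx.
have lnY : ln Y = 2 * ln (normc (bspline_base u)).
  by rewrite /Y lnXn// mulr2n; ring.
have l1 : ln Y <= Y - 1.
  have -> : Y = 1 + (Y - 1) by ring.
  by rewrite (le_trans (le_ln1Dx _)); lra.
have l2 : 1 - Y^-1 <= ln Y.
  have := @le_ln1Dx R (Y^-1 - 1).
  have -> : 1 + (Y^-1 - 1) = Y^-1 by ring.
  rewrite lnV ?posrE// => H.
  have : - ln Y <= Y^-1 - 1 by apply: H; rewrite ltrBrDl subrr invr_gt0.
  lra.
have Yi : Y^-1 <= 1 + s / 12 + 2 * (s / 12) ^+ 2.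
  rewrite -[Y^-1]mul1r ler_pdivrMr//.
  apply: (@le_trans _ _ ((1 + s / 12 + 2 * (s / 12) ^+ 2) * (1 - s / 12))); last first.
    by rewrite ler_wpM2l//; nra.
  nra.
rewrite ler_norml; apply/andP; split; nra.
Qed.

End BsplineBase.

(** * Convergence in the Fourier domain *)

Section FrequencyLimit.
Context {R : realType}.
Implicit Types (a b xi u x y : R).

(* With the value [0] at [z = 0], as in [qpow]. *)
Definition bspline_scalar (a b xi : R) : R[i] :=
  let z := bspline_base xi in
  if z == 0 then 0 else cexp ((a +i* b) * clog z).

Lemma normc_le_ReIm (z : R[i]) : normc z <= `|Re z| + `|Im z|.
Proof.
rewrite -ler_sqr ?nnegrE ?normc_ge0 ?addr_ge0// normc_sqr sqrrD.
rewrite !real_normK ?num_real//.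
have : 0 <= `|Re z| * `|Im z| by rewrite mulr_ge0.
lra.
Qed.

Lemma normr_sin_le y : `|sin y| <= `|y|.
Proof.
have H t : 0 <= t -> `|sin t| <= t.
  move=> t0; apply: (@normr_le_of_derive _ sin cos id (fun=> 1) t t0).
  - by rewrite sin0 normr0.
  - by move=> s _; exact: cos_max.
have [y0|y0] := leP 0 y; first by rewrite (ger0_norm y0) H.
by rewrite (ltr0_norm y0) -normrN -sinN H// oppr_ge0 ltW.
Qed.

Lemma normr_cos_sub1_le y : `|cos y - 1| <= `|y|.
Proof.
rewrite -cos_norm; apply: (@normr_le_of_derive _ (fun t => cos t - 1)
  (fun t => - sin t) id (fun=> 1) `|y| (normr_ge0 y)).
- by move=> t; apply: is_derive_eq; rewrite subr0.
- by rewrite cos0 subrr normr0.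
- by move=> s _; rewrite normrN; exact: sin_max.
Qed.

Lemma normc_cexp_sub1_le x y : `|x| <= 1 ->
  normc (cexp (x +i* y) - 1) <= 2 * expR 1 * (`|x| + `|y|).
Proof.
move=> x1; rewrite (le_trans (normc_le_ReIm _))//.
rewrite !(complexReIm, Re_cexp, Im_cexp) /= oppr0 addr0.
set K := expR 1.
have eK : expR x <= K by rewrite ler_expR; apply: le_trans x1; exact: ler_norm.
have e0 := @expR_gt0 R x.
have K1 : 1 <= K by rewrite -expR0 ler_expR.
have ex : `|expR x - 1| <= K * `|x|.
  have := @expR_ge1Dx R x; have := @expR_ge1Dx R (- x); rewrite expRN => H1 H2.
  have H3 : expR x * (1 - x) <= 1.
    by have := ler_wpM2l (ltW e0) H1; rewrite mulfV ?gt_eqF.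
  have xn : x <= `|x| by exact: ler_norm.
  have xN : - x <= `|x| by rewrite -normrN; exact: ler_norm.
  have nx : `|x| <= K * `|x| by rewrite ler_peMl.
  have ub : expR x * x <= K * `|x|.
    apply: (@le_trans _ _ (expR x * `|x|)); first by rewrite ler_wpM2l// ltW.
    by rewrite ler_wpM2r.
  by rewrite ler_norml; apply/andP; split; lra.
have A1 : `|expR x * cos y - 1| <= K * `|y| + K * `|x|.
  have -> : expR x * cos y - 1 = expR x * (cos y - 1) + (expR x - 1) by ring.
  rewrite (le_trans (ler_normD _ _))// lerD// normrM (gtr0_norm e0).
  by apply: ler_pM => //; exact: normr_cos_sub1_le.
have A2 : `|expR x * sin y| <= K * `|y|.
  rewrite normrM (gtr0_norm e0).
  by apply: ler_pM => //; exact: normr_sin_le.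
have K0 : 0 <= K * `|x| by rewrite mulr_ge0// (le_trans _ K1).
lra.
Qed.

(* That is, [(1 + y / a) ^ a] is nondecreasing in [a]: the decay in [y] obtained at
   [a = 4] persists for all larger [a]. *)
Lemma concave_ln_scale (a y : R) : 4 <= a -> 0 <= y ->
  4 * ln (1 + y / 4) <= a * ln (1 + y / a).
Proof.
move=> a4 y0; have a0 : 0 < a by lra.
have i0 : 0 <= 4 / a by rewrite divr_ge0// ltW.
have i1 : 4 / a <= 1 by rewrite ler_pdivrMr// mul1r.
have y4 : 0 < 1 + y / 4 by lra.
(* [1 + y / a] is the convex combination of [1 + y / 4] and [1] with weights [4 / a] and
   [1 - 4 / a]. *)
have := @concave_ln R (Itv01 i0 i1) _ _ y4 ltr01.
rewrite !convRE/= ln1 mulr0 addr0.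
rewrite [X in _ <= ln X](_ : _ = 1 + y / a); last first.
  change (4 / a * (1 + y / 4) + (1 - 4 / a) * 1 = 1 + y / a).
  by field; rewrite gt_eqF.
by rewrite -(ler_pM2l a0) mulrA mulrCA mulfV ?mulr1// gt_eqF.
Qed.

Lemma oneD_sqr_le (k xi : R) : 1 <= k -> 1 + xi ^+ 2 <= k * (1 + xi ^+ 2 / k).
Proof.
move=> k1; rewrite mulrDr mulr1 mulrCA mulfV ?mulr1; last by rewrite gt_eqF//; lra.
by rewrite lerD2r.
Qed.

(** The modulus is [|z| ^ a] times [exp (- b arg z)]. The first factor is at most
    [(1 + xi ^ 2 / (60 a)) ^ (- a / 2)], which for [a >= 4] is at most its value at [a = 4]; hence
    the exponent 2 and the constant [240 = 60 * 4]. *)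
Lemma normc_bspline_scalar_le a b xi : 4 <= a ->
  normc (bspline_scalar a b (xi / Num.sqrt a)) <=
  expR (`|b| * pi) * 240 ^+ 2 / (1 + xi ^+ 2) ^+ 2.
Proof.
move=> a4; have a0 : 0 < a by lra.
have u0 : 0 < 1 + xi ^+ 2 by rewrite ltr_wpDr ?sqr_ge0.
rewrite /bspline_scalar; set z := bspline_base _.
case: ifPn => [_|z0].
  rewrite Normc.normc0; apply: divr_ge0; last exact: sqr_ge0.
  by apply: mulr_ge0; [exact: expR_ge0|exact: sqr_ge0].
have nz : 0 < normc z by exact: normc_gt0.
rewrite normc_cexp complexRe_M /= expRD -mulrA.
rewrite mulrC; apply: ler_pM; rewrite ?expR_ge0//.
  rewrite ler_expR (le_trans (ler_norm _))// normrN normrM ler_wpM2l//.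
  exact: normr_carg_le.
have Y : normc z ^+ 2 <= (1 + xi ^+ 2 / 60 / a)^-1.
  have := normc_bspline_base_sqr_le (xi / Num.sqrt a).
  by rewrite exprMn exprVn sqr_sqrtr ?(ltW a0)// mulrAC.
have x60 : 0 <= xi ^+ 2 / 60 by have := sqr_ge0 xi; lra.
have p0 : 0 < 1 + xi ^+ 2 / 60 / a.
  by rewrite ltr_wpDr//; apply: divr_ge0 => //; exact: ltW.
have lnY : 2 * ln (normc z) <= - ln (1 + xi ^+ 2 / 60 / a).
  have -> : 2 * ln (normc z) = ln (normc z ^+ 2) by rewrite lnXn// mulr2n; ring.
  by rewrite -lnV ?posrE// ler_ln ?posrE ?exprn_gt0 ?invr_gt0.
have cl := concave_ln_scale a4 x60.
have lnz : a * ln (normc z) <= - (2 * ln (1 + xi ^+ 2 / 240)).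
  have e240 : xi ^+ 2 / 60 / 4 = xi ^+ 2 / 240 by field.
  rewrite e240 in cl.
  have := ler_wpM2l (ltW a0) lnY; lra.
have q0 : 0 < 1 + xi ^+ 2 / 240 by have := sqr_ge0 xi; lra.
apply: (@le_trans _ _ (expR (- (2 * ln (1 + xi ^+ 2 / 240))))).
  by rewrite ler_expR.
have -> : - (2 * ln (1 + xi ^+ 2 / 240)) = - ln ((1 + xi ^+ 2 / 240) ^+ 2).
  by rewrite lnXn// mulr2n; ring.
rewrite expRN lnK ?posrE ?exprn_gt0// ler_pdivlMr ?exprn_gt0//.
rewrite mulrC ler_pdivrMr ?exprn_gt0// -exprMn.
rewrite ler_sqr; first by apply: oneD_sqr_le; lra.
  by rewrite nnegrE ltW.
by rewrite nnegrE; lra.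
Qed.

(** Half of [xi ^ 2 / 24] absorbs the linear term at the cost of [12 * b ^ 2]; the rest,
    [xi ^ 2 / 48], gives [97 = 1 + 2 * 48] in [expRN_sqr_le]. *)
Lemma normc_freq_scalar_le a b xi : 4 <= a ->
  normc (freq_scalar a b xi) <=
  expR (12 * b ^+ 2) * 97 ^+ 2 / (1 + xi ^+ 2) ^+ 2.
Proof.
move=> a4; have a0 : 0 < a by lra.
rewrite /freq_scalar normc_cexp /=.
have sa : 1 <= Num.sqrt a by rewrite -sqrtr1 ler_wsqrtr//; lra.
have bx : b * xi / (2 * Num.sqrt a) <= xi ^+ 2 / 48 + 12 * b ^+ 2.
  apply: (@le_trans _ _ (`|b * xi|)).
    rewrite ler_pdivrMr; last by rewrite mulr_gt0// (lt_le_trans _ sa).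
    by rewrite (le_trans (ler_norm _))// ler_peMr//; lra.
  rewrite ler_norml; apply/andP; split.
    have := sqr_ge0 (b + xi / 24); rewrite sqrrD; lra.
  have := sqr_ge0 (b - xi / 24); rewrite sqrrB; lra.
apply: (@le_trans _ _ (expR (12 * b ^+ 2) * expR (- (1 / 48 * xi ^+ 2)))).
  rewrite -expRD ler_expR; lra.
rewrite -[leRHS]mulrA ler_wpM2l ?expR_ge0//.
have := @expRN_sqr_le R (1 / 48) xi; rewrite divr_gt0// => /(_ isT).
by have -> : (1 + 2 / (1 / 48)) = 97 :> R by field.
Qed.

(** The quotient of the two functions is [exp ((a + i b) l)], where [l] is the error of
    [ln_bspline_base]. The bound on [xi ^ 2] gives [|u| <= 1], the one on [xi ^ 4] gives
    [|a l| <= 1]. *)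
Lemma bspline_sub_freq_small a b xi : 1 <= a -> xi ^+ 2 <= a -> xi ^+ 4 <= a ->
  normc (bspline_scalar a b (xi / Num.sqrt a) - freq_scalar a b xi) <=
  normc (freq_scalar a b xi) * (2 * expR 1 * (1 + `|b|) * (xi ^+ 4 / a)).
Proof.
move=> a1 x2 x4; have a0 : 0 < a by lra.
set u := xi / Num.sqrt a.
have u2 : u ^+ 2 = xi ^+ 2 / a by rewrite exprMn exprVn sqr_sqrtr// ltW.
have u4 : u ^+ 4 = xi ^+ 4 / a / a.
  by rewrite (exprM u 2 2) u2 exprMn exprVn -exprM expr2 invfM mulrA.
have u1 : `|u| <= 1.
  rewrite -(@expr_le1 _ 2)// real_normK ?num_real// u2.
  by rewrite ler_pdivrMr// mul1r.
have lz := ln_bspline_base u1; have cz := carg_bspline_base u1.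
(* A zero would force [cos u = 1], against the positive lower bound [u ^ 2 - u ^ 4 / 12]. *)
have z0 : bspline_base u != 0.
  have [->|un0] := eqVneq u 0; first by rewrite /bspline_base eqxx oner_eq0.
  apply/eqP => z0; have := normc_bspline_base_sqr un0.
  rewrite z0 Normc.normc0 expr0n => /esym/eqP.
  rewrite mulf_eq0 invr_eq0 sqrf_eq0 (negbTE un0) orbF => /eqP c0.
  have [lb _] := versin_bounds u.
  have s0 : 0 < u ^+ 2 by rewrite lt_def sqrf_eq0 un0 sqr_ge0.
  have s1 : u ^+ 2 <= 1 by rewrite -(real_normK (num_real u)) expr_le1.
  by move: lb; rewrite c0 (exprM u 2 2); nra.
rewrite /bspline_scalar (negbTE z0).
set l := ln _ + _ in lz.
have sa0 : Num.sqrt a != 0 by rewrite gt_eqF// sqrtr_gt0.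
have saE : a = Num.sqrt a ^+ 2 by rewrite sqr_sqrtr// ltW.
have -> : (a +i* b) * clog (bspline_base u) = ((b * xi / (2 * Num.sqrt a) - xi ^+ 2 / 24) +i*
        (- (Num.sqrt a * xi / 2) - b * xi ^+ 2 / (24 * a))) + ((a * l) +i* (b * l)).
  apply: complex_ext; rewrite !complexReIm /= cz /l u2.
  - rewrite /u; field; rewrite sa0 gt_eqF//.
  - have -> : a * - (u / 2) = - (Num.sqrt a * xi / 2).
      by rewrite {1}saE /u; field.
    by field; rewrite gt_eqF.
rewrite cexpD -/(freq_scalar a b xi) -[X in _ - X]mulr1 -mulrBr Normc.normcM.
rewrite ler_wpM2l ?normc_ge0//.
have al : `|a * l| <= xi ^+ 4 / a.
  rewrite normrM (gtr0_norm a0) -ler_pdivlMl// (le_trans lz)// u4.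
  by rewrite mulrC.
have x40 : 0 <= xi ^+ 4 / a.
  by apply: divr_ge0; [rewrite (exprM xi 2 2) sqr_ge0|exact: ltW].
have bl : `|b * l| <= `|b| * (xi ^+ 4 / a).
  rewrite normrM ler_wpM2l// (le_trans lz)// u4 ler_pdivrMr// ler_peMr//.
apply: (le_trans (normc_cexp_sub1_le _ _)).
  by rewrite (le_trans al)// ler_pdivrMr// mul1r.
rewrite -[leRHS]mulrA ler_wpM2l ?mulr_ge0 ?expR_ge0//.
by rewrite mulrDl mul1r lerD.
Qed.

Lemma freq_limit b e : 0 < e -> \forall a \near +oo, forall xi,
  normc (bspline_scalar a b (xi / Num.sqrt a) - freq_scalar a b xi)
    <= e / (1 + xi ^+ 2).
Proof.
move=> e0.
pose C1 := expR (`|b| * pi) * 240 ^+ 2.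
pose C2 := expR (12 * b ^+ 2) * 97 ^+ 2.
have C10 : 0 <= C1 by apply: mulr_ge0; [exact: expR_ge0|exact: sqr_ge0].
have C20 : 0 <= C2 by apply: mulr_ge0; [exact: expR_ge0|exact: sqr_ge0].
(* Beyond [M] the spare factor [1 / (1 + xi ^ 2)] is at most [e / (C1 + C2)] when [C1 + C2] is
   positive. *)
pose M := 1 + (C1 + C2) / e.
have M1 : 1 <= M by rewrite lerDl divr_ge0 ?addr_ge0// ltW.
have eb0 : 0 <= 2 * expR 1 * (1 + `|b|) by rewrite !mulr_ge0 ?expR_ge0 ?addr_ge0.
(* Threshold for [a] on [|xi| <= M], where [xi ^ 4] is bounded by [M ^ 4], the Gaussian by [C2], and
   the weight is smallest at [M]. *)
pose B := 2 * expR 1 * (1 + `|b|) * M ^+ 4 * C2 * (1 + M ^+ 2) / e.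
near=> a.
have a4 : 4 <= a by near: a; apply: nbhs_pinfty_ge; exact: num_real.
have aM2 : M ^+ 2 <= a by near: a; apply: nbhs_pinfty_ge; exact: num_real.
have aM4 : M ^+ 4 <= a by near: a; apply: nbhs_pinfty_ge; exact: num_real.
have aB : B <= a by near: a; apply: nbhs_pinfty_ge; exact: num_real.
move=> xi; have a0 : 0 < a by lra.
have u0 : 0 < 1 + xi ^+ 2 by rewrite ltr_wpDr ?sqr_ge0.
have F2 := @normc_freq_scalar_le a b xi a4.
have [xM|Mx] := leP `|xi| M.
  have xM2 : xi ^+ 2 <= M ^+ 2.
    by rewrite -(real_normK (num_real xi)) ler_sqr ?nnegrE// (le_trans _ M1).
  have xM4 : xi ^+ 4 <= M ^+ 4.
    rewrite (exprM xi 2 2) (exprM M 2 2) ler_sqr ?nnegrE ?sqr_ge0//.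
  have := @bspline_sub_freq_small a b xi.
  have -> : 1 <= a by lra.
  rewrite (le_trans xM2 aM2) (le_trans xM4 aM4) => /(_ isT isT isT) H.
  apply: (le_trans H).
  have F2' : normc (freq_scalar a b xi) <= C2.
    apply: (le_trans F2); rewrite -/C2 ler_pdivrMr ?exprn_gt0//.
    by rewrite ler_peMr// exprn_ege1// lerDl sqr_ge0.
  apply: (@le_trans _ _ (C2 * (2 * expR 1 * (1 + `|b|) * (M ^+ 4 / a)))).
    apply: ler_pM => //; first exact: normc_ge0.
      by rewrite mulr_ge0// divr_ge0 ?(ltW a0)// (exprM xi 2 2) sqr_ge0.
    by rewrite ler_wpM2l// ler_pM2r ?invr_gt0.
  apply: (@le_trans _ _ (e / (1 + M ^+ 2))); last first.
    rewrite ler_pM2l// lef_pV2 ?posrE// ?lerD2l//.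
    by rewrite ltr_wpDr ?sqr_ge0.
  have M0 : 0 < 1 + M ^+ 2 by rewrite ltr_wpDr ?sqr_ge0.
  rewrite ler_pdivlMr// [X in C2 * X]mulrA mulrA mulrAC ler_pdivrMr//.
  move: aB; rewrite /B ler_pdivrMr// => aB; apply: le_trans (le_trans aB _).
    by rewrite le_eqVlt; apply/orP; left; apply/eqP; ring.
  by rewrite mulrC.
have F1 := @normc_bspline_scalar_le a b xi a4.
apply: (@le_trans _ _ ((C1 + C2) / (1 + xi ^+ 2) ^+ 2)).
  by rewrite (le_trans (le_normcD _ _))// normcN mulrDl lerD.
rewrite ler_pdivrMr ?exprn_gt0// expr2 mulrA mulfVK ?gt_eqF//.
rewrite -ler_pdivrMl// mulrC; apply: (@le_trans _ _ M); first by rewrite lerDr.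
apply: (le_trans (ltW Mx)).
have := sqr_ge0 (`|xi| - 1); rewrite sqrrB real_normK ?num_real//; lra.
Unshelve. all: by end_near. Qed.

End FrequencyLimit.

(** * The Fourier transform of the time-domain Gaussian *)

Section GaussFourier.
Context {R : realType}.
Local Notation mu := (@lebesgue_measure R).
Local Notation J := ('i%C : R[i]).
Variables (a b xi : R).
Hypothesis a0 : 0 < a.

(* Completing the square: the integrand is a constant times
   [exp (c1 + i c2 - (X + i w) ^ 2)], where [r1 + i r2] is the square root of
   [6 a / (a + i b)]. *)
Let nq := Num.sqrt (a ^+ 2 + b ^+ 2).
Let h := Num.sqrt a.
Let g := Num.sqrt (a + nq).
Let k := Num.sqrt 3 * h / (nq * g).
Let r1 := k * (a + nq).
Let r2 := - (k * b).
(** With [r = r1 + i r2], the shift [s1 + i s2] is [(- 6 h + i xi) / (2 r)], so that the cross term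
    of [(r x + s1 + i s2) ^ 2] is [(- 6 h + i xi) x]. The factor [nq / (12 * a)] is
    [1 / (2 |r| ^ 2)]. *)
Let s1 := (- (6 * h * r1) + xi * r2) * (nq / (12 * a)).
Let s2 := (xi * r1 + 6 * h * r2) * (nq / (12 * a)).
Let X (x : R) := r1 * x + s1.
Let w (x : R) := r2 * x + s2.
Let c1 := b * xi / (2 * h) - xi ^+ 2 / 24.
Let c2 := - (h * xi / 2) - b * xi ^+ 2 / (24 * a).
Let E1 (x : R) := 6 * h * x - 3 / 2 * a - 6 * a * x ^+ 2 / (a ^+ 2 + b ^+ 2) * a.
Let T (x : R) := 6 * a * x ^+ 2 / (a ^+ 2 + b ^+ 2) * b - 3 / 2 * b - xi * x.

Let q2 : 0 < a ^+ 2 + b ^+ 2.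
Proof. by rewrite ltr_pwDl ?exprn_gt0 ?sqr_ge0. Qed.
Let nq2 : nq ^+ 2 = a ^+ 2 + b ^+ 2. Proof. by rewrite sqr_sqrtr// ltW. Qed.
Let nq0 : 0 < nq. Proof. by rewrite sqrtr_gt0. Qed.
Let h2 : h ^+ 2 = a. Proof. by rewrite sqr_sqrtr// ltW. Qed.
Let h0 : 0 < h. Proof. by rewrite sqrtr_gt0. Qed.
Let an0 : 0 < a + nq. Proof. exact: addr_gt0. Qed.
Let g2 : g ^+ 2 = a + nq. Proof. by rewrite sqr_sqrtr// ltW. Qed.
Let g0 : 0 < g. Proof. by rewrite sqrtr_gt0. Qed.
Let k0 : 0 < k. Proof. by rewrite divr_gt0 ?mulr_gt0 ?sqrtr_gt0. Qed.

Let k2 : k ^+ 2 = 3 * a / (nq ^+ 2 * (a + nq)).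
Proof. by rewrite !exprMn exprVn exprMn h2 g2 sqr_sqrtr. Qed.

Let r21 : `|r2| < r1.
Proof.
rewrite normrN normrM (gtr0_norm k0) ltr_pM2l//.
have : `|b| <= nq.
  rewrite -ler_sqr ?nnegrE ?sqrtr_ge0// nq2 real_normK ?num_real//.
  by rewrite lerDr sqr_ge0.
by move=> bn; rewrite (le_lt_trans bn)// ltrDr.
Qed.

(** [R1], [R2] and [R3] give the real part, half the imaginary part and the modulus of
    [r ^ 2 = 6 a / (a + i b)]; they remove [k] and its square roots from the later identities. *)
Let R1 : r1 ^+ 2 - r2 ^+ 2 = 6 * a ^+ 2 / nq ^+ 2.
Proof.
have -> : r1 ^+ 2 - r2 ^+ 2 = k ^+ 2 * ((a + nq) ^+ 2 - b ^+ 2).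
  by rewrite /r1 /r2; ring.
rewrite k2; have -> : b ^+ 2 = nq ^+ 2 - a ^+ 2 by rewrite nq2; ring.
by field; rewrite !gt_eqF.
Qed.

Let R2 : r1 * r2 = - (3 * a * b / nq ^+ 2).
Proof.
have -> : r1 * r2 = - (k ^+ 2 * (a + nq) * b) by rewrite /r1 /r2; ring.
by rewrite k2; field; rewrite !gt_eqF.
Qed.

Let R3 : r1 ^+ 2 + r2 ^+ 2 = 6 * a / nq.
Proof.
have -> : r1 ^+ 2 + r2 ^+ 2 = k ^+ 2 * ((a + nq) ^+ 2 + b ^+ 2).
  by rewrite /r1 /r2; ring.
rewrite k2; have -> : b ^+ 2 = nq ^+ 2 - a ^+ 2 by rewrite nq2; ring.
by field; rewrite !gt_eqF.
Qed.

(** [K1] and [K2] are the real and imaginary parts of the completed square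
    [E1 + i T = c1 + i c2 - (X + i w) ^ 2]. *)
Let K1 x : w x ^+ 2 - X x ^+ 2 + c1 = E1 x.
Proof.
have S : w x ^+ 2 - X x ^+ 2 = - ((r1 ^+ 2 - r2 ^+ 2) * x ^+ 2
   - 12 * h * (r1 ^+ 2 + r2 ^+ 2) * (nq / (12 * a)) * x
   + (nq / (12 * a)) ^+ 2 * ((36 * h ^+ 2 - xi ^+ 2) * (r1 ^+ 2 - r2 ^+ 2)
      - 24 * h * xi * (r1 * r2))).
  by rewrite /w /X /s1 /s2; ring.
rewrite S R1 R2 R3 h2 /c1 /E1 -nq2.
have -> : 24 * h * xi * - (3 * a * b / nq ^+ 2) = - (72 * h ^+ 2 / h * xi * a * b / nq ^+ 2).
  by field; rewrite !gt_eqF.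
by rewrite h2; field; rewrite !gt_eqF.
Qed.

Let K2 x : 2 * X x * w x - c2 = - T x.
Proof.
have S : 2 * X x * w x = 2 * (r1 * r2) * x ^+ 2
   + 2 * xi * (r1 ^+ 2 + r2 ^+ 2) * (nq / (12 * a)) * x
   + 2 * (nq / (12 * a)) ^+ 2 * ((xi ^+ 2 - 36 * h ^+ 2) * (r1 * r2)
      - 6 * h * xi * (r1 ^+ 2 - r2 ^+ 2)).
  by rewrite /w /X /s1 /s2; ring.
by rewrite S R1 R2 R3 h2 /c2 /T -nq2; field; rewrite !gt_eqF.
Qed.

(** The factor [(2 * pi)^-1] leaves exactly [1 / sqrt pi], which the Gaussian integral cancels. *)
Let kpi : (2 * pi)^-1 * (2 * Num.sqrt 3 * Num.sqrt (pi * a) / (nq * g)) =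
  k / Num.sqrt pi.
Proof.
have pi0 := @pi_gt0 R; have sp0 : 0 < Num.sqrt (pi : R) by rewrite sqrtr_gt0.
have pE : (pi : R) = Num.sqrt pi ^+ 2 by rewrite sqr_sqrtr// ltW.
rewrite sqrtrM ?(ltW pi0)// -/h {1}pE /k.
move: (Num.sqrt pi) sp0 => p p0; field.
by rewrite !gt_eqF.
Qed.

Let f x := cexp (- (J * (xi * x)%:C)) * time_scalar a b x.

Let fE x : f x = (k / Num.sqrt pi)%:C * ((a + nq) -i* b) * cexp ((E1 x) +i* (T x)).
Proof.
rewrite /f /time_scalar -/nq -/g kpi mulrCA; congr (_ * _).
by rewrite -cexpD; congr cexp; apply: complex_ext; rewrite !complexReIm /=;
  rewrite /E1 /T -/h; ring.
Qed.

Let F phi x := expR (w x ^+ 2 - X x ^+ 2) *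
  (r1 * cos (2 * X x * w x + phi) + r2 * sin (2 * X x * w x + phi)).

Let expE x : expR (E1 x) = expR c1 * expR (w x ^+ 2 - X x ^+ 2).
Proof. by rewrite -expRD addrC K1. Qed.

Let Ref x : Re (f x) = expR c1 / Num.sqrt pi * F (- c2) x.
Proof.
rewrite fE !(complexReIm, Re_cexp, Im_cexp) /= expE /F K2 cosN sinN /r1 /r2; ring.
Qed.

Let Imf x : Im (f x) = expR c1 / Num.sqrt pi * F (- c2 + pi / 2) x.
Proof.
rewrite fE !(complexReIm, Re_cexp, Im_cexp) /= expE /F addrA K2.
rewrite cosDpihalf sinDpihalf cosN sinN /r1 /r2; ring.
Qed.

Lemma time_scalar_fourier : cintegrable f /\ cintegral f = freq_scalar a b xi.
Proof.
have [i1 v1] := @Rintegral_complex_gauss R r1 r2 s1 s2 (- c2) r21.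
have [i2 v2] := @Rintegral_complex_gauss R r1 r2 s1 s2 (- c2 + pi / 2) r21.
have sp0 : Num.sqrt (pi : R) != 0 by rewrite gt_eqF// sqrtr_gt0 pi_gt0.
have RfE : (fun x => Re (f x)) = fun x => expR c1 / Num.sqrt pi * F (- c2) x.
  by apply/funext => x; exact: Ref.
have IfE : (fun x => Im (f x)) = fun x => expR c1 / Num.sqrt pi * F (- c2 + pi / 2) x.
  by apply/funext => x; exact: Imf.
split; first split.
- by rewrite (_ : (fun x => _) = EFin \o (fun x => Re (f x)))// RfE;
    exact: integrable_Zl.
- by rewrite (_ : (fun x => _) = EFin \o (fun x => Im (f x)))// IfE;
    exact: integrable_Zl.
apply: complex_ext; rewrite /freq_scalar ?Re_cexp ?Im_cexp /= -/h -/c1 -/c2.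
- rewrite RfE RintegralZl// v1 cosN.
  by rewrite mulrA mulfVK.
- rewrite IfE RintegralZl// v2 cosDpihalf sinN opprK.
  by rewrite mulrA mulfVK.
Qed.

End GaussFourier.

(** * Bounds on Lebesgue norms *)

Section LnormBounds.
Context {R : realType}.
Local Notation mu := (@lebesgue_measure R).

(** The integral of a nonnegative function is a supremum over the simple functions below it, hence
    monotone. This suits the norms in the Fourier domain, where only pointwise bounds are at
    hand. *)
Lemma ge0_le_integral_nonmeasurable (f g : R -> \bar R) :
  (forall x, 0 <= f x)%E -> (forall x, f x <= g x)%E ->
  (\int[mu]_x f x <= \int[mu]_x g x)%E.
Proof.
move=> f0 fg.
rewrite !ge0_integralTE//; last by move=> x; apply: le_trans (fg x).
apply: ereal_sup_le => _ [h /= hf <-]; exists h => //= x.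
exact: le_trans (hf x) (fg x).
Qed.

Let lebesgue_setT_gt0 : (0 < mu setT)%E.
Proof.
have -> : [set: R] = `]-oo, +oo[%classic by rewrite set_itvNyy.
by rewrite lebesgue_measure_itv/= ltry.
Qed.

Lemma Lnorm_le_of_integral (p : \bar R) (g : R -> R) (M : R) : (1 <= p)%E ->
  0 < M -> (forall x, 0 <= g x) ->
  {ae mu, forall x, g x <= M} ->
  (forall r : R, p = r%:E -> (\int[mu]_x (g x `^ r)%:E <= (M `^ r)%:E)%E) ->
  (Lnorm mu p (EFin \o g) <= M%:E)%E.
Proof.
move=> p1 M0 g0 gM gi; rewrite unlock; case: p p1 gi => [r|_ _|//].
- rewrite lee_fin => r1 /(_ r erefl) H.
  have r0 : 0 < r by exact: lt_le_trans r1.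
  have -> : M%:E = ((M `^ r)%:E `^ r^-1)%E.
    by rewrite poweR_EFin -powRrM mulfV ?powRr1 ?ltW// gt_eqF.
  apply: gt0_ler_poweR.
  + by rewrite invr_ge0 ltW.
  + by rewrite in_itv/= leey andbT; apply: integral_ge0 => x _; rewrite lee_fin powR_ge0.
  + by rewrite in_itv/= leey andbT lee_fin powR_ge0.
  + apply: le_trans H; rewrite le_eqVlt; apply/orP; left; apply/eqP.
    by apply: eq_integral => x _; rewrite /= ger0_norm.
(* The norm at [+oo] is the essential supremum only on a space of positive measure. *)
- rewrite lebesgue_setT_gt0; apply/ess_supP.
  by apply: ae_imply gM => x gxM; rewrite /= lee_fin ger0_norm.
Qed.

(** For [r >= 1] the power [r] of the weight is at most the weight itself, of integral [pi], and
    [pi <= pi ^ r]; so one constant serves all exponents. *)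
Lemma Lnorm_le_oneDsqr (p : \bar R) (g : R -> R) (e : R) : (1 <= p)%E ->
  0 < e -> (forall x, 0 <= g x) -> (forall x, g x <= e / (1 + x ^+ 2)) ->
  (Lnorm mu p (EFin \o g) <= (e * pi)%:E)%E.
Proof.
move=> p1 e0 g0 ge; have pi1 : 1 <= (pi : R) by rewrite (le_trans _ (@pi_ge2 R))// ler1n.
have u1 (x : R) : 1 <= 1 + x ^+ 2 by rewrite lerDl sqr_ge0.
have u0 (x : R) : 0 < 1 + x ^+ 2 by exact: lt_le_trans (u1 x).
have ge' x : g x <= e.
  by rewrite (le_trans (ge x))// ler_pdivrMr// ler_peMr// ltW.
apply: Lnorm_le_of_integral => //.
- by rewrite mulr_gt0// pi_gt0.
- by apply: aeW => x; rewrite (le_trans (ge' x))// ler_peMr// ltW.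
- move=> r pr; have {p1 pr} r1 : 1 <= r by rewrite -lee_fin -pr.
  apply: (@le_trans _ _ (\int[mu]_x (e `^ r * (1 + x ^+ 2)^-1)%:E)%E).
    apply: ge0_le_integral_nonmeasurable => x; first by rewrite lee_fin powR_ge0.
    rewrite lee_fin (@le_trans _ _ ((e / (1 + x ^+ 2)) `^ r))//.
      apply: ge0_ler_powR; rewrite ?nnegrE//; first exact: le_trans r1.
      by rewrite divr_ge0 ?(ltW e0) ?(ltW (u0 _)).
    rewrite powRM ?(ltW e0) ?invr_ge0 ?(ltW (u0 _))// ler_wpM2l ?powR_ge0//.
    have i0 : 0 < (1 + x ^+ 2)^-1 by rewrite invr_gt0.
    rewrite -[leRHS]powRr1 ?(ltW i0)//.
    rewrite /powR !gt_eqF// ler_expR ler_wnM2r// ln_le0// invf_le1//.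
  rewrite -EFin_Rintegral//; last first.
    by apply: integrable_Zl => //; exact: integrable_oneDsqrV.
  rewrite RintegralZl//; last exact: integrable_oneDsqrV.
  rewrite Rintegral_oneDsqrV lee_fin powRM ?(ltW e0) ?pi_ge0//.
  rewrite ler_wpM2l ?powR_ge0// -[leLHS]powRr1 ?pi_ge0//.
  by rewrite ler_powR.
Qed.

(** Interpolation: almost everywhere [g ^ r <= M ^ (r - 2) * g ^ 2]. *)
Lemma Lnorm_le_sqr (p : \bar R) (g : R -> R) (M : R) : (2%:E <= p)%E ->
  0 < M -> measurable_fun setT g -> (forall x, 0 <= g x) ->
  {ae mu, forall x, g x <= M} ->
  (\int[mu]_x (g x ^+ 2)%:E <= (M ^+ 2)%:E)%E ->
  (Lnorm mu p (EFin \o g) <= M%:E)%E.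
Proof.
move=> p2 M0 mg g0 gM g2.
have p1 : (1 <= p)%E by apply: le_trans p2; rewrite lee_fin ler1n.
apply: Lnorm_le_of_integral => // r pr.
have {p1 p2 pr} r2 : 2 <= r by rewrite -lee_fin -pr.
apply: (@le_trans _ _ (\int[mu]_x (M `^ (r - 2) * g x ^+ 2)%:E)%E).
  apply: ae_ge0_le_integral => //.
  - by move=> x _; rewrite lee_fin powR_ge0.
  - by apply/measurable_EFinP; apply: (measurableT_comp (f := fun t => t `^ r)) => //; exact: measurable_powR.
  - by move=> x _; rewrite lee_fin mulr_ge0 ?powR_ge0 ?sqr_ge0.
  - by apply/measurable_EFinP; apply: measurable_funM => //; exact: measurable_funX.
  - apply: ae_imply gM => x gxM _; rewrite lee_fin.
    have -> : g x ^+ 2 = g x `^ 2 by rewrite powR_mulrn.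
    have -> : g x `^ r = g x `^ (r - 2) * g x `^ 2.
      by rewrite -powRD ?subrK// (gt_eqF (lt_le_trans _ r2)) ?ltr0n.
    rewrite ler_wpM2r ?powR_ge0//; apply: ge0_ler_powR; rewrite ?nnegrE ?(ltW M0)//.
    by rewrite subr_ge0.
under eq_integral do rewrite EFinM.
rewrite ge0_integralZl//; last 3 first.
- by apply/measurable_EFinP; exact: measurable_funX.
- by move=> x _; rewrite lee_fin sqr_ge0.
- by rewrite lee_fin powR_ge0.
apply: (@le_trans _ _ ((M `^ (r - 2))%:E * (M ^+ 2)%:E)%E).
  by rewrite lee_wpmul2l// lee_fin powR_ge0.
rewrite -EFinM lee_fin -(powR_mulrn 2 (ltW M0)) -powRD ?subrK//.
by rewrite (gt_eqF M0) implybT.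
Qed.

End LnormBounds.

(** * Fourier transforms with values in the complexified quaternions *)

Section ComplexFourier.
Context {R : realType}.
Local Notation mu := (@lebesgue_measure R).
Local Notation J := ('i%C : R[i]).
Implicit Types (f g : R -> R[i]) (c : R[i]) (k xi x : R).

Lemma cintegrable_ext f g : f =1 g -> cintegrable f -> cintegrable g.
Proof. by move=> /funext ->. Qed.

Lemma cintegrableD f g : cintegrable f -> cintegrable g ->
  cintegrable (fun x => f x + g x).
Proof.
move=> [fR fI] [gR gI]; split.
- under eq_fun do rewrite complexRe_D; exact: integrable_D.
- under eq_fun do rewrite complexIm_D; exact: integrable_D.
Qed.

Lemma cintegralD f g : cintegrable f -> cintegrable g ->
  cintegral (fun x => f x + g x) = cintegral f + cintegral g.
Proof.
move=> [fR fI] [gR gI]; apply: complex_ext; rewrite !complexReIm /=.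
- by under eq_Rintegral do rewrite complexRe_D; exact: RintegralD.
- by under eq_Rintegral do rewrite complexIm_D; exact: RintegralD.
Qed.

Lemma cintegrableZ c f : cintegrable f -> cintegrable (fun x => c * f x).
Proof.
move=> [fR fI]; split.
- by under eq_fun do rewrite complexRe_M; apply: integrable_B => //; exact: integrable_Zl.
- by under eq_fun do rewrite complexIm_M; apply: integrable_D => //; exact: integrable_Zl.
Qed.

Lemma cintegralZ c f : cintegrable f -> cintegral (fun x => c * f x) = c * cintegral f.
Proof.
move=> [fR fI]; apply: complex_ext; rewrite !complexReIm /=.
- under eq_Rintegral do rewrite complexRe_M.
  by rewrite RintegralB ?RintegralZl//; exact: integrable_Zl.
- under eq_Rintegral do rewrite complexIm_M.
  by rewrite RintegralD ?RintegralZl//; exact: integrable_Zl.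
Qed.

Definition character xi x : R[i] := cexp (- (J * (xi * x)%:C)).

Lemma Re_character xi x : Re (character xi x) = cos (xi * x).
Proof.
rewrite Re_cexp !complexReIm /= !(mul0r, mul1r, mulr0, subr0, add0r, oppr0, addr0).
by rewrite expR0 mul1r cosN.
Qed.

Lemma Im_character xi x : Im (character xi x) = - sin (xi * x).
Proof.
rewrite Im_cexp !complexReIm /= !(mul0r, mul1r, mulr0, subr0, add0r, oppr0, addr0).
by rewrite expR0 mul1r sinN.
Qed.

Let integrableM_cos xi (h : R -> R) : mu.-integrable setT (EFin \o h) ->
  mu.-integrable setT (EFin \o (fun x => h x * cos (xi * x))).
Proof.
move=> hi; apply: (integrableM_bounded (M := 1)) => //.
- by apply: continuous_measurable_fun => x; apply: continuous_comp;
    [exact: mulrl_continuous | exact: continuous_cos].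
- by move=> x _; exact: cos_max.
Qed.

Let integrableM_sin xi (h : R -> R) : mu.-integrable setT (EFin \o h) ->
  mu.-integrable setT (EFin \o (fun x => h x * sin (xi * x))).
Proof.
move=> hi; apply: (integrableM_bounded (M := 1)) => //.
- by apply: continuous_measurable_fun => x; apply: continuous_comp;
    [exact: mulrl_continuous | exact: continuous_sin].
- by move=> x _; exact: sin_max.
Qed.

Let Re_characterM f xi x : Re (character xi x * f x) =
  Re (f x) * cos (xi * x) + Im (f x) * sin (xi * x).
Proof. by rewrite complexRe_M Re_character Im_character; ring. Qed.

Let Im_characterM f xi x : Im (character xi x * f x) =
  Im (f x) * cos (xi * x) - Re (f x) * sin (xi * x).
Proof. by rewrite complexIm_M Re_character Im_character; ring. Qed.

Lemma cintegrable_character xi f : cintegrable f ->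
  cintegrable (fun x => character xi x * f x).
Proof.
move=> [fR fI]; split.
- under eq_fun do rewrite Re_characterM.
  by apply: integrable_D => //; [exact: integrableM_cos | exact: integrableM_sin].
- under eq_fun do rewrite Im_characterM.
  by apply: integrable_B => //; [exact: integrableM_cos | exact: integrableM_sin].
Qed.

Definition cfourier f xi := cintegral (fun x => character xi x * f x).

Lemma cfourierD f g xi : cintegrable f -> cintegrable g ->
  cfourier (fun x => f x + g x) xi = cfourier f xi + cfourier g xi.
Proof.
move=> fi gi; rewrite -cintegralD; try exact: cintegrable_character.
by congr cintegral; apply/funext => x; rewrite mulrDr.
Qed.

Lemma cfourierZ c f xi : cintegrable f ->
  cfourier (fun x => c * f x) xi = c * cfourier f xi.
Proof.
move=> fi; rewrite -cintegralZ; last exact: cintegrable_character.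
by congr cintegral; apply/funext => x; rewrite mulrCA.
Qed.

Lemma cintegrable_dilation k f : 0 < k -> cintegrable f ->
  cintegrable (fun x => k%:C * f (k * x)).
Proof.
move=> k0 [fR fI]; apply: (@cintegrableZ _ (fun x => f (k * x))).
by split; [exact: (integrable_scale k0 fR) | exact: (integrable_scale k0 fI)].
Qed.

Lemma cfourier_dilation k f xi : 0 < k -> cintegrable f ->
  cfourier (fun x => k%:C * f (k * x)) xi = cfourier f (xi / k).
Proof.
move=> k0 fi; have [hR hI] := cintegrable_character (xi / k) fi.
have E : (fun x => character xi x * (k%:C * f (k * x))) =
    (fun x => k%:C * (character (xi / k) (k * x) * f (k * x))).
  apply/funext => x; rewrite mulrCA /character.
  by rewrite (_ : xi / k * (k * x) = xi * x)// mulrA divfK// gt_eqF.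
rewrite /cfourier E; apply: complex_ext => /=.
- rewrite (Rintegral_scale k0 hR) -RintegralZl//; last exact: (integrable_scale k0 hR).
  by apply: eq_Rintegral => x _; rewrite complexRe_M /= mul0r subr0.
- rewrite (Rintegral_scale k0 hI) -RintegralZl//; last exact: (integrable_scale k0 hI).
  by apply: eq_Rintegral => x _; rewrite complexIm_M /= mul0r addr0.
Qed.

Section Bound.
Variables (f : R -> R[i]) (e : R).
Hypothesis fi : cintegrable f.
Hypothesis f_le : forall xi, normc (cfourier f xi) <= e / (1 + xi ^+ 2).

Let Re_cfourier xi : Re (cfourier f xi) =
  cosT (fun x => Re (f x)) xi + sinT (fun x => Im (f x)) xi.
Proof.
have [fR fI] := fi; rewrite /=; under eq_Rintegral do rewrite Re_characterM.
by rewrite RintegralD//; [exact: integrableM_cos | exact: integrableM_sin].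
Qed.

Let Im_cfourier xi : Im (cfourier f xi) =
  cosT (fun x => Im (f x)) xi - sinT (fun x => Re (f x)) xi.
Proof.
have [fR fI] := fi; rewrite /=; under eq_Rintegral do rewrite Im_characterM.
by rewrite RintegralB//; [exact: integrableM_cos | exact: integrableM_sin].
Qed.

Let cosTN (h : R -> R) xi : cosT h (- xi) = cosT h xi.
Proof. by apply: eq_Rintegral => x _; rewrite mulNr cosN. Qed.

Let sinTN (h : R -> R) xi : mu.-integrable setT (EFin \o h) ->
  sinT h (- xi) = - sinT h xi.
Proof.
move=> hi; rewrite -[RHS]mulN1r -RintegralZl//; last exact: integrableM_sin.
by apply: eq_Rintegral => x _; rewrite mulNr sinN mulrN mulN1r.
Qed.

(* Cosine transforms are even and sine transforms are odd, so the bounds at [xi] and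
   at [- xi] separate the two terms of [Re_cfourier] and of [Im_cfourier]. *)
Let normr_half_le (s t r : R) : `|s + t| <= r -> `|s - t| <= r ->
  `|s| <= r /\ `|t| <= r.
Proof. by rewrite !ler_norml => /andP[? ?] /andP[? ?]; split; apply/andP; split; lra. Qed.

Let Re_le xi : `|cosT (fun x => Re (f x)) xi| <= e / (1 + xi ^+ 2) /\
  `|sinT (fun x => Im (f x)) xi| <= e / (1 + xi ^+ 2).
Proof.
have [fR fI] := fi; apply: normr_half_le.
- by rewrite -Re_cfourier; exact: le_trans (normr_Re_le _) (f_le _).
- rewrite -(cosTN _ xi) -sinTN// -Re_cfourier -(sqrrN xi).
  exact: le_trans (normr_Re_le _) (f_le _).
Qed.

Let Im_le xi : `|cosT (fun x => Im (f x)) xi| <= e / (1 + xi ^+ 2) /\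
  `|sinT (fun x => Re (f x)) xi| <= e / (1 + xi ^+ 2).
Proof.
have [fR fI] := fi; apply: normr_half_le.
- rewrite -[sinT _ _]opprK -sinTN// -(cosTN _ xi) -Im_cfourier -(sqrrN xi).
  exact: le_trans (normr_Im_le _) (f_le _).
- by rewrite -Im_cfourier; exact: le_trans (normr_Im_le _) (f_le _).
Qed.

Lemma ae_normc_sqr_le : {ae mu, forall x, normc (f x) ^+ 2 <= 2 * e ^+ 2}.
Proof.
have [fR fI] := fi.
have H1 := ae_normr_le_of_transform fR (fun xi => (Re_le xi).1) (fun xi => (Im_le xi).2).
have H2 := ae_normr_le_of_transform fI (fun xi => (Im_le xi).1) (fun xi => (Re_le xi).2).
apply: ae_imply (ae_and H1 H2) => x /= [h1 h2].
rewrite normc_sqr -(real_normK (num_real (Re _))) -(real_normK (num_real (Im _))).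
by have := normr_ge0 (Re (f x)); have := normr_ge0 (Im (f x)); nra.
Qed.

Lemma measurable_normc_sqr : measurable_fun setT (fun x => normc (f x) ^+ 2).
Proof.
have [fR fI] := fi; under eq_fun do rewrite normc_sqr.
by apply: measurable_funD; apply: measurable_funX; exact: integrable_measurable.
Qed.

Lemma integral_normc_sqr_le : (\int[mu]_x (normc (f x) ^+ 2)%:E <= (2 * e ^+ 2)%:E)%E.
Proof.
have [fR fI] := fi; under eq_integral do rewrite normc_sqr EFinD.
rewrite ge0_integralD//.
- rewrite mulr2n mulrDl mul1r EFinD; apply: leeD.
  + exact: (Plancherel_le fR (fun xi => (Re_le xi).1) (fun xi => (Im_le xi).2)).
  + exact: (Plancherel_le fI (fun xi => (Im_le xi).1) (fun xi => (Re_le xi).2)).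
- by move=> x _; rewrite lee_fin sqr_ge0.
- by apply/measurable_EFinP; apply: measurable_funX; exact: (integrable_measurable fR).
- by move=> x _; rewrite lee_fin sqr_ge0.
- by apply/measurable_EFinP; apply: measurable_funX; exact: (integrable_measurable fI).
Qed.

End Bound.
End ComplexFourier.

(** The norms may be infinite for small [a]; the bound with [e = 1] makes them finite eventually,
    after which real convergence applies. *)
Lemma cvge0_of_le (R : realType) (g : R -> \bar R) : (forall a, 0 <= g a)%E ->
  (forall e : R, 0 < e -> \forall a \near +oo, (g a <= e%:E)%E) ->
  g a @[a --> +oo] --> 0%E.
Proof.
move=> g0 gle; apply/fine_cvgP; split.
  apply: filterS (gle 1 ltr01) => a ga1.
  by rewrite ge0_fin_numE//; exact: le_lt_trans ga1 (ltry _).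
apply/cvgr0Pnorm_le => e e0; apply: filterS (gle e e0) => a gae.
rewrite /= ger0_norm ?fine_ge0// -lee_fin fineK//.
by rewrite ge0_fin_numE//; exact: le_lt_trans gae (ltry _).
Qed.

Section QuaternionFourier.
Context {R : realType}.
Local Notation mu := (@lebesgue_measure R).
Local Notation J := ('i%C : R[i]).

Lemma normc_le_qnorm (p : quat R[i]) :
  [/\ normc (q0 p) <= qnorm p, normc (q1 p) <= qnorm p,
      normc (q2 p) <= qnorm p & normc (q3 p) <= qnorm p].
Proof.
have s0 (z : R[i]) : 0 <= normc z ^+ 2 by exact: sqr_ge0.
by split; rewrite -ler_sqr ?nnegrE ?qnorm_ge0 ?normc_ge0// qnorm_sqr;
  have := s0 (q0 p); have := s0 (q1 p); have := s0 (q2 p); have := s0 (q3 p);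
  lra.
Qed.

(** Each of the four components has squared modulus, and integral of it, at most [2 * e ^ 2]; the
    total [8 * e ^ 2] is below [(3 * e) ^ 2]. *)
Lemma HC_Lnorm_le_fourier (p : \bar R) (f : R -> quat R[i]) (e : R) : (2%:E <= p)%E ->
  0 < e -> HC_integrable f -> (forall xi, qnorm (fourier f xi) <= e / (1 + xi ^+ 2)) ->
  (HC_Lnorm p f <= (3 * e)%:E)%E.
Proof.
move=> p2 e0 [i0 i1 i2 i3] fe.
have c0 xi : normc (cfourier (fun x => q0 (f x)) xi) <= e / (1 + xi ^+ 2).
  by have [/le_trans + _ _ _] := normc_le_qnorm (fourier f xi); apply.
have c1 xi : normc (cfourier (fun x => q1 (f x)) xi) <= e / (1 + xi ^+ 2).
  by have [_ /le_trans + _ _] := normc_le_qnorm (fourier f xi); apply.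
have c2 xi : normc (cfourier (fun x => q2 (f x)) xi) <= e / (1 + xi ^+ 2).
  by have [_ _ /le_trans + _] := normc_le_qnorm (fourier f xi); apply.
have c3 xi : normc (cfourier (fun x => q3 (f x)) xi) <= e / (1 + xi ^+ 2).
  by have [_ _ _ /le_trans +] := normc_le_qnorm (fourier f xi); apply.
have m0 := measurable_normc_sqr i0; have m1 := measurable_normc_sqr i1.
have m2 := measurable_normc_sqr i2; have m3 := measurable_normc_sqr i3.
have E : 8 * e ^+ 2 <= (3 * e) ^+ 2 by nra.
apply: Lnorm_le_sqr => //.
- by rewrite mulr_gt0.
- have ms : measurable_fun setT (@Num.sqrt R).
    by apply: continuous_measurable_fun; exact: sqrt_continuous.
  rewrite /qnorm; apply: (measurableT_comp ms).
  by do 3 (apply: measurable_funD => //).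
- by move=> x; exact: qnorm_ge0.
- apply: ae_imply (ae_and (ae_and (ae_normc_sqr_le i0 c0) (ae_normc_sqr_le i1 c1))
    (ae_and (ae_normc_sqr_le i2 c2) (ae_normc_sqr_le i3 c3))) => x /= [[h0 h1] [h2 h3]].
  rewrite -ler_sqr ?nnegrE ?qnorm_ge0// ?qnorm_sqr; first by lra.
  by rewrite mulr_ge0// ltW.
- under eq_integral do rewrite qnorm_sqr !EFinD.
  have Em (g : R -> R) : measurable_fun setT g -> measurable_fun setT (EFin \o g).
    by move=> mg; exact/measurable_EFinP.
  have l0 (g : R -> quat R[i]) (q : quat R[i] -> R[i]) x :
      (0 <= (normc (q (g x)) ^+ 2)%:E)%E by rewrite lee_fin sqr_ge0.
  rewrite !ge0_integralD//; try (by move=> x _; rewrite ?adde_ge0//);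
    try (by rewrite /=; do ?[apply: emeasurable_funD]; exact: Em).
  apply: (@le_trans _ _ ((2 * e ^+ 2)%:E + (2 * e ^+ 2)%:E + (2 * e ^+ 2)%:E
    + (2 * e ^+ 2)%:E)%E).
    by apply: leeD; [apply: leeD; [apply: leeD|]|]; exact: integral_normc_sqr_le.
  by rewrite -!EFinD lee_fin; lra.
Qed.

Lemma HC_integrableB (f g : R -> quat R[i]) : HC_integrable f -> HC_integrable g ->
  HC_integrable (fun x => f x - g x).
Proof.
have H (f1 g1 : R -> R[i]) : cintegrable f1 -> cintegrable g1 ->
    cintegrable (fun x => f1 x - g1 x).
  move=> fi gi; apply: (@cintegrable_ext _ (fun x => f1 x + (-1) * g1 x)).
    by move=> x; rewrite mulN1r.
  by apply: cintegrableD => //; exact: cintegrableZ.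
by move=> [? ? ? ?] [? ? ? ?]; split; exact: H.
Qed.

Lemma fourierB (f g : R -> quat R[i]) xi : HC_integrable f -> HC_integrable g ->
  fourier (fun x => f x - g x) xi = fourier f xi - fourier g xi.
Proof.
have H (f1 g1 : R -> R[i]) : cintegrable f1 -> cintegrable g1 ->
    cfourier (fun x => f1 x - g1 x) xi = cfourier f1 xi - cfourier g1 xi.
  move=> fi gi; have -> : (fun x => f1 x - g1 x) = (fun x => f1 x + (-1) * g1 x).
    by apply/funext => x; rewrite mulN1r.
  by rewrite cfourierD//; [rewrite cfourierZ// mulN1r | exact: cintegrableZ].
by move=> [i0 i1 i2 i3] [j0 j1 j2 j3]; congr Quat;
  [exact: H i0 j0 | exact: H i1 j1 | exact: H i2 j2 | exact: H i3 j3].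
Qed.

Lemma HC_integrable_dilation k (f : R -> quat R[i]) : 0 < k -> HC_integrable f ->
  HC_integrable (fun x => k%:C *: f (k * x)).
Proof.
move=> k0 [i0 i1 i2 i3]; split.
- exact: cintegrable_dilation k0 i0.
- exact: cintegrable_dilation k0 i1.
- exact: cintegrable_dilation k0 i2.
- exact: cintegrable_dilation k0 i3.
Qed.

Lemma fourier_dilation k (f : R -> quat R[i]) xi : 0 < k -> HC_integrable f ->
  fourier (fun x => k%:C *: f (k * x)) xi = fourier f (xi / k).
Proof.
by move=> k0 [i0 i1 i2 i3]; congr Quat;
  [exact: cfourier_dilation k0 i0 | exact: cfourier_dilation k0 i1
  |exact: cfourier_dilation k0 i2 | exact: cfourier_dilation k0 i3].
Qed.

Lemma qsplit_fourier n1 n2 n3 (f g : R -> R[i]) xi : cintegrable f -> cintegrable g ->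
  HC_integrable (fun x => qsplit n1 n2 n3 (f x) (g x)) /\
  fourier (fun x => qsplit n1 n2 n3 (f x) (g x)) xi =
  qsplit n1 n2 n3 (cfourier f xi) (cfourier g xi).
Proof.
move=> fi gi.
have H (c d : R[i]) (h : R -> R[i]) : (forall x, h x = c * f x + d * g x) ->
    cintegrable h /\ cfourier h xi = c * cfourier f xi + d * cfourier g xi.
  move=> /funext ->; split; first by apply: cintegrableD; exact: cintegrableZ.
  by rewrite cfourierD ?cfourierZ//; exact: cintegrableZ.
have H0 : forall x, (f x + g x) / 2 = 2^-1 * f x + 2^-1 * g x by move=> x; ring.
have Hn (n : R) x : J * ((g x - f x) / 2) * n%:C =
  - (J * n%:C / 2) * f x + (J * n%:C / 2) * g x by ring.
have [[I0 E0] [I1 E1] [I2 E2] [I3 E3]] := And4 (H _ _ _ H0) (H _ _ _ (Hn n1))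
  (H _ _ _ (Hn n2)) (H _ _ _ (Hn n3)).
split; first by [].
congr Quat.
- by apply: (etrans E0); ring.
- by apply: (etrans E1); ring.
- by apply: (etrans E2); ring.
- by apply: (etrans E3); ring.
Qed.

End QuaternionFourier.

(** * From complex exponents back to quaternions, and the two limits *)

Section Limits.
Context {R : realType}.
Variables (v : quat R) (hv : scalar_part v = 0).

Lemma qpow_bspline_baseB n1 n2 n3 m (a xi : R) :
  n1 ^+ 2 + n2 ^+ 2 + n3 ^+ 2 = 1 -> qnorm (toHC v) = m ->
  toHC v = qsplit n1 n2 n3 ('i%C * m%:C) (- ('i%C * m%:C)) ->
  qpow (bspline_base (xi / Num.sqrt a)) (a%:A + v) - gauss_freq (a%:A + v) xi =
  qsplit n1 n2 n3
    (bspline_scalar a m (xi / Num.sqrt a) - freq_scalar a m xi)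
    (bspline_scalar a (- m) (xi / Num.sqrt a) - freq_scalar a (- m) xi).
Proof.
move=> n_unit mE vE; rewrite (gauss_freqE hv n_unit vE) -qsplitB; congr (_ - _).
rewrite /bspline_scalar; have [->|z0] := eqVneq (bspline_base _) 0.
  by rewrite /qpow eqxx; congr Quat; rewrite /= ?addr0 ?subrr ?(mul0r, mulr0).
exact: (qpowE hv mE vE).
Qed.

Lemma qnorm_freq_limit (e : R) : 0 < e -> \forall a \near +oo, forall xi,
  qnorm (qpow (bspline_base (xi / Num.sqrt a)) (a%:A + v) - gauss_freq (a%:A + v) xi)
    <= e / (1 + xi ^+ 2).
Proof.
move=> e0; have [n1 [n2 [n3 [n_unit vE]]]] := toHC_qsplit hv.
have e20 : 0 < e / 2 by rewrite divr_gt0.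
apply: filterS2 (freq_limit (qnorm (toHC v)) e20) (freq_limit (- qnorm (toHC v)) e20).
move=> a H1 H2 xi; rewrite (qpow_bspline_baseB _ _ n_unit erefl vE).
apply: le_trans (qnorm_qsplit_le n_unit _ _) _.
by rewrite [e in leRHS]splitr mulrDl lerD.
Qed.

Lemma gauss_time_fourier (a xi : R) : 0 < a ->
  HC_integrable (gauss_time (a%:A + v)) /\
  fourier (gauss_time (a%:A + v)) xi = gauss_freq (a%:A + v) xi.
Proof.
move=> a0; have [n1 [n2 [n3 [n_unit vE]]]] := toHC_qsplit hv.
rewrite (gauss_freqE hv n_unit vE).
have -> : gauss_time (a%:A + v) = (fun x => qsplit n1 n2 n3
    (time_scalar a (qnorm (toHC v)) x) (time_scalar a (- qnorm (toHC v)) x)).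
  by apply/funext => x; exact: (gauss_timeE hv n_unit erefl vE).
(* Integrability is read off from the transform at [xi = 0], where the character is 1. *)
have ti b : cintegrable (time_scalar a b).
  apply: cintegrable_ext (time_scalar_fourier b 0 a0).1 => x.
  by rewrite mul0r mulr0 oppr0 cexp0 mul1r.
have [I ->] := qsplit_fourier n1 n2 n3 xi (ti (qnorm (toHC v))) (ti (- qnorm (toHC v))).
split=> //; congr qsplit; exact: (time_scalar_fourier _ _ a0).2.
Qed.

End Limits.

Theorem theorem6 (R : realType) (v : quat R) (hv : scalar_part v = 0)
    (B : quat R -> R -> quat R[i])
    (hB : forall a : R, 2 <= a -> is_bspline (a%:A + v) (B (a%:A + v))) :
  (forall p : \bar R, (1 <= p)%E ->
     HC_Lnorm p (fun xi : R =>
       fourier (B (a%:A + v)) (xi / Num.sqrt a) - gauss_freq (a%:A + v) xi)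
     @[a --> +oo] --> 0%E)
  /\
  (forall p' : \bar R, (2 <= p')%E ->
     HC_Lnorm p' (fun x : R =>
       (Num.sqrt a)%:C *: B (a%:A + v) (Num.sqrt a * x)
       - gauss_time (a%:A + v) x)
     @[a --> +oo] --> 0%E).
Proof.
split=> p p1; apply: cvge0_of_le; try by move=> a; exact: Lnorm_ge0.
- move=> e e0; have ep0 : 0 < e / pi by rewrite divr_gt0// pi_gt0.
  near=> a; have [_ hF] : is_bspline (a%:A + v) (B (a%:A + v)) by apply: hB; near: a;
    apply: nbhs_pinfty_ge; exact: num_real.
  rewrite -[e](@divfK _ pi) ?gt_eqF ?pi_gt0//; apply: Lnorm_le_oneDsqr => //.
    by move=> xi; exact: qnorm_ge0.
  by move=> xi; rewrite hF; move: xi; near: a; exact: qnorm_freq_limit.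
- move=> e e0; have e30 : 0 < e / 3 by rewrite divr_gt0.
  near=> a; have a2 : 2 <= a by near: a; apply: nbhs_pinfty_ge; exact: num_real.
  have a0 : 0 < a by exact: lt_le_trans a2.
  have s0 : 0 < Num.sqrt a by rewrite sqrtr_gt0.
  have [Bi hF] := hB _ a2.
  rewrite -[e](@divfK _ 3) ?gt_eqF// mulrC; apply: HC_Lnorm_le_fourier => //.
    apply: HC_integrableB; first exact: HC_integrable_dilation.
    exact: (gauss_time_fourier hv 0 a0).1.
  (* Dilation by [sqrt a] evaluates the transform of the spline at [xi / sqrt a], so the difference
     of transforms is the function of the first claim and the same estimate applies. *)
  move=> xi; rewrite fourierB; last exact: (gauss_time_fourier hv 0 a0).1.
    rewrite fourier_dilation// hF (gauss_time_fourier hv xi a0).2.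
    by move: xi; near: a; exact: qnorm_freq_limit.
  exact: HC_integrable_dilation.
Unshelve. all: by end_near. Qed.
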